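(* Let $H\in\mathcal{G}$, let $\Gamma$ be a compact family in Poly, and let $G=\langle H,\Gamma\rangle$ be the polynomial semigroup generated by $H$ and $\Gamma$. Suppose (1) $G\in\mathcal{G}_{dis}$; (2) $J(\gamma)\cap J_{\min}(G)=\emptyset$ for each $\gamma\in\Gamma$; (3) $H$ is hyperbolic; and (4) for each $\gamma\in\Gamma$, the critical values of $\gamma$ do not meet $J_{\min}(G)$. Then $G$ is hyperbolic.
   Context: A polynomial semigroup is a semigroup of non-constant complex polynomials, regarded as self-maps of $\hat{\mathbb{C}}$, under composition. For such $G$, $F(G)$ is the set of points having a neighborhood on which $G$ is normal, $J(G)=\hat{\mathbb{C}}\setminus F(G)$, $J(g)=J(\langle g\rangle)$. $P(G)$ is the closure in $\hat{\mathbb{C}}$ of the set of all critical values of all $g\in G$, $P^*(G)=P(G)\setminus\{\infty\}$; $G$ is hyperbolic if $P(G)\subset F(G)$. $\mathcal{G}$: polynomial semigroups all of whose elements have degree $\ge2$ and with $P^*(G)$ bounded in $\mathbb{C}$; $\mathcal{G}_{dis}$: those $G\in\mathcal{G}$ with $J(G)$ disconnected. $\hat K(G)=\{z\in\mathbb{C}:\{g(z):g\in G\}\text{ bounded}\}$. For $G\in\mathcal{G}_{dis}$, $J_{\min}(G)$ is the unique connected component of $J(G)$ (not containing $\infty$) which meets $\partial\hat K(G)$. Poly is the set of all polynomials with the topology of uniform convergence on $\hat{\mathbb{C}}$ with respect to the spherical metric. *)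

(* Defs.v *)
From HB Require Import structures.
From mathcomp Require Import all_boot all_order all_algebra.
From mathcomp Require Import complex.
From mathcomp Require Import reals.
From Stdlib Require List.
Set Implicit Arguments. Unset Strict Implicit. Unset Printing Implicit Defensive.
Import Order.TTheory GRing.Theory Num.Theory.
Local Open Scope ring_scope.

Section PolySemigroups.
Variable R : realType.
Local Notation C := (R[i]).

(* The Riemann sphere: [Some z] is the finite point z, [None] is infinity. *)
Definition sphere := option C.

Definition cnorm (z : C) : R := Normc.normc z.

Definition sdist (z w : sphere) : R :=
  match z, w with
  | Some a, Some b =>
      2 * cnorm (a - b) / Num.sqrt ((1 + cnorm a ^+ 2) * (1 + cnorm b ^+ 2))
  | Some a, None | None, Some a => 2 / Num.sqrt (1 + cnorm a ^+ 2)
  | None, None => 0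
  end.

Definition pmap (p : {poly C}) (z : sphere) : sphere :=
  match z with
  | Some x => Some p.[x]
  | None => if (size p <= 1)%N then Some p`_0 else None
  end.

Definition sopen (U : sphere -> Prop) : Prop :=
  forall z, U z -> exists2 r : R, 0 < r & forall w, sdist z w < r -> U w.

Definition sclosure (A : sphere -> Prop) (z : sphere) : Prop :=
  forall r : R, 0 < r -> exists2 w, A w & sdist z w < r.

Definition sboundary (A : sphere -> Prop) (z : sphere) : Prop :=
  sclosure A z /\ sclosure (fun w => ~ A w) z.

Definition rel_open (A B : sphere -> Prop) : Prop :=
  (forall z, B z -> A z) /\
  forall z, B z -> exists2 r : R, 0 < r &
    forall w, A w -> sdist z w < r -> B w.

Definition sconnected (A : sphere -> Prop) : Prop :=
  ~ exists B1 B2 : sphere -> Prop,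
      [/\ rel_open A B1, rel_open A B2,
          (exists z, B1 z), (exists z, B2 z) &
          (forall z, A z -> B1 z \/ B2 z) /\
          (forall z, ~ (B1 z /\ B2 z))].

Definition component (A : sphere -> Prop) (x z : sphere) : Prop :=
  exists K : sphere -> Prop,
    [/\ forall w, K w -> A w, sconnected K, K x & K z].

Definition comp_closed (S : {poly C} -> Prop) : Prop :=
  forall g h, S g -> S h -> S (g \Po h).

Definition poly_semigroup (S : {poly C} -> Prop) : Prop :=
  [/\ exists g, S g, (forall g, S g -> (1 < size g)%N) & comp_closed S].

Definition generated (A : {poly C} -> Prop) (p : {poly C}) : Prop :=
  forall T : {poly C} -> Prop,
    (forall q, A q -> T q) -> comp_closed T -> T p.

Definition normal_on (F : {poly C} -> Prop) (U : sphere -> Prop) : Prop :=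
  forall g : nat -> {poly C}, (forall n, F (g n)) ->
  exists phi : nat -> nat, (forall n, (phi n < phi n.+1)%N) /\
  exists f : sphere -> sphere,
    forall w, U w -> exists2 r : R, 0 < r &
      forall eps : R, 0 < eps -> exists N, forall n, (N <= n)%N ->
        forall z, U z -> sdist w z < r ->
          sdist (pmap (g (phi n)) z) (f z) < eps.

Definition Fatou (G : {poly C} -> Prop) (z : sphere) : Prop :=
  exists U, [/\ sopen U, U z & normal_on G U].

Definition Julia (G : {poly C} -> Prop) (z : sphere) : Prop := ~ Fatou G z.

Definition Julia1 (g : {poly C}) : sphere -> Prop :=
  Julia (generated (fun q => q = g)).

(* Critical values of g as a self-map of the sphere
   (infinity is a critical value when deg g >= 2). *)
Definition critval (g : {poly C}) (w : sphere) : Prop :=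
  (exists c : C, (g^`()).[c] = 0 /\ w = Some g.[c])
  \/ (w = None /\ (2 < size g)%N).

Definition Pset (G : {poly C} -> Prop) : sphere -> Prop :=
  sclosure (fun w => exists2 g, G g & critval g w).

Definition hyperbolic (G : {poly C} -> Prop) : Prop :=
  forall z, Pset G z -> Fatou G z.

Definition classG (G : {poly C} -> Prop) : Prop :=
  [/\ poly_semigroup G,
      (forall g, G g -> (2 < size g)%N) &
      exists M : R, forall z : C, Pset G (Some z) -> cnorm z <= M].

Definition classGdis (G : {poly C} -> Prop) : Prop :=
  classG G /\ ~ sconnected (Julia G).

Definition Khat (G : {poly C} -> Prop) (z : sphere) : Prop :=
  exists2 x : C, z = Some x &
    exists M : R, forall g, G g -> cnorm g.[x] <= M.

(* J_min(G): the component(s) of J(G) not containing infinity that meet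
   the boundary of \hat K(G).  (For G in G_dis there is exactly one.) *)
Definition Jmin (G : {poly C} -> Prop) (z : sphere) : Prop :=
  exists x, [/\ component (Julia G) x z,
                ~ component (Julia G) x None &
                exists2 y, component (Julia G) x y & sboundary (Khat G) y].

Definition poly_open (U : {poly C} -> Prop) : Prop :=
  forall p, U p -> exists2 e : R, 0 < e &
    forall q, (forall z, sdist (pmap q z) (pmap p z) < e) -> U q.

Definition poly_compact (K : {poly C} -> Prop) : Prop :=
  forall (I : Type) (U : I -> {poly C} -> Prop),
    (forall i, poly_open (U i)) ->
    (forall p, K p -> exists i, U i p) ->
    exists s : seq I, forall p, K p -> exists i, (List.In i s) /\ U i p.

End PolySemigroups.

(* Main.v *)
Require Import Defs.
From HB Require Import structures.
From mathcomp Require Import all_boot all_order all_algebra.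
From mathcomp Require Import complex reals.
From mathcomp Require Import boolp classical_sets.
From mathcomp Require Import ring lra.
Set Implicit Arguments. Unset Strict Implicit. Unset Printing Implicit Defensive.
Import Order.TTheory GRing.Theory Num.Theory.
Local Open Scope ring_scope.
Local Open Scope complex_scope.

Local Notation Re := (@complex.Re _).
Local Notation Im := (@complex.Im _).
Local Notation pmap := Defs.pmap.

(** Let K be the filled set of G. As the critical values of the elements of G
    have bounded G-orbits, P*(G) lies in K, the interior of K lies in F(G), and
    a point of P(G) in J(G) lies on the boundary of K, which is contained in
    J_min(G). Two facts exclude such points.

    Each gamma in Gamma maps K into the interior of K, uniformly by compactness.
    Indeed, suppose that z and gamma z are boundary points of K. Some level curve
    [|f| = r], f in G, passes near gamma z; it is connected because it encloses
    all critical values of f, and it is close to J(G). Its preimages under the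
    iterates of gamma are chained to each other and reach the boundary of the
    filled Julia set of gamma, so that J(gamma) meets J_min(G).

    If z in P(G) is a boundary point of K then: if z is in P(H), it is in F(H),
    so H is equicontinuous at z, and a generator gamma sends the points near K
    into K, which makes z an interior point of K. Otherwise z is a limit of
    [h(l)] with h in H and l deep inside K; the inverse branches of h near z are
    equicontinuous and bring points outside K next to l, which is absurd.

    Normality is handled by elementary means: the maximum principle for
    quotients of polynomials, proved as in the fundamental theorem of algebra,
    gives the Schwarz lemma for a polynomial and for its reciprocal. *)

(** * Modulus, sequences and compactness in C *)

(** Topology enters through sequences only. Components are reached by finite chains of small step:
    as J(G) is compact, the points reachable from a given one by chains of every step form a
    connected set. Covering theory is also reduced to compactness: a polynomial of constant degree,
    with coefficients depending on a parameter in a disc and with simple roots throughout, has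
    uniformly separated roots that move uniformly continuously, so its sheets can be labelled by the
    central fibre. This serves twice: for the inverse branches of [h] and, after a substitution z =
    y / w that brings infinity to w = 0, for the connectedness of level curves.

    The dynamics rests on one radius [r] such that |g(w)| >= 2 |w| for |w| >= r and every g in G. It
    exists because infinity lies in P(H), hence in F(H), and because Gamma is compact. It turns K
    into the set where all |g| are at most [r], and any escape beyond [r] into a conflict with
    equicontinuity, after one more element of the semigroup is applied. *)

Section Norm.
Variable R : realType.
Implicit Types (x y z : R[i]) (e : R).

Lemma cnorm_def z : cnorm z = Num.sqrt (Re z ^+ 2 + Im z ^+ 2).
Proof. by case: z. Qed.

Lemma cnorm_sqr z : cnorm z ^+ 2 = Re z ^+ 2 + Im z ^+ 2.
Proof. by rewrite cnorm_def sqr_sqrtr // addr_ge0 // sqr_ge0. Qed.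

Lemma cnorm_ge0 z : 0 <= cnorm z.
Proof. by rewrite cnorm_def sqrtr_ge0. Qed.
Hint Resolve cnorm_ge0 : core.

Lemma cnorm0 : cnorm (0 : R[i]) = 0. Proof. exact: Normc.normc0. Qed.
Lemma cnorm1 : cnorm (1 : R[i]) = 1. Proof. exact: Normc.normc1. Qed.

Lemma cnorm_eq0 z : (cnorm z == 0) = (z == 0).
Proof. by apply/eqP/eqP => [/Normc.eq0_normc|->] //; rewrite cnorm0. Qed.

Lemma cnorm_gt0 z : (0 < cnorm z) = (z != 0).
Proof. by rewrite lt_def cnorm_ge0 andbT cnorm_eq0. Qed.

Lemma cnormM : {morph @cnorm R : x y / x * y}.
Proof. exact: Normc.normcM. Qed.

Lemma cnormV z : cnorm z^-1 = (cnorm z)^-1.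
Proof. exact: Normc.normcV. Qed.

Lemma cnormX z n : cnorm (z ^+ n) = cnorm z ^+ n.
Proof. by elim: n => [|n IH]; rewrite ?expr0 ?cnorm1 // !exprS cnormM IH. Qed.

Lemma cnormN z : cnorm (- z) = cnorm z.
Proof. exact: normcN. Qed.

Lemma cnormD x y : cnorm (x + y) <= cnorm x + cnorm y.
Proof. exact: le_normcD. Qed.

Lemma cdistC x y : cnorm (x - y) = cnorm (y - x).
Proof. by rewrite -cnormN opprB. Qed.

Lemma cdist_triangle y x z : cnorm (x - z) <= cnorm (x - y) + cnorm (y - z).
Proof. by apply: le_trans (cnormD _ _); rewrite addrA subrK. Qed.

Lemma cnorm_le_dist x y : cnorm x <= cnorm y + cnorm (x - y).
Proof. by apply: le_trans (cnormD _ _); rewrite addrC subrK. Qed.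

Lemma cnorm_lip x y : `|cnorm x - cnorm y| <= cnorm (x - y).
Proof.
have h1 := cnorm_le_dist x y; have h2 := cnorm_le_dist y x; move: h1 h2.
by rewrite (cdistC y) ler_norml => h1 h2; lra.
Qed.

Lemma cnormB x y : cnorm (x - y) <= cnorm x + cnorm y.
Proof. by apply: le_trans (cnormD _ _) _; rewrite cnormN. Qed.

Lemma cnorm_real (r : R) : cnorm r%:C = `|r|.
Proof. by rewrite cnorm_def /= expr0n /= addr0 sqrtr_sqr. Qed.

Lemma normRe_le z : `|Re z| <= cnorm z.
Proof.
by rewrite -sqrtr_sqr cnorm_def ler_sqrt ?addr_ge0 ?sqr_ge0 // lerDl sqr_ge0.
Qed.

Lemma normIm_le z : `|Im z| <= cnorm z.
Proof.
by rewrite -sqrtr_sqr cnorm_def ler_sqrt ?addr_ge0 ?sqr_ge0 // lerDr sqr_ge0.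
Qed.

Lemma cnorm_leReIm z : cnorm z <= `|Re z| + `|Im z|.
Proof.
have h : 0 <= `|Re z| + `|Im z| by rewrite addr_ge0.
rewrite -[leRHS]ger0_norm // -sqrtr_sqr cnorm_def ler_sqrt ?sqr_ge0 //.
rewrite sqrrD -(real_normK (num_real (Re z))) -(real_normK (num_real (Im z))).
by rewrite lerD2r lerDl mulrn_wge0 // mulr_ge0.
Qed.

Lemma cnorm_prod (I : Type) (s : seq I) (F : I -> R[i]) :
  cnorm (\prod_(i <- s) F i) = \prod_(i <- s) cnorm (F i).
Proof. by apply: (big_morph (@cnorm R)); [exact: cnormM | exact: cnorm1]. Qed.

End Norm.
#[export] Hint Extern 0 (is_true (0 <= cnorm _)) => exact: cnorm_ge0 : core.

Section Sequences.
Variable R : realType.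

Definition ccvg (u : nat -> R[i]) (l : R[i]) :=
  forall e : R, 0 < e -> exists N, forall n, (N <= n)%N -> cnorm (u n - l) < e.

Definition extraction (phi : nat -> nat) := forall n, (phi n < phi n.+1)%N.

Lemma extraction_ge phi : extraction phi -> forall n, (n <= phi n)%N.
Proof. by move=> h; elim=> // n IH; apply: leq_ltn_trans IH (h n). Qed.

Lemma extraction_mono phi : extraction phi -> {homo phi : m n / (m <= n)%N}.
Proof.
move=> h m n; elim: n => [|n IH]; first by rewrite leqn0 => /eqP ->.
by rewrite leq_eqVlt => /orP[/eqP -> //|/IH /leq_trans]; apply; apply: ltnW.
Qed.

Lemma extraction_lt phi : extraction phi -> {homo phi : m n / (m < n)%N}.
Proof. by move=> h m n mn; apply: leq_trans (h m) (extraction_mono h mn). Qed.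

Lemma extraction_comp phi psi : extraction phi -> extraction psi ->
  extraction (phi \o psi).
Proof. by move=> h k n; apply: (extraction_lt h) (k n). Qed.

Lemma extract (P : nat -> nat -> Prop) :
  (forall k N, exists2 n, (N <= n)%N & P k n) ->
  exists2 phi, extraction phi & forall k, P k (phi k).
Proof.
move=> h.
have /choice[f hf] : forall kN : nat * nat, exists n, (kN.2 <= n)%N /\ P kN.1 n.
  by move=> [k N]; have [n ? ?] := h k N; exists n.
pose phi := fix phi n := if n is m.+1 then f (m.+1, (phi m).+1) else f (0, 0)%N.
exists phi; first by move=> n; exact: (hf (n.+1, (phi n).+1)).1.
by case=> [|k]; [exact: (hf (0, 0)%N).2 | exact: (hf (k.+1, (phi k).+1)).2].
Qed.

Lemma invn_lt (e : R) : 0 < e -> exists N, forall n, (N <= n)%N -> n.+1%:R^-1 < e.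
Proof.
move=> e0; have i0 : 0 <= e^-1 by rewrite invr_ge0 ltW.
have := archi_boundP i0.
set N := Num.bound _ => hN; exists N => n Nn.
rewrite -[ltRHS]invrK ltf_pV2 ?posrE ?invr_gt0 ?ltr0n //.
by apply: lt_trans hN _; rewrite ltr_nat ltnS.
Qed.

Lemma bolzano_real (u : nat -> R) (M : R) : (forall n, `|u n| <= M) ->
  exists2 phi, extraction phi & exists l : R,
    forall e : R, 0 < e -> exists N, forall n, (N <= n)%N -> `|u (phi n) - l| < e.
Proof.
(* The supremum of [S] is the upper limit of [u]: only finitely many terms exceed it by a fixed
   amount. *)
move=> uM; pose S : set R := fun x => forall N, exists2 n, (N <= n)%N & x <= u n.
have S0 : S (- M).
  by move=> N; exists N => //; have := uM N; rewrite ler_norml => /andP[].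
have Sub : has_ubound S.
  exists M => x /(_ 0%N)[n _ xn]; apply: le_trans xn _.
  by have := uM n; rewrite ler_norml => /andP[].
have Ssup : has_sup S by split=> //; exists (- M).
pose l := sup S.
have near k N : exists2 n, (N <= n)%N & `|u n - l| < k.+1%:R^-1.
  have e0 : 0 < k.+1%:R^-1 :> R by rewrite invr_gt0 ltr0n.
  move: (k.+1%:R^-1) e0 => e e0.
  have [x Sx lx] := sup_adherent e0 Ssup.
  have nS : ~ S (l + e / 2).
    by move=> /(ub_le_sup Sub); rewrite -/l gerDl; apply/negP; rewrite -ltNge divr_gt0.
  have [N' hN'] : exists N', forall n, (N' <= n)%N -> u n < l + e / 2.
    apply: contrapT => h; apply: nS => N'; apply: contrapT => h'; apply: h; exists N' => n N'n.
    by rewrite ltNge; apply/negP => ?; apply: h'; exists n.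
  have [n] := Sx (maxn N N'); rewrite geq_max => /andP[Nn N'n] xn.
  exists n => //; rewrite ltr_norml; apply/andP; split.
    by rewrite ltrBrDl; apply: lt_le_trans lx xn.
  rewrite ltrBlDl; apply: lt_le_trans (hN' _ N'n) _.
  by rewrite lerD2l; move: e0; clear; lra.
have [phi hphi Pphi] := extract near.
exists phi => //; exists l => e e0; have [N hN] := invn_lt e0; exists N => n Nn.
exact: lt_trans (Pphi n) (hN _ Nn).
Qed.

Lemma bolzano (u : nat -> R[i]) (M : R) : (forall n, cnorm (u n) <= M) ->
  exists2 phi, extraction phi & exists l, ccvg (u \o phi) l.
Proof.
move=> uM.
have [phi hphi [a ha]] := @bolzano_real (fun n => Re (u n)) M
  (fun n => le_trans (normRe_le _) (uM n)).
have [psi hpsi [b hb]] := @bolzano_real (fun n => Im (u (phi n))) M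
  (fun n => le_trans (normIm_le _) (uM _)).
exists (phi \o psi); first exact: extraction_comp.
exists (Complex a b) => e e0.
have e20 : 0 < e / 2 by rewrite divr_gt0.
have [N1 h1] := ha _ e20; have [N2 h2] := hb _ e20.
exists (maxn N1 N2) => n; rewrite geq_max => /andP[n1 n2].
apply: le_lt_trans (cnorm_leReIm _) _.
have /h1 := leq_trans n1 (extraction_ge hpsi n).
have := h2 _ n2.
rewrite /=; case: (u _) => x y /=.
lra.
Qed.

Lemma ccvg_extraction (u : nat -> R[i]) l phi :
  ccvg u l -> extraction phi -> ccvg (u \o phi) l.
Proof.
move=> ul hphi e /ul[N hN]; exists N => n Nn; apply: hN.
exact: leq_trans Nn (extraction_ge hphi n).
Qed.

Lemma ccvg_unique (u : nat -> R[i]) l l' : ccvg u l -> ccvg u l' -> l = l'.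
Proof.
move=> h h'; apply/eqP; rewrite -subr_eq0 -cnorm_eq0; apply: contraT => n0.
have e0 : 0 < cnorm (l - l') / 2 by rewrite divr_gt0 // lt_def n0 cnorm_ge0.
have [N hN] := h _ e0; have [N' hN'] := h' _ e0.
have := hN (maxn N N') (leq_maxl _ _); have := hN' (maxn N N') (leq_maxr _ _).
have := cdist_triangle (u (maxn N N')) l l'; rewrite (cdistC l (u _)); lra.
Qed.

Definition cclosed (X : R[i] -> Prop) :=
  forall u l, (forall n, X (u n)) -> ccvg u l -> X l.

Definition cbounded (X : R[i] -> Prop) := exists M, forall x, X x -> cnorm x <= M.

Definition cts (f : R[i] -> R[i]) := forall x e, 0 < e ->
  exists2 d : R, 0 < d & forall y, cnorm (y - x) < d -> cnorm (f y - f x) < e.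

Definition rcts_at (X : R[i] -> Prop) (f : R[i] -> R) x := forall e : R, 0 < e ->
  exists2 d : R, 0 < d & forall y, X y -> cnorm (y - x) < d -> `|f y - f x| < e.

Lemma evt (X : R[i] -> Prop) (f : R[i] -> R) x0 :
  cclosed X -> cbounded X -> X x0 -> (forall x, X x -> rcts_at X f x) ->
  exists2 x, X x & forall y, X y -> f y <= f x.
Proof.
move=> Xc [M XM] Xx0 fc.
have sub u : (forall n, X (u n)) -> exists2 phi, extraction phi &
    exists2 l, X l & forall e : R, 0 < e -> exists N, forall n, (N <= n)%N -> `|f (u (phi n)) - f l| < e.
  move=> Xu; have [phi hphi [l ul]] := @bolzano u M (fun n => XM _ (Xu n)).
  have Xl : X l by apply: Xc ul => n; apply: Xu.
  exists phi => //; exists l => // e /(fc _ Xl)[d /ul[N hN] hd].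
  by exists N => n /hN ?; apply: hd.
pose S : set R := fun r => exists2 x, X x & f x = r.
have S0 : S (f x0) by exists x0.
have Sub : has_ubound S.
  apply: contrapT => nub.
  have /choice[u hu] : forall n : nat, exists x, X x /\ n%:R <= f x.
    move=> n; apply: contrapT => h; apply: nub; exists n%:R => r [x Xx <-].
    by rewrite leNgt; apply/negP => ?; apply: h; exists x; split => //; apply: ltW.
  have [phi hphi [l _ /(_ 1 ltr01)[N hN]]] := sub u (fun n => (hu n).1).
  pose n := maxn N (Num.bound (`|f l| + 1)).
  have := hN n (leq_maxl _ _); have := (hu (phi n)).2.
  have : (Num.bound (`|f l| + 1))%:R <= (phi n)%:R :> R.
    by rewrite ler_nat; apply: leq_trans (leq_maxr _ _) (extraction_ge hphi _).
  have : `|f l| + 1 < (Num.bound (`|f l| + 1))%:R by apply: archi_boundP; rewrite addr_ge0.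
  have := ler_norm (f l); rewrite ltr_norml => ? ? ? ? /andP[? ?]; lra.
have Ssup : has_sup S by split=> //; exists (f x0).
have /choice[u hu] : forall n : nat, exists x, X x /\ sup S - n.+1%:R^-1 < f x.
  move=> n; have e0 : 0 < n.+1%:R^-1 :> R by rewrite invr_gt0 ltr0n.
  by have [r [x Xx <-] ?] := sup_adherent e0 Ssup; exists x.
have [phi hphi [l Xl hl]] := sub u (fun n => (hu n).1).
exists l => // y Xy; have fy : f y <= sup S by apply: ub_le_sup => //; exists y.
apply: le_trans fy _; rewrite leNgt; apply/negP => lt.
have e0 : 0 < (sup S - f l) / 2 by rewrite divr_gt0 // subr_gt0.
have [N hN] := hl _ e0; have [N' hN'] := invn_lt e0.
pose n := maxn N N'.
have := hN n (leq_maxl _ _).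
have := hN' (phi n) (leq_trans (leq_maxr _ _) (extraction_ge hphi _)).
have := (hu (phi n)).2; move: (phi n).+1%:R^-1 => i; rewrite ltr_norml => ? ? /andP[? ?]; lra.
Qed.

Definition segp (x y : R[i]) (t : R) := x + t%:C * (y - x).

Lemma segment_cross (P : R[i] -> Prop) x y : P x -> ~ P y ->
  exists2 t : R, 0 <= t <= 1 & forall e : R, 0 < e ->
    (exists2 w, P w & cnorm (w - segp x y t) < e) /\
    (exists2 w, ~ P w & cnorm (w - segp x y t) < e).
Proof.
move=> Px Py.
pose S : set R := fun t => 0 <= t <= 1 /\ P (segp x y t).
have s0 : segp x y 0 = x by rewrite /segp mul0r addr0.
have s1 : segp x y 1 = y by rewrite /segp mul1r addrC subrK.
have S0 : S 0 by split; [rewrite lexx ler01 | rewrite s0].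
have Sub : has_ubound S by exists 1 => t [/andP[]].
have Ssup : has_sup S by split=> //; exists 0.
have t0 : 0 <= sup S by apply: ub_le_sup.
have t1 : sup S <= 1 by apply: ge_sup; [exists 0 | move=> t [/andP[]]].
exists (sup S); first by rewrite t0 t1.
have dist t t' : cnorm (segp x y t - segp x y t') = `|t - t'| * cnorm (y - x).
  rewrite -cnorm_real -cnormM /segp rmorphB; congr cnorm; ring.
move=> e e0; pose d := e / (cnorm (y - x) + 1).
have d0 : 0 < d by rewrite divr_gt0 // ltr_wpDl.
have hd t : `|t - sup S| < d -> cnorm (segp x y t - segp x y (sup S)) < e.
  move=> h; rewrite dist; apply: le_lt_trans (_ : _ <= `|t - sup S| * (cnorm (y - x) + 1)) _.
    by rewrite ler_wpM2l // lerDl.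
  by rewrite -ltr_pdivlMr // ltr_wpDl.
split.
  have [t St lt] := sup_adherent d0 Ssup.
  exists (segp x y t); first exact: St.2.
  apply: hd; rewrite ltr_norml; have := ub_le_sup Sub St; move: lt d0; rewrite -/(sup S); lra.
(* Times past the supremum are outside [P]; if at most [d / 2] remains before 1, the endpoint [y] is
   close enough. *)
have [lt|ge] := ltP (sup S + d / 2) 1.
  exists (segp x y (sup S + d / 2)); last first.
    by apply: hd; rewrite addrAC subrr add0r ger0_norm; lra.
  move=> h; have : S (sup S + d / 2) by split=> //; lra.
  by move=> /(ub_le_sup Sub); rewrite -/(sup S); lra.
exists y => //; rewrite -{1}s1; apply: hd; rewrite ltr_norml; lra.
Qed.

End Sequences.

(** * The maximum principle for quotients of polynomials *)

Section Polynomials.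
Variable R : realType.
Implicit Types (p q g s : {poly R[i]}) (x y z w a t : R[i]).

Lemma poly_bounded p (M : R) :
  exists2 B : R, 0 <= B & forall x, cnorm x <= M -> cnorm p.[x] <= B.
Proof.
elim/poly_ind: p => [|p c [B B0 IH]].
  by exists 0 => // x _; rewrite horner0 cnorm0.
have [M0|M0] := ltP M 0.
  by exists 0 => // x; rewrite leNgt (lt_le_trans M0).
exists (B * M + cnorm c); first by rewrite addr_ge0 // mulr_ge0.
move=> x xM; rewrite hornerMXaddC; apply: le_trans (cnormD _ _) _.
by rewrite lerD2r cnormM ler_pM // IH.
Qed.

Lemma factor_at p a : exists s, p = (p.[a])%:P + s * ('X - a%:P).
Proof.
have /factor_theorem[s hs] : root (p - (p.[a])%:P) a.
  by rewrite /root !hornerE subrr.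
by exists s; rewrite -hs addrC subrK.
Qed.

Lemma horner_factor p s a : p = (p.[a])%:P + s * ('X - a%:P) ->
  forall w, p.[w] - p.[a] = s.[w] * (w - a).
Proof. by move=> {1}-> w; rewrite !hornerE addrAC subrr add0r. Qed.

Lemma deriv_factor p s a : p = (p.[a])%:P + s * ('X - a%:P) -> p^`().[a] = s.[a].
Proof.
move=> ->; rewrite derivD derivC add0r derivM derivXsubC mulr1.
by rewrite !hornerE subrr mulr0 add0r.
Qed.

Lemma cts_poly p : cts (horner p).
Proof.
move=> x e e0; have [s /horner_factor hs] := factor_at p x.
have [B B0 hB] := poly_bounded s (cnorm x + 1).
have B1 : 0 < B + 1 by rewrite ltr_wpDl.
exists (Num.min 1 (e / (B + 1))); first by rewrite lt_min ltr01 divr_gt0.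
move=> y; rewrite lt_min => /andP[y1 ye].
rewrite hs cnormM; apply: le_lt_trans (_ : _ <= (B + 1) * cnorm (y - x)) _.
  rewrite ler_wpM2r // (le_trans (hB _ _)) ?lerDl //.
  by apply: le_trans (cnorm_le_dist _ x) _; rewrite lerD2l ltW.
by rewrite mulrC -ltr_pdivlMr.
Qed.

Lemma ccvg_poly p (u : nat -> R[i]) l :
  ccvg u l -> ccvg (fun n => p.[u n]) p.[l].
Proof.
by move=> ul e /(cts_poly p l)[d /ul[N hN] hd]; exists N => n /hN/hd.
Qed.

Lemma ccvg_norm_le (u : nat -> R[i]) l (M : R) :
  ccvg u l -> (forall N, exists2 n, (N <= n)%N & cnorm (u n) <= M) -> cnorm l <= M.
Proof.
move=> ul uM; rewrite leNgt; apply/negP => Ml.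
have /ul[N hN] : 0 < cnorm l - M by rewrite subr_gt0.
have [n /hN] := uM N; have := cnorm_le_dist l (u n); rewrite cdistC; lra.
Qed.

(** If all roots of [p - t] were at distance at least [s] from [x], their product formula would
    contradict the bound. The bound involves only degree and leading coefficient, hence a
    quantitative open mapping property, uniform in [x] and [t]. *)
Lemma root_near p x t (s : R) : 0 <= s -> (1 < size p)%N ->
  cnorm (p.[x] - t) < cnorm (lead_coef p) * s ^+ (size p).-1 ->
  exists2 y, p.[y] = t & cnorm (y - x) < s.
Proof.
move=> s0 sp h.
have szt : size (p - t%:P) = size p.
  by rewrite size_polyDl // size_polyN (leq_ltn_trans (size_polyC_leq1 _)).
have lct : lead_coef (p - t%:P) = lead_coef p.
  by rewrite lead_coefDl // size_polyN (leq_ltn_trans (size_polyC_leq1 _)).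
have hE w : (p - t%:P).[w] = p.[w] - t by rewrite !hornerE.
have [rs hrs] := closed_field_poly_normal (p - t%:P).
have p0 : p - t%:P != 0 by rewrite -size_poly_eq0 szt -lt0n ltnW.
have szrs : size rs = (size p).-1.
  rewrite -szt {1}hrs size_scale ?lead_coef_eq0 // size_prod_XsubC //.
apply: contrapT => nex; move: h; apply/negP; rewrite -leNgt.
have -> : p.[x] - t = lead_coef p * \prod_(z <- rs) (x - z).
  rewrite -lct -hE {1}hrs.
  by rewrite hornerZ horner_prod; congr (_ * _); apply: eq_bigr => z _; rewrite !hornerE.
rewrite cnormM cnorm_prod ler_wpM2l // -szrs.
have : {in rs, forall z, s <= cnorm (x - z)}.
  move=> z zrs; rewrite leNgt; apply/negP => lt; apply: nex; exists z; last by rewrite cdistC.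
  apply/eqP; rewrite -subr_eq0 -hE hrs hornerZ.
  have /eqP -> : root (\prod_(z <- rs) ('X - z%:P)) z by rewrite root_prod_XsubC.
  by rewrite mulr0.
elim: (rs) => [|z l IH] hl; first by rewrite big_nil expr0.
rewrite big_cons exprS ler_pM // ?exprn_ge0 //; first by apply: hl; rewrite mem_head.
by apply: IH => y yl; apply: hl; rewrite inE yl orbT.
Qed.

Lemma root_close p (s : R) : 0 < s -> (1 < size p)%N -> exists2 k : R, 0 < k &
  forall x t, cnorm (p.[x] - t) < k -> exists2 y, p.[y] = t & cnorm (y - x) < s.
Proof.
move=> s0 sp; exists (cnorm (lead_coef p) * s ^+ (size p).-1).
  by rewrite mulr_gt0 ?exprn_gt0 // cnorm_gt0 lead_coef_eq0 -size_poly_gt0 ltnW.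
by move=> x t; apply: root_near => //; apply: ltW.
Qed.

Lemma poly_surj p t : (1 < size p)%N -> exists y, p.[y] = t.
Proof.
move=> sp; have [k k0 _] := root_close ltr01 sp.
pose s := cnorm (p.[0] - t) / cnorm (lead_coef p) + 1.
have l0 : 0 < cnorm (lead_coef p).
  by rewrite cnorm_gt0 lead_coef_eq0 -size_poly_gt0 ltnW.
have s1 : 1 <= s by rewrite lerDr divr_ge0.
have [|y <- _] := @root_near p 0 t s (le_trans ler01 s1) sp; last by exists y.
rewrite mulrC -ltr_pdivrMr //; apply: lt_le_trans (_ : s <= _).
  by rewrite ltrDl.
case: (size p) sp => // -[|n] // _.
by rewrite exprS ler_peMr ?exprn_ege1 //; lra.
Qed.

(** The hypothesis forces Re(conj(a) y) > 0, so a move along [y] increases the modulus for steps of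
    any length. *)
Lemma cnorm_ltD_dir a y (t : R) : 0 < t -> cnorm (y - a) < cnorm a ->
  cnorm a < cnorm (a + t%:C * y).
Proof.
move=> t0; rewrite -(ltr_pXn2r (n := 2)) ?nnegrE // => h.
rewrite -(ltr_pXn2r (n := 2)) ?nnegrE //.
move: h; rewrite !cnorm_sqr; case: a => a1 a2; case: y => y1 y2 /=.
rewrite !mul0r subr0 addr0 => h.
have h1 : 0 < 2 * (a1 * y1 + a2 * y2) by nra.
nra.
Qed.

(* Same expansion as in the proof of the fundamental theorem of algebra: near
   [x], [p / q = c + b * (w - x)^k + ...] increases in modulus in some
   direction unless it is constant. *)
Lemma local_max p q x (r : R) : 0 < r -> p.[x] != 0 -> q.[x] != 0 ->
  (forall w, cnorm (w - x) < r ->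
    cnorm p.[w] * cnorm q.[x] <= cnorm p.[x] * cnorm q.[w]) ->
  q.[x] *: p = p.[x] *: q.
Proof.
move=> r0 px qx h; apply/eqP; rewrite -subr_eq0; apply: contraT => P0.
have [k [s]] := multiplicity_XsubC (q.[x] *: p - p.[x] *: q) x.
rewrite P0 /= => sx hP.
have k0 : (0 < k)%N.
  rewrite lt0n; apply/negP => /eqP k0; move: sx; rewrite -[s]mulr1 -(expr0 ('X - x%:P)) -k0 -hP.
  by rewrite /root !hornerE mulrC subrr eqxx.
pose A0 := p.[x] * q.[x].
have A0n : 0 < cnorm A0 by rewrite cnorm_gt0 mulf_neq0.
(* As [e ^+ k * s.[x] = A0], a step [t * e] from [x] adds to [p.[x] * q.[w]], which is close to
   [A0], a term close to [t ^+ k * A0]: the directions agree and the modulus grows. *)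
pose e := k.-root (A0 / s.[x]).
have ek : e ^+ k = A0 / s.[x] by rewrite /e rootCK.
have e0 : 0 < cnorm e.
  rewrite cnorm_gt0; apply: contraTneq A0n => e0; move: ek.
  rewrite e0 expr0n gtn_eqF // => /esym /eqP.
  by rewrite mulf_eq0 invr_eq0 -rootE (negPf sx) orbF => /eqP ->; rewrite cnorm0 ltxx.
have A02 : 0 < cnorm A0 / 2 by rewrite divr_gt0.
have [d1 d10 h1] := cts_poly (e ^+ k *: s - p.[x] *: q) x A02.
have [d2 d20 h2] := cts_poly (p.[x] *: q) x A02.
pose t := Num.min r (Num.min d1 d2) / (2 * cnorm e).
have t0 : 0 < t by rewrite divr_gt0 ?lt_min ?r0 ?d10 ?d20 // mulr_gt0.
pose w := x + t%:C * e.
have wx : cnorm (w - x) = Num.min r (Num.min d1 d2) / 2.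
  rewrite /w addrAC subrr add0r cnormM cnorm_real gtr0_norm // /t.
  by field; rewrite gt_eqF.
have : cnorm (w - x) < Num.min r (Num.min d1 d2).
  by rewrite wx gtr_pMr ?lt_min ?r0 ?d10 ?d20 //; lra.
rewrite !lt_min => /and3P[wr /h1 w1 /h2 w2].
have /= := h _ wr; apply: contraLR => _; rewrite -ltNge.
have -> : cnorm p.[w] * cnorm q.[x] = cnorm (p.[x] * q.[w] + (t ^+ k)%:C * (e ^+ k * s.[w])).
  rewrite -cnormM; congr cnorm.
  have := congr1 (fun f => f.[w]) hP; rewrite !hornerE.
  have -> : w - x = t%:C * e by rewrite /w addrAC subrr add0r.
  by move=> /(canRL (subrK _)); rewrite mulrC => ->; rewrite exprMn rmorphXn /=; ring.
rewrite -cnormM; apply: cnorm_ltD_dir; first exact: exprn_gt0.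
move: w1 w2; rewrite !hornerE ek divfK ?rootE // -/A0 => w1 w2.
have := cnorm_le_dist A0 (p.[x] * q.[w]); rewrite cdistC => w3.
have -> : A0 / s.[x] * s.[w] - p.[x] * q.[w] =
   A0 / s.[x] * s.[w] - p.[x] * q.[w] - (A0 - A0) by rewrite subrr subr0.
by move: w1 w2 w3; rewrite -/A0; lra.
Qed.

Lemma rcts_ratio (X : R[i] -> Prop) p q x : q.[x] != 0 ->
  rcts_at X (fun w => cnorm p.[w] / cnorm q.[w]) x.
Proof.
move=> qx e e0; have q0 : 0 < cnorm q.[x] by rewrite cnorm_gt0.
pose P := cnorm p.[x]; pose Q := cnorm q.[x].
pose d := Num.min (Q / 2) (e * Q * Q / (2 * (P + Q + 1))).
have P0 : 0 <= P by exact: cnorm_ge0.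
have PQ : 0 < 2 * (P + Q + 1) by rewrite /Q; lra.
have d0 : 0 < d by rewrite lt_min divr_gt0 //= divr_gt0 // !mulr_gt0.
have [d1 d10 h1] := cts_poly p x d0; have [d2 d20 h2] := cts_poly q x d0.
exists (Num.min d1 d2); first by rewrite lt_min d10.
move=> y _; rewrite lt_min => /andP[/h1 y1 /h2 y2].
have n1 : `|cnorm p.[y] - P| < d by apply: le_lt_trans (cnorm_lip _ _) y1.
have n2 : `|cnorm q.[y] - Q| < d by apply: le_lt_trans (cnorm_lip _ _) y2.
have yQ : Q / 2 < cnorm q.[y].
  have dQ : d <= Q / 2 by rewrite ge_min lexx.
  by move: n2; rewrite ltr_norml => /andP[? ?]; lra.
have yQ0 : 0 < cnorm q.[y] by apply: lt_trans yQ; rewrite divr_gt0.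
rewrite -/P -/Q.
have -> : cnorm p.[y] / cnorm q.[y] - P / Q =
  ((cnorm p.[y] - P) * Q - P * (cnorm q.[y] - Q)) / (cnorm q.[y] * Q).
  by field; rewrite !gt_eqF.
rewrite normrM [X in _ * X]gtr0_norm ?invr_gt0 ?mulr_gt0 //.
rewrite ltr_pdivrMr ?mulr_gt0 //.
apply: le_lt_trans (ler_normB _ _) _; rewrite !normrM (gtr0_norm q0) (ger0_norm P0).
apply: le_lt_trans (_ : _ <= d * (P + Q)) _.
  by rewrite mulrDr addrC (mulrC P); apply: lerD; rewrite ler_wpM2r // ltW.
have dle : d * (2 * (P + Q + 1)) <= e * Q * Q.
  by rewrite -ler_pdivlMr // ge_min lexx orbT.
have : e * Q * Q < e * Q * (2 * cnorm q.[y]) by rewrite ltr_pM2l ?mulr_gt0 //; lra.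
have : 0 < d * 1 by rewrite mulr1.
nra.
Qed.

(** The set [Y] where |p / q| is maximal is compact. If its point of largest real part is interior
    to [X], then [local_max] makes p / q constant and a shift to the right stays in [Y]. The
    extremal real part takes the place of a connectedness argument. *)
Theorem max_principle (X : R[i] -> Prop) p q (M : R) :
  cclosed X -> cbounded X -> 0 <= M -> (forall x, X x -> q.[x] != 0) ->
  (forall x, X x -> cnorm p.[x] <= M * cnorm q.[x] \/
     exists2 r : R, 0 < r & forall w, cnorm (w - x) < r -> X w) ->
  forall x, X x -> cnorm p.[x] <= M * cnorm q.[x].
Proof.
move=> Xc Xb M0 Xq hX x0 Xx0; rewrite leNgt; apply/negP => hx0.
pose f w := cnorm p.[w] / cnorm q.[w].
have q0 w : X w -> 0 < cnorm q.[w] by move=> /Xq; rewrite cnorm_gt0.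
have [x1 Xx1 max1] : exists2 x, X x & forall y, X y -> f y <= f x.
  by apply: evt Xx0 _ => // x /Xq; apply: rcts_ratio.
pose Y w := X w /\ cnorm p.[w] * cnorm q.[x1] = cnorm p.[x1] * cnorm q.[w].
have Yf w : X w -> cnorm p.[x1] * cnorm q.[w] <= cnorm p.[w] * cnorm q.[x1] -> Y w.
  move=> Xw le; split=> //; apply/eqP; rewrite eq_le le andbT.
  by have := max1 _ Xw; rewrite /f ler_pdivrMr ?q0 // mulrAC ler_pdivlMr ?q0.
have Yc : cclosed Y.
  move=> u l hu ul; have Xl : X l by apply: Xc ul => n; case: (hu n).
  split=> //; rewrite -!cnormM; apply/eqP; rewrite -subr_eq0; apply: contraT => n0.
  have e0 : 0 < `|cnorm (p.[l] * q.[x1]) - cnorm (p.[x1] * q.[l])| / 2.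
    by rewrite divr_gt0 // normr_gt0.
  have [N1 h1] := ccvg_poly (p * (q.[x1])%:P) ul e0.
  have [N2 h2] := ccvg_poly ((p.[x1])%:P * q) ul e0.
  pose n := maxn N1 N2.
  have := h1 n (leq_maxl _ _); have := h2 n (leq_maxr _ _).
  have [_] := hu n; rewrite -!cnormM !hornerE; move: e0.
  set a := p.[l] * _; set b := _ * q.[l]; set a' := p.[u n] * _; set b' := _ * q.[u n].
  have := cnorm_lip a' a; have := cnorm_lip b' b.
  move: (cnorm a) (cnorm a') (cnorm b) (cnorm b') (cnorm (a' - a)) (cnorm (b' - b)).
  move=> A A' B B' D E; rewrite !ler_norml => /andP[? ?] /andP[? ?].
  by case: (ger0P (A - B)) => ? ? ? ? ?; exfalso; lra.
have [x2 [Xx2 eq2] max2] : exists2 x, Y x & forall y, Y y -> Re y <= Re x.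
  apply: (@evt R Y Re x1) => //.
  - by case: Xb => b0 hb; exists b0 => x [/hb].
  - move=> x _ e e0; exists e => // y _ h; apply: le_lt_trans h.
    by rewrite -raddfB normRe_le.
have hx2 : M * cnorm q.[x2] < cnorm p.[x2].
  have := max1 _ Xx0; rewrite /f ler_pdivrMr ?q0 // => h.
  have : M < f x1.
    by rewrite -(ltr_pM2r (q0 _ Xx0)); apply: lt_le_trans hx0 h.
  by rewrite /f ltr_pdivlMr ?q0 // -(ltr_pM2r (q0 _ Xx2)) -eq2 mulrAC ltr_pM2r ?q0.
have [|[r r0 hr]] := hX _ Xx2; first by rewrite leNgt hx2.
have p2 : p.[x2] != 0 by rewrite -cnorm_gt0; apply: le_lt_trans hx2; rewrite mulr_ge0.
have eqpq : q.[x2] *: p = p.[x2] *: q.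
  apply: local_max r0 p2 (Xq _ Xx2) _ => w /hr Xw.
  have := max1 _ Xw; rewrite /f ler_pdivrMr ?q0 // mulrAC ler_pdivlMr ?q0 // => h.
  rewrite -(ler_pM2r (q0 _ Xx1)) mulrAC.
  apply: le_trans (ler_wpM2r (cnorm_ge0 _) h) _.
  by rewrite [leRHS]mulrAC eq2 mulrAC.
have r2 : 0 < r / 2 by rewrite divr_gt0.
have Xw : X (x2 + (r / 2)%:C).
  by apply: hr; rewrite addrAC subrr add0r cnorm_real gtr0_norm //; lra.
suff /max2 : Y (x2 + (r / 2)%:C) by case: (x2) => a b /=; lra.
apply: Yf => //; move: (_ + _) Xw => w Xw.
have := congr1 (fun f => cnorm f.[w]) eqpq; rewrite !hornerZ !cnormM => E.
rewrite -(ler_pM2r (q0 _ Xx2)) mulrAC -eq2 -(mulrA (cnorm p.[w])) (mulrC (cnorm q.[x1])).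
by rewrite mulrA (mulrC (cnorm p.[w])) E mulrAC.
Qed.

Lemma cball_closed a (r : R) : cclosed (fun w => cnorm (w - a) <= r).
Proof.
move=> u l hu ul; have := ccvg_poly ('X - a%:P) ul; rewrite !hornerE => h.
apply: (ccvg_norm_le h) => N; exists N => //.
by rewrite !hornerE.
Qed.

Lemma cball_bounded a (r : R) : cbounded (fun w => cnorm (w - a) <= r).
Proof.
by exists (cnorm a + r) => x h; apply: le_trans (cnorm_le_dist _ a) _; rewrite lerD2l.
Qed.

Lemma cball_dichotomy a (r : R) x : cnorm (x - a) <= r -> cnorm (x - a) = r \/
  exists2 e : R, 0 < e & forall w, cnorm (w - x) < e -> cnorm (w - a) <= r.
Proof.
rewrite le_eqVlt => /orP[/eqP ->|lt]; [by left|right].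
exists (r - cnorm (x - a)); first by rewrite subr_gt0.
by move=> w hw; have := cdist_triangle x w a; lra.
Qed.

(** On the circle |s| = |g - g(a)| / r, and the maximum principle carries the bound inside. As [s]
    is the difference quotient at [a], both the Schwarz lemma and the Cauchy estimate follow. *)
Lemma schwarz_factor g s a (r B : R) : 0 < r ->
  g = (g.[a])%:P + s * ('X - a%:P) ->
  (forall w, cnorm (w - a) <= r -> cnorm (g.[w] - g.[a]) <= B) ->
  forall w, cnorm (w - a) <= r -> cnorm s.[w] <= B / r.
Proof.
move=> r0 /horner_factor hs hg w hw.
have B0 : 0 <= B by apply: le_trans (hg a _) => //; rewrite subrr cnorm0 ltW.
rewrite -[leRHS]mulr1 -(cnorm1 R) -(hornerC 1 w).
apply: (max_principle (@cball_closed a r) (@cball_bounded a r)) hw.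
- by rewrite divr_ge0 // ltW.
- by move=> x _; rewrite hornerC oner_eq0.
- move=> x hx; have [eqr|] := cball_dichotomy hx; [left|by right].
  rewrite hornerC cnorm1 mulr1 ler_pdivlMr // -eqr -cnormM -hs.
  exact: hg.
Qed.

Lemma schwarz g a (r B : R) : 0 < r ->
  (forall w, cnorm (w - a) <= r -> cnorm (g.[w] - g.[a]) <= B) ->
  forall w, cnorm (w - a) <= r -> cnorm (g.[w] - g.[a]) <= B / r * cnorm (w - a).
Proof.
move=> r0 hg w hw; have [s hs] := factor_at g a.
by rewrite (horner_factor hs) cnormM ler_wpM2r // (schwarz_factor r0 hs hg).
Qed.

Lemma cauchy_deriv g a (r B : R) : 0 < r ->
  (forall w, cnorm (w - a) <= r -> cnorm (g.[w] - g.[a]) <= B) ->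
  cnorm (g^`()).[a] <= B / r.
Proof.
move=> r0 hg; have [s hs] := factor_at g a.
by rewrite (deriv_factor hs) (schwarz_factor r0 hs hg) // subrr cnorm0 ltW.
Qed.

(* The Schwarz lemma applied to [1 / q]. *)
Lemma schwarz_inv q a (r k : R) : 0 < r -> 0 < k ->
  (forall w, cnorm (w - a) <= r -> k <= cnorm q.[w]) ->
  forall w, cnorm (w - a) <= r ->
    cnorm (q.[w] - q.[a]) <= (1 + cnorm q.[a] / k) / r * cnorm (w - a) * cnorm q.[w].
Proof.
move=> r0 k0 hq w hw; have [s /horner_factor hs] := factor_at q a.
rewrite hs cnormM [leRHS]mulrAC ler_wpM2r //.
apply: (max_principle (@cball_closed a r) (@cball_bounded a r)) hw.
- by rewrite divr_ge0 ?addr_ge0 // ?divr_ge0 // ltW.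
- by move=> x /hq hx; rewrite -cnorm_gt0 (lt_le_trans k0).
- move=> x hx; have [eqr|] := cball_dichotomy hx; [left|by right].
  rewrite mulrAC ler_pdivlMr // -{1}eqr -cnormM -hs.
  (* On the circle |q - q(a)| <= |q| + |q(a)|, and [k <= |q|] absorbs the second term. *)
  apply: le_trans (cnormB _ _) _; rewrite mulrDl mul1r lerD2l mulrAC ler_pdivlMr //.
  by rewrite ler_wpM2l // hq.
Qed.

End Polynomials.

(** * The chordal metric *)

Section Sphere.
Variable R : realType.
Implicit Types (a b c x y w : R[i]) (z v : sphere R) (e M : R) (g p : {poly R[i]}).

Definition chord_weight (a : R[i]) := Num.sqrt (1 + cnorm a ^+ 2).
Local Notation h := chord_weight.

Lemma weight_sqr a : h a ^+ 2 = 1 + cnorm a ^+ 2.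
Proof. by rewrite sqr_sqrtr // addr_ge0 ?sqr_ge0. Qed.

Lemma weight_ge1 a : 1 <= h a.
Proof. by rewrite -{1}sqrtr1 ler_sqrt ?lerDl ?sqr_ge0 ?addr_ge0 ?sqr_ge0. Qed.

Lemma weight_gt0 a : 0 < h a. Proof. exact: lt_le_trans (weight_ge1 a). Qed.

Lemma weight_ge a : cnorm a <= h a.
Proof.
rewrite -(ler_pXn2r (n := 2)) ?nnegrE ?(ltW (weight_gt0 _)) //.
by rewrite weight_sqr lerDr.
Qed.

Lemma weight_le a : h a <= 1 + cnorm a.
Proof.
have n0 := cnorm_ge0 a.
rewrite -(ler_pXn2r (n := 2)) ?nnegrE ?(ltW (weight_gt0 _)) ?addr_ge0 //.
by rewrite weight_sqr; nra.
Qed.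

Lemma weight_lip a b : h a <= h b + cnorm (a - b).
Proof.
have := weight_sqr a; have := weight_sqr b; have := weight_ge b.
have := weight_gt0 a; have := weight_gt0 b; have := cnorm_le_dist a b.
have := cnorm_ge0 (a - b); have := cnorm_ge0 a; have := cnorm_ge0 b.
set A := cnorm a; set B := cnorm b; set D := cnorm _; move=> *.
have [ha hb] : 0 <= h a /\ 0 <= h b + D by split; lra.
rewrite -(ler_pXn2r (n := 2)) ?nnegrE //.
nra.
Qed.

Lemma sdistE a b : sdist (Some a) (Some b) = 2 * cnorm (a - b) / (h a * h b).
Proof. by rewrite /= sqrtrM // addr_ge0 ?sqr_ge0. Qed.

Lemma sdist_inf a : sdist (Some a) None = 2 / h a.
Proof. by []. Qed.

Lemma sdistC z v : sdist z v = sdist v z.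
Proof.
by case: z v => [a|] [b|] //; rewrite !sdistE cdistC (mulrC (h a)).
Qed.

Lemma sdistzz z : sdist z z = 0.
Proof. by case: z => [a|] //; rewrite sdistE subrr cnorm0 mulr0 mul0r. Qed.

Lemma sdist_ge0 z v : 0 <= sdist z v.
Proof.
have w0 c : 0 <= h c by rewrite ltW ?weight_gt0.
by case: z v => [a|] [b|] //; rewrite ?sdistE ?sdist_inf ?(sdistC None) ?sdist_inf ?divr_ge0 ?mulr_ge0.
Qed.

(** Cauchy-Schwarz in C^2 for (1, c) and (1, b), whose norms are the weights. *)
Lemma weight_cs b c : cnorm (1 + conjc c * b) <= h c * h b.
Proof.
rewrite -(ler_pXn2r (n := 2)) ?nnegrE ?mulr_ge0 ?(ltW (weight_gt0 _)) //.
rewrite exprMn !weight_sqr !cnorm_sqr; case: b c => b1 b2 [c1 c2] /=.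
by have := sqr_ge0 (c1 - b1); have := sqr_ge0 (c2 - b2); nra.
Qed.

Lemma sdist_triangle v z z' : sdist z z' <= sdist z v + sdist v z'.
Proof.
have h0 c : 0 < h c := weight_gt0 c.
have hn c : h c != 0 by rewrite gt_eqF.
have fin a b : sdist (Some a) (Some b) <= sdist (Some a) None + sdist None (Some b).
  rewrite (sdistC None) !sdistE !sdist_inf -(ler_pM2r (h0 a)) -(ler_pM2r (h0 b)).
  have -> : 2 * cnorm (a - b) / (h a * h b) * h a * h b = 2 * cnorm (a - b).
    by field; rewrite !hn.
  have -> : (2 / h a + 2 / h b) * h a * h b = 2 * (h a + h b).
    by field; rewrite !hn.
  by rewrite ler_pM2l //; apply: le_trans (cnormB _ _) _; apply: lerD; apply: weight_ge.
have inf a b : sdist (Some a) None <= sdist (Some a) (Some b) + sdist (Some b) None.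
  rewrite !sdistE !sdist_inf -(ler_pM2r (h0 a)) -(ler_pM2r (h0 b)).
  have -> : 2 / h a * h a * h b = 2 * h b by field; rewrite !hn.
  have -> : (2 * cnorm (a - b) / (h a * h b) + 2 / h b) * h a * h b = 2 * (h a + cnorm (a - b)).
    by field; rewrite !hn.
  by rewrite ler_pM2l // cdistC weight_lip.
case: z z' v => [a|] [b|] [c|]; rewrite ?sdistzz ?add0r ?addr0 ?lexx //; try exact: fin; try exact: inf.
(* For three finite points, (a - b)(1 + |c|^2) = (a - c)(1 + conj(c) b) + (c - b)(1 + conj(c) a),
   and [weight_cs] bounds the second factors. *)
- rewrite !sdistE -(ler_pM2r (h0 a)) -(ler_pM2r (h0 b)) -(ler_pM2r (h0 c)) -(ler_pM2r (h0 c)).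
  have -> : 2 * cnorm (a - b) / (h a * h b) * h a * h b * h c * h c = 2 * (cnorm (a - b) * h c ^+ 2).
    by field; rewrite !hn.
  have -> : (2 * cnorm (a - c) / (h a * h c) + 2 * cnorm (c - b) / (h c * h b)) * h a * h b * h c * h c
     = 2 * (cnorm (a - c) * (h c * h b) + cnorm (c - b) * (h c * h a)).
    by field; rewrite !hn.
  rewrite ler_pM2l // weight_sqr.
  have -> : 1 + cnorm c ^+ 2 = cnorm (1 + conjc c * c).
    have -> : 1 + conjc c * c = (1 + cnorm c ^+ 2)%:C.
      rewrite cnorm_sqr; case: c => c1 c2; apply/eqP; rewrite eq_complex /=.
      by apply/andP; split; apply/eqP; ring.
    by rewrite cnorm_real ger0_norm // addr_ge0 ?sqr_ge0.
  rewrite -cnormM.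
  have -> : (a - b) * (1 + conjc c * c) = (a - c) * (1 + conjc c * b) + (c - b) * (1 + conjc c * a) by ring.
  apply: le_trans (cnormD _ _) _; rewrite !cnormM.
  by apply: lerD; rewrite ler_wpM2l // weight_cs.
- by rewrite !(sdistC None) addrC (sdistC (Some c)) inf.
- by rewrite addr_ge0 ?sdist_ge0.
Qed.

Lemma sdist_le_cdist a b : sdist (Some a) (Some b) <= 2 * cnorm (a - b).
Proof.
rewrite sdistE ler_pdivrMr ?mulr_gt0 ?weight_gt0 // ler_peMr ?mulr_ge0 //.
by rewrite mulr_ege1 ?weight_ge1.
Qed.

Lemma cdist_of_sdist M e : 0 < e -> exists2 d : R, 0 < d &
  forall a b, cnorm a <= M -> sdist (Some a) (Some b) < d -> cnorm (a - b) < e.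
Proof.
move=> e0; have [M0|M0] := ltP M 0.
  by exists 1 => // a b /(le_trans (cnorm_ge0 _)); rewrite leNgt M0.
have m0 : 0 < (1 + M) * (1 + M + e) by rewrite mulr_gt0 //; lra.
(* With D = |a - b|, the weights are at most 1 + M and 1 + M + D, and 2 D / ((1 + M)(1 + M + D))
   increases with D; this is its value at D = e. *)
exists (2 * e / ((1 + M) * (1 + M + e))); first by rewrite divr_gt0 // mulr_gt0.
move=> a b aM; rewrite sdistE; apply: contraLR; rewrite -!leNgt => ex.
rewrite ler_pdivrMr // mulrAC ler_pdivlMr ?mulr_gt0 ?weight_gt0 //.
have ha : h a <= 1 + M by apply: le_trans (weight_le a) _; rewrite lerD2l.
have hb : h b <= 1 + M + cnorm (a - b).
  by apply: le_trans (weight_lip b a) _; rewrite cdistC lerD2r.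
apply: le_trans (_ : 2 * e * ((1 + M) * (1 + M + cnorm (a - b))) <= _).
  by rewrite ler_wpM2l ?mulr_ge0 ?(ltW e0) // ler_pM // ltW ?weight_gt0.
rewrite -!mulrA ler_pM2l // mulrCA [leRHS]mulrCA ler_pM2l; last lra.
rewrite mulrDr [leRHS]mulrDr; apply: lerD; last by rewrite mulrC.
by rewrite ler_wpM2r //; lra.
Qed.

Lemma sdist_inf_gt M : exists2 d : R, 0 < d &
  forall a, sdist (Some a) None < d -> M < cnorm a.
Proof.
have m0 : 0 < 1 + `|M| by rewrite ltr_pwDl.
exists (2 / (1 + `|M|)); first by rewrite divr_gt0.
move=> a; rewrite sdist_inf ltr_pM2l // ltf_pV2 ?posrE ?weight_gt0 // => lt.
have := lt_le_trans lt (weight_le a); rewrite ltrD2l; apply: le_lt_trans.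
exact: ler_norm.
Qed.

Lemma sdist_inf_lt e : 0 < e -> exists M, forall a, M <= cnorm a -> sdist (Some a) None < e.
Proof.
move=> e0; exists (2 / e + 1) => a Ma; rewrite sdist_inf ltr_pdivrMr ?weight_gt0 //.
rewrite mulrC -ltr_pdivrMr //; have := weight_ge a; lra.
Qed.

Lemma sdist_inf_mono a b : cnorm b <= cnorm a -> sdist (Some a) None <= sdist (Some b) None.
Proof.
move=> ba; rewrite !sdist_inf ler_pM2l // lef_pV2 ?posrE ?weight_gt0 //.
by rewrite ler_sqrt ?lerD2l ?lerXn2r ?nnegrE // addr_ge0 ?sqr_ge0.
Qed.

Lemma finite_near a : exists2 d : R, 0 < d &
  forall z, sdist (Some a) z < d -> exists b, z = Some b.
Proof.
exists (sdist (Some a) None); first by rewrite sdist_inf divr_gt0 ?weight_gt0.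
by case=> [b|]; [exists b | rewrite ltxx].
Qed.

Lemma sphere_near a e : 0 < e -> exists2 d : R, 0 < d &
  forall z, sdist (Some a) z < d -> exists2 b, z = Some b & cnorm (b - a) < e.
Proof.
move=> e0; have [d1 d10 h1] := finite_near a.
have [d2 d20 h2] := cdist_of_sdist (cnorm a) e0.
exists (Num.min d1 d2); first by rewrite lt_min d10.
move=> z; rewrite lt_min => /andP[/h1[b ->] /(h2 _ _ (lexx _)) ?].
by exists b => //; rewrite cdistC.
Qed.

Definition scvg (u : nat -> sphere R) (l : sphere R) :=
  forall e : R, 0 < e -> exists N, forall n, (N <= n)%N -> sdist (u n) l < e.

Lemma ccvg_scvg (u : nat -> R[i]) l : ccvg u l -> scvg (fun n => Some (u n)) (Some l).
Proof.
move=> ul e e0; have e2 : 0 < e / 2 by rewrite divr_gt0.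
have [N hN] := ul _ e2; exists N => n /hN lt.
by apply: le_lt_trans (sdist_le_cdist _ _) _; lra.
Qed.

Lemma sphere_compact (u : nat -> sphere R) :
  exists2 phi, extraction phi & exists l, scvg (u \o phi) l.
Proof.
have [hinf|] := pselect (forall k N : nat, exists2 n, (N <= n)%N & sdist (u n) None < k.+1%:R^-1).
  have [phi hphi Pphi] := extract hinf; exists phi => //; exists None => e e0.
  have [N hN] := invn_lt e0; exists N => n Nn; exact: lt_trans (Pphi n) (hN _ Nn).
move=> /existsNP[k /existsNP[N hN]].
have k0 : 0 < k.+1%:R^-1 :> R by rewrite invr_gt0 ltr0n.
have hu n : sdist (u (N + n)%N) None >= k.+1%:R^-1.
  by rewrite leNgt; apply/negP => lt; apply: hN; exists (N + n)%N => //; rewrite leq_addr.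
have [M hM] := sdist_inf_lt k0.
have /choice[x hx] : forall n, exists x, u (N + n)%N = Some x /\ cnorm x <= M.
  move=> n; move: (hu n); case: (u _) => [x|] le; last by move: le; rewrite sdistzz leNgt k0.
  by exists x; split=> //; rewrite leNgt; apply/negP => /ltW/hM; rewrite ltNge le.
have [phi hphi [l hl]] := bolzano (fun n => (hx n).2).
exists (fun n => N + phi n)%N; first by move=> n; rewrite ltn_add2l.
exists (Some l) => e /(ccvg_scvg hl)[N' hN']; exists N' => n /hN'.
by rewrite /= (hx _).1.
Qed.

(** By [root_near], a small value at [y] forces a root within the fixed distance [s] of [y], and
    every root is bounded by the sum of the moduli of all of them. *)
Lemma poly_infty p M : (1 < size p)%N -> exists K : R, forall y, K <= cnorm y -> M <= cnorm p.[y].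
Proof.
move=> sp; have p0 : p != 0 by rewrite -size_poly_gt0 ltnW.
have l0 : 0 < cnorm (lead_coef p) by rewrite cnorm_gt0 lead_coef_eq0.
have [rs hrs] := closed_field_poly_normal p.
have root_le (z : R[i]) : root p z -> cnorm z <= \sum_(y <- rs) cnorm y.
  rewrite hrs rootZ ?lead_coef_eq0 // root_prod_XsubC.
  elim: rs {hrs} => // y rs IH; rewrite inE big_cons => /orP[/eqP ->|/IH le].
    by rewrite lerDl sumr_ge0.
  by apply: le_trans le _; rewrite lerDr.
pose s := `|M| / cnorm (lead_coef p) + 1.
have s1 : 1 <= s by rewrite lerDr divr_ge0.
exists (s + \sum_(y <- rs) cnorm y) => y; apply: contraLR; rewrite -!ltNge => lt.
have [|z pz zy] := @root_near R p y 0 s (le_trans ler01 s1) sp.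
  rewrite subr0; apply: lt_le_trans lt _; apply: le_trans (ler_norm _) _.
  rewrite mulrC -ler_pdivrMr //; apply: le_trans (_ : s <= _); first by rewrite lerDl.
  case: (size p) sp => // -[|n] // _.
  by rewrite exprS ler_peMr ?exprn_ege1 //; lra.
have := root_le z; rewrite rootE pz => /(_ (eqxx _)).
have := cnorm_le_dist y z; rewrite cdistC; lra.
Qed.

Lemma pmap_inf p : (1 < size p)%N -> pmap p None = None.
Proof. by move=> sp; rewrite /= leqNgt sp. Qed.

Lemma pmap_cts p z e : (1 < size p)%N -> 0 < e ->
  exists2 d : R, 0 < d & forall v, sdist z v < d -> sdist (pmap p z) (pmap p v) < e.
Proof.
move=> sp e0; case: z => [x|].
  have e2 : 0 < e / 2 by rewrite divr_gt0.
  have [d /(sphere_near x)[d' d'0 hd'] hd] := cts_poly p x e2.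
  exists d' => // v /hd'[b -> /hd lt].
  by apply: le_lt_trans (sdist_le_cdist _ _) _; rewrite cdistC; lra.
have [M hM] := sdist_inf_lt e0; have [K hK] := poly_infty M sp.
have [d d0 hd] := sdist_inf_gt K; exists d => // -[y|].
  by rewrite pmap_inf // !(sdistC None) => /hd/ltW/hK/hM.
by move=> _; rewrite sdistzz.
Qed.

End Sphere.

(** * Normality and equicontinuity *)

Section Normality.
Variable R : realType.
Implicit Types (a b c x y w : R[i]) (z v : sphere R) (e M : R) (g p : {poly R[i]}).
Implicit Types (F : {poly R[i]} -> Prop).

Definition equicts F z := forall e : R, 0 < e -> exists2 d : R, 0 < d &
  forall g, F g -> forall v, sdist z v < d -> sdist (pmap g z) (pmap g v) < e.

(** The limit [f] is not known to be continuous, so continuity at [z] is borrowed from the single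
    member of index [N], to which all later members are close near [z]. *)
Lemma normal_equicts F U z : (forall g, F g -> (1 < size g)%N) ->
  sopen U -> U z -> normal_on F U -> equicts F z.
Proof.
move=> Fs Uo Uz hF; apply: contrapT => /existsNP[e /not_implyP[e0 he]].
have [r' r'0 hr'] := Uo z Uz.
have /choice[gv hgv] : forall n : nat, exists gv : {poly R[i]} * sphere R,
    [/\ F gv.1, sdist z gv.2 < n.+1%:R^-1 & e <= sdist (pmap gv.1 z) (pmap gv.1 gv.2)].
  move=> n; apply: contrapT => h; apply: he; exists (n.+1%:R^-1).
    by rewrite invr_gt0 ltr0n.
  move=> g Fg v zv; rewrite ltNge; apply/negP => le; apply: h; exists (g, v).
  by split.
have [phi [hphi [f hf]]] := hF (fun n => (gv n).1) (fun n => (let: And3 h _ _ := hgv n in h)).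
have [r r0 hr] := hf z Uz.
have e6 : 0 < e / 6 by rewrite divr_gt0.
have [N hN] := hr _ e6.
have [Fg _ _] := hgv (phi N).
have [d d0 hd] := pmap_cts z (Fs _ Fg) e6.
have m0 : 0 < Num.min d (Num.min r r') by rewrite !lt_min d0 r0 r'0.
have [N' hN'] := invn_lt m0.
pose n := maxn N N'; have Nn : (N <= n)%N by rewrite leq_maxl.
have [Fn zv le] := hgv (phi n).
have : sdist z (gv (phi n)).2 < Num.min d (Num.min r r').
  apply: lt_trans zv (hN' _ _).
  exact: leq_trans (leq_maxr _ _) (extraction_ge hphi _).
rewrite !lt_min => /and3P[vd vr /hr' Uv].
have zr : sdist z z < r by rewrite sdistzz.
have h1 := hN _ Nn _ Uz zr; have h2 := hN _ Nn _ Uv vr.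
have h3 := hN _ (leqnn _) _ Uz zr; have h4 := hN _ (leqnn _) _ Uv vr.
have h5 := hd _ vd; move: h1 h2 h3 h4 h5 le.
set A := pmap (gv (phi n)).1 z; set B := pmap (gv (phi n)).1 _.
set A' := pmap _ z; set B' := pmap _ _; set C := f z; set D := f _ => h1 h2 h3 h4 h5 le.
have := sdist_triangle C A B; have := sdist_triangle A' C B.
have := sdist_triangle B' A' B; have := sdist_triangle D B' B.
rewrite (sdistC C A') (sdistC D B); lra.
Qed.

Lemma Fatou_equicts F z : (forall g, F g -> (1 < size g)%N) ->
  Fatou F z -> equicts F z.
Proof. by move=> Fs [U [Uo Uz]]; apply: normal_equicts. Qed.

Definition ratpoint (n : nat) : sphere R :=
  if unpickle n is Some (q1, q2) then Some (Complex (ratr q1) (ratr q2) : R[i]) else None.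

Lemma ratpoint_dense z e : 0 < e -> exists n, sdist z (ratpoint n) < e.
Proof.
have fin x (d : R) : 0 < d -> exists n, sdist (Some x) (ratpoint n) < d.
  move=> d0; have d4 : 0 < d / 8 by rewrite divr_gt0.
  have rat1 (t : R) : exists q : rat, `|t - ratr q| < d / 8.
    have [|q] := @rat_in_itvoo _ (t - d / 8) (t + d / 8); first lra.
    rewrite in_itv /= => /andP[? ?]; exists q; rewrite ltr_norml; lra.
  case: x => x1 x2; have [q1 h1] := rat1 x1; have [q2 h2] := rat1 x2.
  exists (pickle (q1, q2)); rewrite /ratpoint pickleK.
  apply: le_lt_trans (sdist_le_cdist _ _) _.
  by have := cnorm_leReIm (Complex x1 x2 - Complex (ratr q1) (ratr q2)); rewrite /=; lra.
move=> e0; case: z => [x|]; first exact: fin.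
have e2 : 0 < e / 2 by rewrite divr_gt0.
have [M hM] := sdist_inf_lt e2.
have /hM h : M <= cnorm (`|M|)%:C by rewrite cnorm_real normr_id ler_norm.
have [n hn] := fin (`|M|)%:C _ e2.
exists n; apply: le_lt_trans (sdist_triangle (Some (`|M|)%:C) _ _) _.
by rewrite (sdistC None); lra.
Qed.

(** Each [Phi k.+1] refines [Phi k] so that [u k] converges along it; [tail] exhibits the later
    extractions, hence the tail of the diagonal, as subsequences of it. *)
Lemma diagonal (u : nat -> nat -> sphere R) :
  exists2 phi, extraction phi &
    forall k, exists l, scvg (fun n => u k (phi n)) l.
Proof.
pose ext := {phi : nat -> nat | extraction phi}.
have /choice[step hstep] : forall kp : nat * ext, exists psi : ext,
    exists l, scvg (fun n => u kp.1 (sval kp.2 (sval psi n))) l.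
  move=> [k phi]; have [psi hpsi [l hl]] := sphere_compact (u k \o sval phi).
  by exists (exist _ psi hpsi); exists l.
have cext (p q : ext) : extraction (sval p \o sval q).
  by apply: extraction_comp; apply: svalP.
have idE : extraction id by move=> n; apply: ltnSn.
pose id_ext : ext := exist _ id idE.
pose Phi := fix Phi k : ext := if k is j.+1 then
  exist extraction _ (cext (Phi j) (step (j, Phi j))) else id_ext.
have PhiS k n : sval (Phi k.+1) n = sval (Phi k) (sval (step (k, Phi k)) n) by [].
have tail k m : exists2 chi, extraction chi & forall n, sval (Phi (k + m)%N) n = sval (Phi k) (chi n).
  elim: m => [|m [chi hchi IH]]; first by rewrite addn0; exists id => // n; apply: ltnSn.
  exists (chi \o sval (step ((k + m)%N, Phi (k + m)%N))); last by move=> n; rewrite addnS PhiS IH.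
  by apply: extraction_comp => //; apply: svalP.
exists (fun n => sval (Phi n) n).
  move=> n; rewrite PhiS; apply: (extraction_lt (svalP (Phi n))).
  exact: (extraction_ge (svalP (step (n, Phi n))) n.+1).
move=> k; have [l hl] := hstep (k, Phi k); exists l => e /hl[N hN].
exists (maxn N k.+1) => n; rewrite geq_max => /andP[Nn kn].
have [chi hchi] := tail k.+1 (n - k.+1)%N; rewrite subnKC // => ->.
rewrite PhiS; apply: hN; exact: leq_trans Nn (extraction_ge hchi n).
Qed.

Lemma scvg_cauchy (u : nat -> sphere R) :
  (forall e : R, 0 < e -> exists N, forall m n, (N <= m)%N -> (N <= n)%N -> sdist (u m) (u n) < e) ->
  exists l, scvg u l.
Proof.
move=> hu; have [phi hphi [l hl]] := sphere_compact u; exists l => e e0.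
have e2 : 0 < e / 2 by rewrite divr_gt0.
have [N hN] := hu _ e2; have [N' hN'] := hl _ e2.
exists N => n Nn; pose m := maxn N N'.
have := hN _ (phi m) Nn (leq_trans (leq_maxl _ _) (extraction_ge hphi m)).
have := hN' m (leq_maxr _ _); have := sdist_triangle (u (phi m)) (u n) l.
rewrite /=; lra.
Qed.

Theorem arzela_ascoli F U : sopen U -> (forall z, U z -> equicts F z) -> normal_on F U.
Proof.
move=> Uo Ue g Fg.
have [phi hphi hcv] := diagonal (fun k n => pmap (g n) (ratpoint k)).
exists phi; split=> //.
have Ucv z : U z -> exists l, scvg (fun n => pmap (g (phi n)) z) l.
  move=> Uz; apply: scvg_cauchy => e e0; have e3 : 0 < e / 3 by rewrite divr_gt0.
  have [d /(ratpoint_dense z)[k zk] hd] := Ue _ Uz _ e3.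
  have [l hl] := hcv k; have e6 : 0 < e / 6 by rewrite divr_gt0.
  have [N hN] := hl _ e6; exists N => m n /hN hm /hN hn.
  have h1 := hd _ (Fg (phi m)) _ zk; have h2 := hd _ (Fg (phi n)) _ zk; move: hm hn h1 h2.
  set A := pmap (g (phi m)) z; set A' := pmap (g (phi n)) z.
  set B := pmap (g (phi m)) _; set B' := pmap (g (phi n)) _ => h1 h2 h3 h4.
  have := sdist_triangle B A A'; have := sdist_triangle l B A'; have := sdist_triangle B' l A'.
  rewrite (sdistC l B') (sdistC B' A'); lra.
have /choice[f hf] : forall z, exists l, U z -> scvg (fun n => pmap (g (phi n)) z) l.
  move=> z; have [/Ucv[l hl]|nU] := pselect (U z); first by exists l.
  by exists z => /nU.
exists f => w Uw; have [r r0 hr] := Uo _ Uw.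
(* Halving the radius keeps the limit [x'] of the bad points inside [U]. The values of [f] at [x']
   and at a bad point are then compared through one index [m], far enough for both. *)
exists (r / 2); first by rewrite divr_gt0.
move=> e e0; apply: contrapT => hne.
have bad (k N : nat) : exists2 n, (N <= n)%N & exists z,
    [/\ U z, sdist w z < r / 2 & e <= sdist (pmap (g (phi n)) z) (f z)].
  apply: contrapT => h; apply: hne; exists N => n Nn z Uz wz.
  by rewrite ltNge; apply/negP => le; apply: h; exists n => //; exists z.
have [psi hpsi /choice[x hx]] := extract bad.
have [chi hchi [x' hx']] := sphere_compact x.
have Ux' : U x'.
  apply: hr; have r2 : 0 < r / 2 by rewrite divr_gt0.
  have [N hN] := hx' _ r2; have [_ h _] := hx (chi N); have := hN _ (leqnn _).
  by have := sdist_triangle (x (chi N)) w x'; rewrite /=; lra.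
have e5 : 0 < e / 5 by rewrite divr_gt0.
have [d d0 hd] := Ue _ Ux' _ e5.
have [N hN] := hx' _ d0; have [N' hN'] := hf _ Ux' _ e5.
pose k := maxn N N'; pose n := psi (chi k).
have kn : (k <= n)%N by apply: leq_trans (extraction_ge hchi k) (extraction_ge hpsi _).
have [Uy _ le] := hx (chi k); set y := x (chi k) in Uy le.
have yx : sdist x' y < d by rewrite sdistC; apply: hN; rewrite leq_maxl.
have [N2 hN2] := hf _ Uy _ e5; pose m := maxn N' N2.
have h1 := hN' n (leq_trans (leq_maxr _ _) kn).
have h2 := hN' m (leq_maxl _ _); have h3 := hN2 m (leq_maxr _ _).
have h4 := hd _ (Fg (phi n)) _ yx; have h5 := hd _ (Fg (phi m)) _ yx.
move: h1 h2 h3 h4 h5 le; rewrite -/n.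
set A := pmap (g (phi n)) x'; set A' := pmap (g (phi m)) x'.
set B := pmap (g (phi n)) y; set B' := pmap (g (phi m)) y.
set C := f x'; set D := f y => h1 h2 h3 h4 h5 le.
have := sdist_triangle A B D; have := sdist_triangle C A D.
have := sdist_triangle A' C D; have := sdist_triangle B' A' D.
rewrite (sdistC B A) (sdistC C A'); lra.
Qed.

Lemma bounded_equicts F x (r M : R) : 0 < r ->
  (forall g, F g -> forall w, cnorm (w - x) <= r -> cnorm g.[w] <= M) ->
  equicts F (Some x).
Proof.
move=> r0 FM e e0; pose K := `|M| + `|M|.
have K0 : 0 <= K by rewrite addr_ge0.
have d0 : 0 < e / (2 * (K / r + 1)).
  by rewrite divr_gt0 // mulr_gt0 // ltr_wpDl // divr_ge0 // ltW.
have m0 : 0 < Num.min r (e / (2 * (K / r + 1))) by rewrite lt_min r0.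
have [d d1 hd] := sphere_near x m0; exists d => // g /FM gM v /hd[w ->].
rewrite lt_min => /andP[/ltW wr we].
apply: le_lt_trans (sdist_le_cdist _ _) _; rewrite cdistC.
have := @schwarz _ g x r K r0 _ w wr.
have hK y : cnorm (y - x) <= r -> cnorm (g.[y] - g.[x]) <= K.
  move=> hy; apply: le_trans (cnormB _ _) _.
  apply: lerD; apply: le_trans (ler_norm M); apply: gM => //.
  by rewrite subrr cnorm0 ltW.
move=> /(_ hK) h; move: we; rewrite ltr_pdivlMr; last first.
  by rewrite mulr_gt0 // ltr_wpDl // divr_ge0 // ltW.
have := cnorm_ge0 (w - x); nra.
Qed.

(* Montel for families omitting a disc: [1 / g] is bounded. *)
Lemma omit_equicts F x (r k : R) : 0 < r -> 0 < k ->
  (forall g, F g -> forall w, cnorm (w - x) <= r -> k <= cnorm g.[w]) ->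
  equicts F (Some x).
Proof.
move=> r0 k0 Fk e e0; pose K := 2 * ((1 + k^-1) / r).
have K0 : 0 < K by rewrite mulr_gt0 // divr_gt0 // addr_gt0 // invr_gt0.
have m0 : 0 < Num.min r (e / K) by rewrite lt_min r0 divr_gt0.
have [d d1 hd] := sphere_near x m0; exists d => // g /Fk gk v /hd[w ->].
rewrite lt_min => /andP[/ltW wr]; rewrite ltr_pdivlMr // => we.
rewrite sdistE cdistC.
rewrite ltr_pdivrMr ?mulr_gt0 ?weight_gt0 //.
apply: le_lt_trans (ler_wpM2l _ (schwarz_inv r0 k0 gk wr)) _ => //.
have h1 := weight_ge g.[w]; have h2 := weight_ge g.[x]; have h3 := weight_ge1 g.[x].
have h5 := weight_gt0 g.[w].
have h4 : 1 + cnorm g.[x] / k <= (1 + k^-1) * chord_weight g.[x].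
  rewrite mulrDl mul1r; apply: lerD => //.
  by rewrite mulrC ler_wpM2l // invr_ge0 ltW.
apply: le_lt_trans (_ : _ <= (cnorm (w - x) * K) * (chord_weight g.[x] * chord_weight g.[w])) _.
  have -> : 2 * ((1 + cnorm g.[x] / k) / r * cnorm (w - x) * cnorm g.[w]) =
    (2 / r * cnorm (w - x)) * ((1 + cnorm g.[x] / k) * cnorm g.[w]) by field; rewrite gt_eqF //= gt_eqF.
  have -> : cnorm (w - x) * K * (chord_weight g.[x] * chord_weight g.[w]) =
    (2 / r * cnorm (w - x)) * ((1 + k^-1) * chord_weight g.[x] * chord_weight g.[w]).
    by rewrite /K; field; rewrite gt_eqF //= gt_eqF.
  rewrite ler_wpM2l ?mulr_ge0 ?invr_ge0 ?(ltW r0) //.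
  by apply: ler_pM => //; rewrite addr_ge0 // divr_ge0 // ltW.
by rewrite ltr_pM2r // mulr_gt0 // weight_gt0.
Qed.

Lemma sopen_cball x (r : R) :
  sopen (fun z => exists2 w, z = Some w & cnorm (w - x) < r).
Proof.
move=> _ [w -> wr]; have e0 : 0 < r - cnorm (w - x) by rewrite subr_gt0.
have [d d0 hd] := sphere_near w e0; exists d => // v /hd[y -> yw].
by exists y => //; have := cdist_triangle w y x; lra.
Qed.

Lemma Fatou_open F : sopen (Fatou F).
Proof.
move=> z [U [Uo Uz UF]]; have [r r0 hr] := Uo _ Uz; exists r => // w /hr Uw.
by exists U; split.
Qed.

Lemma Fatou_sub F F' z : (forall g, F g -> F' g) -> Fatou F' z -> Fatou F z.
Proof. by move=> FF' [U [Uo Uz UF]]; exists U; split=> // g Fg; apply: UF => n; apply: FF'. Qed.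

Lemma bounded_Fatou F x (r M : R) : 0 < r ->
  (forall g, F g -> forall w, cnorm (w - x) < r -> cnorm g.[w] <= M) ->
  Fatou F (Some x).
Proof.
move=> r0 FM; exists (fun z => exists2 w, z = Some w & cnorm (w - x) < r).
split; [exact: sopen_cball | by exists x => //; rewrite subrr cnorm0 |].
apply: arzela_ascoli; first exact: sopen_cball.
move=> _ [w -> wr]; have r'0 : 0 < (r - cnorm (w - x)) / 2 by rewrite divr_gt0 // subr_gt0.
apply: (@bounded_equicts _ w _ M r'0) => g /FM gM y yw; apply: gM.
by have := cdist_triangle w y x; lra.
Qed.

Lemma Julia_closed F (u : nat -> R[i]) l :
  (forall n, Julia F (Some (u n))) -> ccvg u l -> Julia F (Some l).
Proof.
move=> hu /ccvg_scvg ul /(@Fatou_open F _)[r r0 hr].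
have [N hN] := ul _ r0; apply: (hu N); apply: hr.
by rewrite sdistC; apply: hN.
Qed.

End Normality.

(** * Chains and coverings of a disc *)

Section Chains.
Variable R : realType.
Implicit Types (x y z : R[i]) (S : R[i] -> Prop) (e : R).

(** Chains stand in for connectedness: they pass through uniformly continuous maps by induction, and
    on a compact set chains of every step lead back to components. *)
Inductive chain S e x : R[i] -> Prop :=
| chain0 : S x -> chain S e x x
| chainS y z : chain S e x y -> S z -> cnorm (z - y) < e -> chain S e x z.

Lemma chain_in S e x y : chain S e x y -> S x /\ S y.
Proof. by elim=> {y} [|y z _ []]. Qed.

Lemma chain_trans S e y x z : chain S e x y -> chain S e y z -> chain S e x z.
Proof. by move=> xy; elim=> // {}z w _ xz Sw ?; apply: chainS xz Sw _. Qed.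

Lemma chain_step S e x y : S x -> S y -> cnorm (y - x) < e -> chain S e x y.
Proof. by move=> Sx Sy; apply: chainS => //; apply: chain0. Qed.

Lemma chain_sym S e x y : chain S e x y -> chain S e y x.
Proof.
elim=> [Sx|{}y z xy IH Sz zy]; first exact: chain0.
apply: chain_trans IH; apply: chain_step => //; last by rewrite cdistC.
by case: (chain_in xy).
Qed.

Lemma chain_map S S' e e' (f : R[i] -> R[i]) x y :
  (forall z, S z -> S' (f z)) ->
  (forall z w, S z -> S w -> cnorm (w - z) < e -> cnorm (f w - f z) < e') ->
  chain S e x y -> chain S' e' (f x) (f y).
Proof.
move=> hS he; elim=> [/hS|{}y z xy IH Sz zy]; first exact: chain0.
by apply: chainS IH (hS _ Sz) _; apply: he => //; case: (chain_in xy).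
Qed.

Lemma chain_mono S S' e e' x y : (forall z, S z -> S' z) -> e <= e' ->
  chain S e x y -> chain S' e' x y.
Proof. by move=> hS ee'; apply: chain_map => // z w _ _ h; apply: lt_le_trans h ee'. Qed.

Lemma chain_exit S (P : R[i] -> Prop) e x y : chain S e x y -> P x -> ~ P y ->
  exists z w, [/\ chain S e x z, P z, ~ P w, S w & cnorm (w - z) < e].
Proof.
move=> xy Px; elim: xy => [//|{}y z xy IH Sz zy nPz].
by have [Py|/IH//] := pselect (P y); exists y, z.
Qed.

Lemma path_chain S e (f : R -> R[i]) (d : R) : 0 < d ->
  (forall t, 0 <= t <= 1 -> S (f t)) ->
  (forall t t', 0 <= t <= 1 -> 0 <= t' <= 1 -> `|t - t'| < d -> cnorm (f t - f t') < e) ->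
  chain S e (f 0) (f 1).
Proof.
move=> d0 fS fe; have [N hN] := invn_lt d0.
pose s j : R := j%:R / N.+1%:R.
have N0 : 0 < N.+1%:R :> R by rewrite ltr0n.
have sj j : (j <= N.+1)%N -> 0 <= s j <= 1.
  by move=> jN; rewrite divr_ge0 ?ler0n //= ler_pdivrMr // mul1r ler_nat.
have H j : (j <= N.+1)%N -> chain S e (f 0) (f (s j)).
  elim: j => [_|j IH jN].
    by rewrite /s mul0r; apply: chain0; apply: fS; rewrite lexx ler01.
  apply: chainS (IH (ltnW jN)) (fS _ (sj _ jN)) _.
  apply: fe; [exact: sj | exact/sj/ltnW |].
  by rewrite /s -mulrBl -addn1 natrD addrAC subrr add0r mul1r ger0_norm ?invr_ge0 ?ltW // hN.
by have := H _ (leqnn _); rewrite /s divff ?gt_eqF.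
Qed.

Lemma sqrt_dist (a b : R) : 0 <= a -> 0 <= b -> `|Num.sqrt a - Num.sqrt b| <= Num.sqrt `|a - b|.
Proof.
move=> a0 b0; rewrite -sqrtr_sqr ler_sqrt ?normr_ge0 //.
have -> : a - b = Num.sqrt a ^+ 2 - Num.sqrt b ^+ 2 by rewrite !sqr_sqrtr.
have := sqrtr_ge0 a; have := sqrtr_ge0 b; move: (Num.sqrt a) (Num.sqrt b) => A B B0 A0.
rewrite subr_sqr normrM -(real_normK (num_real (A - B))) expr2 ler_wpM2l //.
rewrite (ger0_norm (addr_ge0 A0 B0)).
by apply: le_trans (ler_normB _ _) _; rewrite !ger0_norm.
Qed.

(** Each point is joined to [r] along its own half of the circle, parametrised by the real part. The
    imaginary part is then a square root, only Hoelder of exponent 1/2, whence the [e ^+ 2] in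
    [d]. *)
Lemma circle_chain (r e : R) x y : 0 <= r -> 0 < e -> cnorm x = r -> cnorm y = r ->
  chain (fun z => cnorm z = r) e x y.
Proof.
move=> r0 e0; suff H z : cnorm z = r -> chain (fun z => cnorm z = r) e z r%:C.
  by move=> /H xr /H yr; apply: chain_trans xr (chain_sym yr).
case: z => a b abr.
have sq : a ^+ 2 + b ^+ 2 = r ^+ 2 by rewrite -abr cnorm_sqr.
have ar : `|a| <= r by rewrite -abr (normRe_le (Complex a b)).
pose sg : R := if 0 <= b then 1 else -1.
have sg1 : sg ^+ 2 = 1 by rewrite /sg; case: ifP; rewrite ?expr1n ?sqrrN ?expr1n.
pose g t := a + t * (r - a).
have gr t : 0 <= t <= 1 -> 0 <= r ^+ 2 - g t ^+ 2.
  move: ar; rewrite ler_norml /g => /andP[? ?] /andP[? ?].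
  by rewrite subr_sqr mulr_ge0 //; nra.
pose f t := Complex (g t) (sg * Num.sqrt (r ^+ 2 - g t ^+ 2)).
have f0 : f 0 = Complex a b.
  rewrite /f /g mul0r addr0; congr Complex; rewrite -sq addrAC subrr add0r sqrtr_sqr /sg.
  by case: ifPn => [/ger0_norm ->|]; rewrite ?mul1r // -ltNge => /ltr0_norm ->; rewrite mulN1r opprK.
have f1 : f 1 = r%:C.
  by rewrite /f /g mul1r addrC subrK subrr sqrtr0 mulr0.
rewrite -f0 -f1; pose K := 2 * r + 1.
have K0 : 0 < K by rewrite ltr_wpDl // mulr_ge0.
pose d := Num.min (e / (2 * K)) (e ^+ 2 / (4 * (K * K))).
have d0 : 0 < d by rewrite lt_min !divr_gt0 ?exprn_gt0 ?mulr_gt0.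
apply: (path_chain d0) => [t /gr h|t t' ht ht' dt].
  rewrite cnorm_def /= exprMn sg1 mul1r sqr_sqrtr // addrC subrK sqrtr_sqr ger0_norm //.
have gg : `|g t - g t'| <= K * `|t - t'|.
  have -> : g t - g t' = (r - a) * (t - t') by rewrite /g; ring.
  rewrite normrM ler_wpM2r //; move: ar; rewrite ler_norml /K => /andP[? ?].
  rewrite ger0_norm; lra.
have gK (s : R) : 0 <= s <= 1 -> `|g s| <= r.
  by move=> hs; rewrite -ler_sqr ?nnegrE // real_normK ?num_real //; have := gr _ hs; lra.
have dt1 : `|t - t'| * (2 * K) < e.
  by rewrite -ltr_pdivlMr ?mulr_gt0 //; apply: lt_le_trans dt _; rewrite ge_min lexx.
have dt2 : `|t - t'| * (4 * (K * K)) < e ^+ 2.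
  rewrite -ltr_pdivlMr ?mulr_gt0 //; apply: lt_le_trans dt _.
  by rewrite ge_min lexx orbT.
apply: le_lt_trans (cnorm_leReIm _) _; rewrite /f /=.
rewrite -mulrBr normrM.
have -> : `|sg| = 1 by rewrite /sg; case: ifP; rewrite ?normrN1 ?normr1.
rewrite mul1r.
have := sqrt_dist (gr _ ht) (gr _ ht').
have -> : r ^+ 2 - g t ^+ 2 - (r ^+ 2 - g t' ^+ 2) = (g t' - g t) * (g t' + g t) by ring.
have : Num.sqrt `|(g t' - g t) * (g t' + g t)| < e / 2.
  rewrite -(ltr_pXn2r (n := 2)) ?nnegrE ?sqrtr_ge0 ?divr_ge0 ?(ltW e0) // sqr_sqrtr //.
  rewrite normrM distrC.
  apply: le_lt_trans (_ : _ <= (K * `|t - t'|) * K) _.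
    apply: ler_pM => //; apply: le_trans (ler_normD _ _) _.
    by have := gK _ ht; have := gK _ ht'; rewrite /K; lra.
  by rewrite expr_div_n; lra.
lra.
Qed.

End Chains.

Section Covering.
Variable R : realType.
Implicit Types (x y z w : R[i]) (e : R).

Variables (over : R[i] -> R[i] -> Prop) (c : R[i]) (r : R) (eta : R).
Hypotheses (r0 : 0 <= r) (eta0 : 0 < eta).
Local Notation D w := (cnorm (w - c) <= r).
Hypothesis sep : forall w y y', D w -> over w y -> over w y' -> cnorm (y - y') < eta -> y = y'.
Hypothesis lift : forall s : R, 0 < s -> exists2 k : R, 0 < k & forall w w' y,
  D w -> D w' -> cnorm (w - w') < k -> over w y -> exists2 y', over w' y' & cnorm (y' - y) < s.

(** [over w y] puts [y] in the fibre over [w]; [sep] and [lift] are what compactness offers in place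
    of local trivialisations. The margin [eta / 8] keeps several displacements together below [eta],
    where [sep] forces equality. *)
Lemma transport : exists2 k : R, 0 < k & exists T : R[i] -> R[i] -> R[i] -> R[i],
  forall w w' y, D w -> D w' -> cnorm (w - w') < k -> over w y ->
    over w' (T w w' y) /\ cnorm (T w w' y - y) < eta / 8.
Proof.
have e8 : 0 < eta / 8 by rewrite divr_gt0.
have [k k0 hk] := lift e8; exists k => //.
have /choice[T hT] : forall p : R[i] * R[i] * R[i], exists y',
  D p.1.1 -> D p.1.2 -> cnorm (p.1.1 - p.1.2) < k -> over p.1.1 p.2 ->
  over p.1.2 y' /\ cnorm (y' - p.2) < eta / 8.
  move=> [[w w'] y] /=.
  have [[h1 h2 h3 h4]|nh] := pselect [/\ D w, D w', cnorm (w - w') < k & over w y].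
    by have [y' ? ?] := hk _ _ _ h1 h2 h3 h4; exists y'.
  by exists 0 => h1 h2 h3 h4; case: nh.
by exists (fun w w' y => T (w, w', y)) => w w' y; apply: (hT (w, w', y)).
Qed.

(* Over a disc the covering is trivial: [lab w y] is the point of the central
   fibre which lies in the same sheet as [y]. *)
Theorem covering_label : exists lab : R[i] -> R[i] -> R[i],
  [/\ forall w y, D w -> over w y -> over c (lab w y),
      forall w y0, D w -> over c y0 -> exists2 y, over w y & lab w y = y0,
      forall w y y', D w -> over w y -> over w y' -> lab w y = lab w y' -> y = y',
      (forall y, over c y -> lab c y = y) &
      (exists2 k : R, 0 < k & forall w w' y y', D w -> D w' -> over w y -> over w' y' ->
         cnorm (w - w') < k -> cnorm (y - y') < k -> lab w y = lab w' y') /\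
      forall a : R[i], c = 0 -> cnorm a = 1 ->
        (forall w y, D w -> over w y -> over (a * w) (a * y)) ->
        forall w y, D w -> over w y -> lab (a * w) (a * y) = a * lab w y].
Proof.
have [k k0 [T hT]] := transport.
have [N hN] : exists N : nat, r / N.+1%:R < k.
  have [N /(_ _ (leqnn _)) hN] := @invn_lt R (k / (r + 1)) (divr_gt0 k0 (ltr_wpDl r0 ltr01)).
  exists N; move: hN; rewrite ltr_pdivlMr ?ltr_wpDl // => h; apply: le_lt_trans h.
  by rewrite mulrC ler_wpM2l ?invr_ge0 // lerDl.
have N0 : 0 < N.+1%:R :> R by rewrite ltr0n.
(* Points on the radius from the centre to [w], in [N.+1] steps shorter than [k]. *)
pose P j w : R[i] := c + (j%:R / N.+1%:R)%:C * (w - c).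
have P0 w : P 0%N w = c by rewrite /P mul0r mul0r addr0.
have PN w : P N.+1 w = w by rewrite /P divff ?gt_eqF // mul1r addrC subrK.
have Pc j : P j c = c by rewrite /P subrr mulr0 addr0.
have frac (j : nat) : (j <= N.+1)%N -> 0 <= (j%:R / N.+1%:R : R) <= 1.
  by move=> jN; rewrite divr_ge0 ?ler0n //= ler_pdivrMr // mul1r ler_nat.
have PD j w : (j <= N.+1)%N -> D w -> D (P j w).
  move=> /frac/andP[h0 h1] Dw; rewrite /P addrAC subrr add0r cnormM cnorm_real ger0_norm //.
  by apply: le_trans Dw; rewrite ler_piMl.
have Plip j w w' : (j <= N.+1)%N -> cnorm (P j w - P j w') <= cnorm (w - w').
  move=> /frac/andP[h0 h1].
  have -> : P j w - P j w' = (j%:R / N.+1%:R)%:C * (w - w') by rewrite /P; ring.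
  by rewrite cnormM cnorm_real ger0_norm // ler_piMl.
have Pstep j w : D w -> cnorm (P j.+1 w - P j w) < k.
  move=> Dw; have -> : P j.+1 w - P j w = (N.+1%:R^-1)%:C * (w - c).
    rewrite /P -addn1 natrD mulrDl rmorphD /= mul1r; ring.
  rewrite cnormM cnorm_real ger0_norm ?invr_ge0 ?ltW //; apply: le_lt_trans hN.
  by rewrite mulrC ler_wpM2r // invr_ge0 ltW.
have cD : D c by rewrite subrr cnorm0.
(* The label is built outwards: over [P j.+1 w] it is one transport back to [P j w] followed by the
   label obtained there. *)
suff H j : (j <= N.+1)%N -> exists lab : R[i] -> R[i] -> R[i],
  [/\ forall w y, D w -> over (P j w) y -> over c (lab w y),
      forall w y0, D w -> over c y0 -> exists2 y, over (P j w) y & lab w y = y0,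
      forall w y y', D w -> over (P j w) y -> over (P j w) y' -> lab w y = lab w y' -> y = y',
      (forall y, over c y -> lab c y = y) &
      (exists2 k : R, 0 < k & forall w w' y y', D w -> D w' -> over (P j w) y -> over (P j w') y' ->
         cnorm (w - w') < k -> cnorm (y - y') < k -> lab w y = lab w' y') /\
      forall a : R[i], c = 0 -> cnorm a = 1 ->
        (forall w y, D w -> over w y -> over (a * w) (a * y)) ->
        forall w y, D w -> over (P j w) y -> lab (a * w) (a * y) = a * lab w y].
  have [lab hlab] := H _ (leqnn _); exists lab; case: hlab => h1 h2 h3 h4 [[k' k'0 h5] h6].
  split=> //.
  - by move=> w y Dw; move: (h1 w y Dw); rewrite PN.
  - by move=> w y0 Dw o0; have [y] := h2 w y0 Dw o0; rewrite PN; exists y.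
  - by move=> w y y' Dw; move: (h3 w y y' Dw); rewrite PN.
  split; first by exists k' => // w w' y y' Dw Dw'; move: (h5 w w' y y' Dw Dw'); rewrite !PN.
  by move=> a c0 a1 ha w y Dw; move: (h6 a c0 a1 ha w y Dw); rewrite PN.
elim: j => [_|j IH jN].
  exists (fun _ y => y); split=> //.
  - by move=> w y _; rewrite P0.
  - by move=> w y0 _ o0; exists y0; rewrite ?P0.
  split=> //; exists eta => // w w' y y' _ _; rewrite !P0 => o o' _; exact: (sep cD).
have jN' := ltnW jN; have [lab [h1 h2 h3 h4 [[k' k'0 h5] h6]]] := IH jN'.
pose U w y := T (P j.+1 w) (P j w) y.
have hU w y : D w -> over (P j.+1 w) y -> over (P j w) (U w y) /\ cnorm (U w y - y) < eta / 8.
  by move=> Dw o; apply: hT => //; [exact: PD | exact: PD | exact: Pstep].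
exists (fun w y => lab w (U w y)); split.
- by move=> w y Dw o; apply: h1 => //; case: (hU w y Dw o).
- move=> w y0 Dw o0; have [y' o' hy'] := h2 w y0 Dw o0.
  have st : cnorm (P j w - P j.+1 w) < k by rewrite cdistC Pstep.
  have [o hy] := hT _ _ _ (PD _ _ jN' Dw) (PD _ _ jN Dw) st o'.
  exists (T (P j w) (P j.+1 w) y') => //; rewrite -hy'; congr lab.
  have [o2 hy2] := hU _ _ Dw o; apply: (sep (PD _ _ jN' Dw)) => //.
  have := cdist_triangle (T (P j w) (P j.+1 w) y') (U w (T (P j w) (P j.+1 w) y')) y'.
  by move: eta0; lra.
- move=> w y y' Dw o o'; have [oU hy] := hU _ _ Dw o; have [oU' hy'] := hU _ _ Dw o'.
  move=> /(h3 _ _ _ Dw oU oU') E; apply: (sep (PD _ _ jN Dw)) => //.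
  have := cdist_triangle (U w y) y y'; rewrite (cdistC y (U w y)).
  by move: eta0 hy'; rewrite -E; lra.
- move=> y oy; have oy' : over (P j.+1 c) y by rewrite Pc.
  have [oU hy] := hU c y cD oy'; have -> : U c y = y; last exact: h4.
  apply: (sep cD) => //; first by rewrite Pc in oU.
  by move: eta0; lra.
split.
  have m0 : 0 < Num.min k' (eta / 8) by rewrite lt_min k'0 divr_gt0.
  have [k2 k20 hk2] := lift m0.
  exists (Num.min (Num.min k' k2) (eta / 8)).
    by rewrite !lt_min k'0 k20 divr_gt0.
  move=> w w' y y' Dw Dw' o o'; rewrite !lt_min => /andP[/andP[w1 w2] w3] /andP[/andP[y1 y2] y3].
  have [oU hy] := hU _ _ Dw o; have [oU' hy'] := hU _ _ Dw' o'.
  have [y2' o2 ] := hk2 _ _ _ (PD _ _ jN' Dw) (PD _ _ jN' Dw') (le_lt_trans (Plip _ _ _ jN') w2) oU.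
  rewrite lt_min => /andP[d1 d2].
  have E : y2' = U w' y'.
    apply: (sep (PD _ _ jN' Dw')) => //.
    have := cdist_triangle (U w y) y2' (U w' y').
    have := cdist_triangle y (U w y) (U w' y').
    have := cdist_triangle y' y (U w' y'); rewrite (cdistC y' (U w' y')).
    by move: eta0; lra.
  by apply: h5; rewrite // -?E // cdistC.
(* A rotation about 0 preserving [over] commutes with transport: the two candidates lie in one
   fibre, closer than [eta]. *)
move=> a c0 a1 ha w y Dw o; have [oU hy] := hU _ _ Dw o.
have Da v : D v -> D (a * v) by rewrite c0 !subr0 cnormM a1 mul1r.
have Pa i v : P i (a * v) = a * P i v by rewrite /P c0; ring.
have o' : over (P j.+1 (a * w)) (a * y) by rewrite Pa; apply: ha => //; exact: PD.
have [oU' hy'] := hU _ _ (Da _ Dw) o'.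
have -> : U (a * w) (a * y) = a * U w y; last exact: h6.
apply: (sep (PD _ _ jN' (Da _ Dw))) => //.
  by rewrite Pa; apply: ha => //; exact: PD.
have := cdist_triangle (a * y) (U (a * w) (a * y)) (a * U w y).
rewrite -(mulrBr a) cnormM a1 mul1r (cdistC y).
by move: eta0; lra.
Qed.

End Covering.

(** * Limits of sums and products, joint subsequences *)

Section Limits.
Variable R : realType.
Implicit Types (u v : nat -> R[i]) (l m : R[i]).

Lemma ccvg_cst l : ccvg (fun _ => l) l.
Proof. by move=> e e0; exists 0%N => n _; rewrite subrr cnorm0. Qed.

Lemma ccvgD u v l m : ccvg u l -> ccvg v m -> ccvg (fun n => u n + v n) (l + m).
Proof.
move=> ul vm e e0; have e2 : 0 < e / 2 by rewrite divr_gt0.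
have [N hN] := ul _ e2; have [N' hN'] := vm _ e2; exists (maxn N N') => n.
rewrite geq_max => /andP[/hN h /hN' h'].
have -> : u n + v n - (l + m) = (u n - l) + (v n - m) by ring.
by apply: le_lt_trans (cnormD _ _) _; lra.
Qed.

Lemma ccvgZ (a : R[i]) u l : ccvg u l -> ccvg (fun n => a * u n) (a * l).
Proof.
move=> ul; have := ccvg_poly (a *: 'X) ul; rewrite !hornerE.
by under eq_fun do rewrite !hornerE.
Qed.

(** Polarisation turns the product into two squares, to which [ccvg_poly] applies. *)
Lemma ccvgM u v l m : ccvg u l -> ccvg v m -> ccvg (fun n => u n * v n) (l * m).
Proof.
move=> ul vm.
have sq (w : nat -> R[i]) k : ccvg w k -> ccvg (fun n => 4^-1 * (w n ^+ 2)) (4^-1 * k ^+ 2).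
  move=> wk; apply: (@ccvgZ 4^-1 (fun n => w n ^+ 2)); have := ccvg_poly ('X ^+ 2) wk; rewrite !hornerE.
  by under eq_fun do rewrite !hornerE.
have -> : l * m = 4^-1 * (l + m) ^+ 2 + (- 1) * (4^-1 * (l + (- 1) * m) ^+ 2) by field.
have -> : (fun n => u n * v n) = fun n => 4^-1 * (u n + v n) ^+ 2
    + (- 1) * (4^-1 * (u n + (- 1) * v n) ^+ 2) by apply/funext => n; field.
have sumcv := ccvgD ul vm.
have difcv := ccvgD ul (ccvgZ (- 1) vm).
exact: (ccvgD (sq _ _ sumcv) (ccvgZ (- 1) (sq _ _ difcv))).
Qed.

Lemma ccvgX u l k : ccvg u l -> ccvg (fun n => u n ^+ k) (l ^+ k).
Proof.
move=> ul; elim: k => [|k IH].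
  by rewrite expr0; under eq_fun do rewrite expr0; exact: ccvg_cst.
by rewrite exprS; under eq_fun do rewrite exprS; exact: ccvgM.
Qed.

Lemma ccvg_sum (I : Type) (s : seq I) (u : I -> nat -> R[i]) (l : I -> R[i]) :
  (forall i, ccvg (u i) (l i)) ->
  ccvg (fun n => \sum_(i <- s) u i n) (\sum_(i <- s) l i).
Proof.
move=> h; elim: s => [|i s IH].
  by rewrite big_nil; under eq_fun do rewrite big_nil; exact: ccvg_cst.
by rewrite big_cons; under eq_fun do rewrite big_cons; exact: ccvgD.
Qed.

Lemma ccvg_close u v l : ccvg u l -> (forall n, cnorm (u n - v n) < n.+1%:R^-1) -> ccvg v l.
Proof.
move=> ul uv e e0; have e2 : 0 < e / 2 by rewrite divr_gt0.
have [N hN] := ul _ e2; have [N' hN'] := invn_lt e2; exists (maxn N N') => n.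
rewrite geq_max => /andP[/hN h /hN' h']; have := cdist_triangle (u n) (v n) l.
have := lt_trans (uv n) h'; clear h'; rewrite (cdistC (v n) (u n)); lra.
Qed.

Lemma inv_extraction phi n : extraction phi -> (phi n).+1%:R^-1 <= n.+1%:R^-1 :> R.
Proof.
move=> /extraction_ge h; rewrite lef_pV2 ?posrE ?ltr0n // ler_nat ltnS; exact: h.
Qed.

Lemma bolzano2 u v (M : R) : (forall n, cnorm (u n) <= M) -> (forall n, cnorm (v n) <= M) ->
  exists2 phi, extraction phi & exists l m, ccvg (u \o phi) l /\ ccvg (v \o phi) m.
Proof.
move=> uM vM; have [phi hphi [l hl]] := bolzano uM.
have [psi hpsi [m hm]] := @bolzano _ (v \o phi) M (fun n => vM _).
exists (phi \o psi); first exact: extraction_comp.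
by exists l, m; split=> //; apply: ccvg_extraction hl hpsi.
Qed.

End Limits.

(** * Roots of polynomials whose coefficients depend on a parameter in a disc *)

Section Families.
Variable R : realType.
Implicit Types (x y z w : R[i]) (e : R).
Variables (n : nat) (A : nat -> {poly R[i]}) (a c : R[i]) (r : R).
Hypotheses (n0 : (0 < n)%N) (An : A n = a%:P) (a0 : a != 0).

(** The constant leading coefficient [a] fixes the degree, so no root runs to infinity over the
    disc. *)
Definition fam w : {poly R[i]} := \poly_(k < n.+1) (A k).[w].
Local Notation D w := (cnorm (w - c) <= r).
Hypothesis simple : forall w y, D w -> (fam w).[y] = 0 -> (fam w)^`().[y] != 0.

Lemma famE w y : (fam w).[y] = \sum_(k < n.+1) (A k).[w] * y ^+ k.
Proof. by rewrite horner_poly. Qed.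

Lemma fam_lead w : lead_coef (fam w) = a.
Proof. by rewrite lead_coef_poly // An hornerC. Qed.

Lemma fam_size w : size (fam w) = n.+1.
Proof. by rewrite size_poly_eq // An hornerC. Qed.

Lemma fam_disc_bounded w : D w -> cnorm w <= cnorm c + r.
Proof. by move=> h; apply: le_trans (cnorm_le_dist _ c) _; rewrite lerD2l. Qed.

Lemma fam_bounded : exists B : R, forall w y, D w -> (fam w).[y] = 0 -> cnorm y <= B.
Proof.
have /choice[B hB] : forall k, exists B : R, 0 <= B /\ forall w, D w -> cnorm (A k).[w] <= B.
  move=> k; have [B B0 hB] := poly_bounded (A k) (cnorm c + r).
  by exists B; split=> // w /fam_disc_bounded/hB.
have ca : 0 < cnorm a by rewrite cnorm_gt0.
pose C := \sum_(k < n) B k; have C0 : 0 <= C by apply: sumr_ge0 => k _; case: (hB k).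
exists (1 + C / cnorm a) => w y Dw; rewrite leNgt => h0; apply/negP => lt.
have y1 : 1 <= cnorm y by apply: le_trans (ltW lt); rewrite lerDl divr_ge0.
have y0 : 0 < cnorm y by apply: lt_le_trans y1.
have yC : C < cnorm a * cnorm y.
  by rewrite mulrC -ltr_pdivrMr //; apply: le_lt_trans lt; rewrite lerDr.
move: h0; rewrite famE big_ord_recr /= An hornerC => /eqP; rewrite addrC addr_eq0 => /eqP.
move=> /(congr1 (@cnorm R)); rewrite cnormN cnormM cnormX => E.
have : cnorm (\sum_(i < n) (A i).[w] * y ^+ i) <= C * cnorm y ^+ n.-1.
  apply: le_trans (_ : _ <= \sum_(i < n) cnorm ((A i).[w] * y ^+ i)) _.
    elim: (index_enum _) => [|i s IH]; first by rewrite !big_nil cnorm0.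
    by rewrite !big_cons; apply: le_trans (cnormD _ _) _; rewrite lerD2l.
  rewrite mulr_suml; apply: ler_sum => i _; rewrite cnormM cnormX.
  apply: ler_pM; rewrite ?exprn_ge0 //; first by case: (hB i) => _; apply.
  by apply: ler_weXn2l => //; rewrite -ltnS prednK.
rewrite -E -{1}(prednK n0) exprS mulrA ler_pM2r ?exprn_gt0 //.
by rewrite leNgt yC.
Qed.

Lemma ccvg_fam (u v : nat -> R[i]) w y : ccvg u w -> ccvg v y ->
  ccvg (fun j => (fam (u j)).[v j]) (fam w).[y].
Proof.
move=> uw vy; rewrite famE; under eq_fun do rewrite famE.
by apply: ccvg_sum => k; apply: ccvgM; [apply: ccvg_poly | apply: ccvgX].
Qed.

(** The divided difference in the unknown, written as a polynomial so that it extends to the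
    diagonal. *)
Definition divided w y y' : R[i] :=
  \sum_(k < n.+1) (A k).[w] * \sum_(i < k) y ^+ (k.-1 - i) * y' ^+ i.

Lemma dividedE w y y' : (fam w).[y] - (fam w).[y'] = (y - y') * divided w y y'.
Proof.
rewrite !famE -sumrB mulr_sumr; apply: eq_bigr => k _.
by rewrite -mulrBr subrXX mulrCA.
Qed.

Lemma divided_diag w y : divided w y y = (fam w)^`().[y].
Proof.
rewrite /fam poly_def raddf_sum horner_sum; apply: eq_bigr => k _.
rewrite /= derivZ derivXn hornerZ hornerMn hornerXn; congr (_ * _).
rewrite -[X in _ *+ X]card_ord -sumr_const; apply: eq_bigr => i _.
have k0 : (0 < k)%N by apply: leq_ltn_trans (ltn_ord i).
have ik : (i <= k.-1)%N by rewrite -ltnS prednK.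
by rewrite -exprD subnK.
Qed.

Lemma ccvg_divided (u v v' : nat -> R[i]) w y : ccvg u w -> ccvg v y -> ccvg v' y ->
  ccvg (fun j => divided (u j) (v j) (v' j)) (divided w y y).
Proof.
move=> uw vy vy'; apply: ccvg_sum => k; apply: ccvgM; first exact: ccvg_poly.
by apply: ccvg_sum => i; apply: ccvgM; apply: ccvgX.
Qed.

Lemma D_closed (u : nat -> R[i]) w : (forall j, D (u j)) -> ccvg u w -> D w.
Proof. exact: cball_closed. Qed.

(** At distinct roots of one polynomial the divided difference vanishes; if such roots merged in a
    limit, the derivative would vanish there, against [simple]. *)
Lemma fam_sep : exists2 eta : R, 0 < eta & forall w y y', D w ->
  (fam w).[y] = 0 -> (fam w).[y'] = 0 -> cnorm (y - y') < eta -> y = y'.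
Proof.
have [B hB] := fam_bounded; apply: contrapT => h.
have /choice[t ht] : forall j : nat, exists t : R[i] * R[i] * R[i],
  [/\ D t.1.1, (fam t.1.1).[t.1.2] = 0, (fam t.1.1).[t.2] = 0,
    cnorm (t.1.2 - t.2) < j.+1%:R^-1 & t.1.2 <> t.2].
  move=> j; apply: contrapT => h'; apply: h; exists j.+1%:R^-1; first by rewrite invr_gt0 ltr0n.
  by move=> w y y' *; apply: contrapT => ne; apply: h'; exists (w, y, y').
have [||phi hphi [w [y [hw hy]]]] := @bolzano2 R (fun j => (t j).1.1) (fun j => (t j).1.2)
  (Num.max (cnorm c + r) B).
- by move=> j; have [/fam_disc_bounded] := ht j; rewrite le_max => ->.
- by move=> j; have [Dw /hB-/(_ Dw)] := ht j; rewrite le_max orbC => ->.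
have hy' : ccvg (fun j => (t (phi j)).2) y.
  apply: ccvg_close hy _ => j; have [_ _ _ + _] := ht (phi j).
  by move=> /lt_le_trans; apply; exact: inv_extraction.
have Dw : D w by apply: D_closed hw => j; case: (ht (phi j)).
have fw : (fam w).[y] = 0.
  apply: (ccvg_unique (ccvg_fam hw hy)) => e e0; exists 0%N => j _ /=.
  by have [_ -> _ _ _] := ht (phi j); rewrite subrr cnorm0.
have /negP := simple Dw fw; apply; rewrite -divided_diag; apply/eqP.
apply: (ccvg_unique (ccvg_divided hw hy hy')) => e e0; exists 0%N => j _ /=.
have [_ f1 f2 _ ne] := ht (phi j); have := dividedE (t (phi j)).1.1 (t (phi j)).1.2 (t (phi j)).2.
rewrite f1 f2 subrr => /esym/eqP; rewrite mulf_eq0 subr_eq0 => /orP[/eqP//|/eqP ->].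
by rewrite subrr cnorm0.
Qed.

(** A root at [w] is almost a root at a nearby [w'], and [root_near] asks only for degree and
    leading coefficient, which do not vary. *)
Lemma fam_lift (s : R) : 0 < s -> exists2 k : R, 0 < k & forall w w' y,
  D w -> D w' -> cnorm (w - w') < k -> (fam w).[y] = 0 ->
  exists2 y', (fam w').[y'] = 0 & cnorm (y' - y) < s.
Proof.
move=> s0; have [B hB] := fam_bounded; apply: contrapT => h.
have /choice[t ht] : forall j : nat, exists t : R[i] * R[i] * R[i],
  [/\ D t.1.1, D t.1.2, (fam t.1.1).[t.2] = 0, cnorm (t.1.1 - t.1.2) < j.+1%:R^-1 &
    ~ exists2 y', (fam t.1.2).[y'] = 0 & cnorm (y' - t.2) < s].
  move=> j; apply: contrapT => h'; apply: h; exists j.+1%:R^-1; first by rewrite invr_gt0 ltr0n.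
  by move=> w w' y *; apply: contrapT => ne; apply: h'; exists (w, w', y).
have [||phi hphi [w [y [hw hy]]]] := @bolzano2 R (fun j => (t j).1.1) (fun j => (t j).2)
  (Num.max (cnorm c + r) B).
- by move=> j; have [/fam_disc_bounded] := ht j; rewrite le_max => ->.
- by move=> j; have [Dw _ /hB-/(_ Dw)] := ht j; rewrite le_max orbC => ->.
have hw' : ccvg (fun j => (t (phi j)).1.2) w.
  apply: ccvg_close hw _ => j; have [_ _ _ + _] := ht (phi j).
  by move=> /lt_le_trans; apply; exact: inv_extraction.
have fw : (fam w).[y] = 0.
  apply: (ccvg_unique (ccvg_fam hw hy)) => e e0; exists 0%N => j _ /=.
  by have [_ _ -> _ _] := ht (phi j); rewrite subrr cnorm0.
have := ccvg_fam hw' hy; rewrite fw => /(_ (cnorm a * s ^+ n)).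
have as0 : 0 < cnorm a * s ^+ n by rewrite mulr_gt0 ?exprn_gt0 ?cnorm_gt0.
move=> /(_ as0)[N /(_ _ (leqnn _)) /= hN].
have [_ _ _ _] := ht (phi N); apply; apply: root_near (ltW s0) _ _.
  by rewrite fam_size ltnS.
by rewrite fam_lead fam_size.
Qed.

End Families.

(** * Inverse branches and level curves *)

Section Branches.
Variable R : realType.
Implicit Types (x y z w t u : R[i]) (e : R) (F h : {poly R[i]}).

(** A Schwarz lemma for the branch of the inverse of [h] sending [u] to [l], without treating that
    branch as a function: the maximum principle is applied to the reciprocal of s = (h - u) / (X -
    l) on the sheet [V] of [l]. On its boundary |h - u| = d / 2 and |x - l| <= 2 B, whence the
    factor 4 B / d. *)
Lemma branch_near h u l b (d B : R) : (1 < size h)%N -> 0 < d ->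
  (forall c, (h^`()).[c] = 0 -> d <= cnorm (h.[c] - u)) ->
  (forall w, cnorm (h.[w] - u) < d -> cnorm w <= B) ->
  h.[l] = u -> cnorm (b - u) <= d / 2 ->
  exists2 b', h.[b'] = b & cnorm (b' - l) <= 4 * B / d * cnorm (b - u).
Proof.
move=> sh d0 hcrit hB hl hb.
have d20 : 0 < d / 2 by rewrite divr_gt0.
have d2d : d / 2 < d by move: d0; lra.
(* Coefficients of [h - t] as polynomials in the parameter [t]. *)
pose A k : {poly R[i]} := (h`_k)%:P - (if k == 0%N then 'X else 0).
pose n := (size h).-1.
have nE : size h = n.+1 by rewrite prednK // ltnW.
have n0 : (0 < n)%N by rewrite -ltnS -nE.
have An : A n = (lead_coef h)%:P by rewrite /A gtn_eqF // subr0 lead_coefE.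
have a0 : lead_coef h != 0 by rewrite lead_coef_eq0 -size_poly_gt0 ltnW.
have famh t : fam n A t = h - t%:P.
  apply/polyP => i; rewrite coef_poly coefB coefC /A -nE.
  case: ltnP => [_|le].
    by rewrite !hornerE; case: eqP => _; rewrite !hornerE.
  by rewrite nth_default // gtn_eqF ?subr0 // (leq_trans _ le) // ltnW.
have overE t y : (fam n A t).[y] = 0 <-> h.[y] = t.
  by rewrite famh !hornerE; split=> [/eqP|->]; [rewrite subr_eq0 => /eqP | rewrite subrr].
have simple w y : cnorm (w - u) <= d / 2 -> (fam n A w).[y] = 0 -> (fam n A w)^`().[y] != 0.
  move=> wu /overE hy; apply/negP; rewrite famh derivB derivC subr0 => /eqP /hcrit.
  by rewrite hy leNgt (le_lt_trans wu).
have [eta eta0 sep] := fam_sep n0 An a0 simple.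
have lift := fam_lift u (d / 2) n0 An a0.
have uD : cnorm (u - u) <= d / 2 by rewrite subrr cnorm0 ltW.
have [lab [l1 l2 l3 l4 [[k k0 l5] _]]] := covering_label (ltW d20) eta0 sep lift.
pose V x := cnorm (h.[x] - u) <= d / 2 /\ lab h.[x] x = l.
have VB x : V x -> cnorm x <= B by move=> [/le_lt_trans/(_ d2d)/hB].
have lV : V l by split; rewrite hl //; apply: l4; apply/overE.
have B0 : 0 <= B by apply: le_trans (VB _ lV).
have [s hs] := factor_at h l; have hsE := horner_factor hs.
have M0 : 0 <= 4 * B / d by rewrite divr_ge0 ?mulr_ge0 // ltW.
have ML : 4 * B / d * (d / 2) = 2 * B by field; rewrite gt_eqF.
(* A zero of [s] on the sheet lies over [u], so it is [l], where [s] equals the derivative of [h];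
   but [u] is not a critical value. *)
have sV x : V x -> s.[x] != 0.
  move=> [hx labx]; apply/eqP => sx.
  have xu : h.[x] = u by apply/eqP; rewrite -subr_eq0 -{1}hl hsE sx mul0r.
  have xl : x = l by rewrite -labx xu l4 //; apply/overE.
  have := hcrit l; rewrite (deriv_factor hs) -xl sx xu subrr cnorm0 => /(_ erefl).
  by rewrite leNgt d0.
have Vmax x : V x -> 1 <= 4 * B / d * cnorm s.[x].
  move=> Vx; have E : cnorm (1%:P : {poly R[i]}).[x] = 1 by rewrite hornerC cnorm1.
  rewrite -[leLHS]E.
  apply: (max_principle _ _ _ _ _ Vx) => //.
  - move=> v z hv vz.
    have hz : cnorm (h.[z] - u) <= d / 2.
      apply: (@cball_closed R u (d / 2) (fun n => h.[v n])); last exact: ccvg_poly.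
      by move=> j; case: (hv j).
    split=> //; have [N hN] := vz _ k0; have [N' hN'] := ccvg_poly h vz k0.
    pose j := maxn N N'; have [hj <-] := hv j.
    have fz x' : (fam n A h.[x']).[x'] = 0 by apply/overE.
    by apply: l5; rewrite // cdistC ?hN ?hN' // ?leq_maxl ?leq_maxr.
  - by exists B.
  - move=> z Vz; have [hz labz] := Vz; rewrite hornerC cnorm1.
    have [eqd|[e e0 he]] := cball_dichotomy hz.
      left; have zl : 0 < cnorm (z - l).
        rewrite cnorm_gt0 subr_eq0; apply/eqP => zl; move: eqd.
        by rewrite zl hl subrr cnorm0; move: d0; lra.
      rewrite -(ler_pM2r zl) -(mulrA (4 * B / d)) -cnormM -hsE hl eqd ML mul1r.
      by apply: le_trans (cnormB _ _) _; have := VB _ Vz; have := VB _ lV; lra.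
    right; have m0 : 0 < Num.min e k by rewrite lt_min e0.
    have [g g0 hg] := cts_poly h z m0.
    exists (Num.min g k); first by rewrite lt_min g0.
    move=> w; rewrite lt_min => /andP[/hg + wk]; rewrite lt_min => /andP[we wk'].
    split; first exact: he.
    have fz x' : (fam n A h.[x']).[x'] = 0 by apply/overE.
    by rewrite -labz; apply: l5 => //; apply: he.
have [b' /overE hb' labb] := l2 b l hb (iffRL (overE _ _) hl).
exists b' => //; have Vb : V b' by split; rewrite hb'.
have := ler_wpM2r (cnorm_ge0 (b' - l)) (Vmax _ Vb).
by rewrite mul1r -(mulrA (4 * B / d)) -cnormM -hsE hb' hl.
Qed.

(** F(z) = w^-n with z = y / w reads w^n F(y / w) = 1, polynomial in [w] and [y], and a y^n = 1 at w
    = 0. Roots are simple for |w| <= rho, where rho^n = 1 / r, because critical values have modulus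
    below [r]. A single sheet [Y] then maps the circle |w| = rho onto the whole level curve. *)
Lemma level_chain F (r e : R) x y : (1 < size F)%N -> 0 < r -> 0 < e ->
  (forall c, (F^`()).[c] = 0 -> cnorm F.[c] < r) ->
  cnorm F.[x] = r -> cnorm F.[y] = r ->
  chain (fun w => cnorm F.[w] = r) e x y.
Proof.
move=> sF r0 e0 hcrit Fx Fy.
pose n := (size F).-1; pose a := lead_coef F.
have nE : size F = n.+1 by rewrite prednK // ltnW.
have n0 : (0 < n)%N by rewrite -ltnS -nE.
pose A k : {poly R[i]} := F`_k *: 'X^(n - k) - (if k == 0%N then 1 else 0).
have An : A n = a%:P.
  rewrite /A gtn_eqF // subr0 subnn expr0. by rewrite alg_polyC /a lead_coefE.
have a0 : a != 0 by rewrite lead_coef_eq0 -size_poly_gt0 ltnW.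
have AE k w : (A k).[w] = F`_k * w ^+ (n - k) - (k == 0%N)%:R.
  by rewrite /A; case: (k == 0%N); rewrite !hornerE.
have famE' w z : (fam n A w).[z] = \sum_(k < n.+1) F`_k * w ^+ (n - k) * z ^+ k - 1.
  rewrite famE; under eq_bigr do rewrite AE mulrBl.
  rewrite sumrB; congr (_ - _); rewrite big_ord_recl big1 ?addr0 ?mul1r //.
  by move=> i _; rewrite mul0r.
have famN w : w != 0 -> fam n A w = w ^+ n *: (F \Po (w^-1 *: 'X)) - 1.
  move=> w0; apply/polyP => i.
  have -> : F \Po (w^-1 *: 'X) = \poly_(k < n.+1) (F`_k * w^-1 ^+ k).
    rewrite comp_polyE poly_def nE; apply: eq_bigr => k _.
    by rewrite exprZn scalerA.
  rewrite coefB coefZ !coef_poly coef1.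
  case: ltnP => [le|gt]; last by rewrite gtn_eqF ?mulr0 ?subr0 // (leq_trans _ gt).
  rewrite AE; have -> : w ^+ (n - i) = w ^+ n * w^-1 ^+ i.
    by rewrite exprVn -[in RHS](subnK (le : (i <= n)%N)) exprD mulfK // expf_neq0.
  by rewrite mulrCA.
have fam0 : fam n A 0 = a *: 'X^n - 1.
  apply/polyP => i; rewrite coefB coefZ coefXn coef_poly coef1 /A.
  case: ltnP => [|gt]; last by rewrite !gtn_eqF ?mulr0 ?subr0 // (leq_trans _ gt).
  rewrite AE ltnS leq_eqVlt => /orP[/eqP ->|lt].
    by rewrite subnn eqxx gtn_eqF // expr0 /a lead_coefE.
  by rewrite (ltn_eqF lt) expr0n subn_eq0 leqNgt lt /= !mulr0.
have [g gn] : exists g : R[i], a * g ^+ n = 1.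
  by exists (n.-root (a^-1)); rewrite rootCK // mulfV.
have [rho rho0 rhon] : exists2 rho : R, 0 < rho & rho ^+ n = r^-1.
  pose q : R[i] := n.-root (r^-1)%:C.
  have qn : cnorm q ^+ n = r^-1 by rewrite -cnormX rootCK // cnorm_real ger0_norm // invr_ge0 ltW.
  exists (cnorm q) => //; rewrite lt_def cnorm_ge0 andbT; apply/eqP => q0.
  by move: qn; rewrite q0 expr0n gtn_eqF // => /esym/eqP; rewrite invr_eq0 gt_eqF.
have over_ne w z : w != 0 -> (fam n A w).[z] = 0 <-> F.[z / w] = w ^- n.
  move=> w0; rewrite famN // !hornerE horner_comp !hornerE (mulrC w^-1).
  have wn : w ^+ n != 0 by rewrite expf_neq0.
  split=> [/eqP|->]; last by rewrite mulfV // subrr.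
  by rewrite subr_eq0 => /eqP h; rewrite -[LHS]mul1r -(mulVf wn) -mulrA h mulr1.
have simple w z : cnorm (w - 0) <= rho -> (fam n A w).[z] = 0 -> (fam n A w)^`().[z] != 0.
  rewrite subr0 => wr; have [->|w0] := eqVneq w 0.
    rewrite fam0 !hornerE => /eqP; rewrite subr_eq0 => /eqP az.
    rewrite derivB derivC subr0 derivZ derivXn !hornerE.
    have z0 : z != 0.
      by apply/eqP => z0; move/eqP: az; rewrite z0 expr0n gtn_eqF // mulr0 eq_sym oner_eq0.
    by rewrite hornerMn hornerXn !mulf_neq0 // mulrn_eq0 negb_or -lt0n n0 expf_neq0.
  move=> /(over_ne _ _ w0) Fz; rewrite famN // derivB derivC subr0 derivZ deriv_comp.
  rewrite derivZ derivX !hornerE horner_comp !hornerE (mulrC w^-1).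
  rewrite !mulf_neq0 ?expf_neq0 ?invr_eq0 ?oner_eq0 //; apply/eqP => /hcrit.
  rewrite Fz cnormV cnormX ltNge -[leLHS]invrK lef_pV2 ?posrE ?invr_gt0 ?exprn_gt0 ?cnorm_gt0 //.
  by rewrite -rhon lerXn2r ?nnegrE // ltW.
have [eta eta0 sep] := fam_sep n0 An a0 simple.
have lift := fam_lift 0 rho n0 An a0.
have [lab [l1 l2 l3 l4 [[k k0 l5] l6]]] := covering_label (ltW rho0) eta0 sep lift.
have og : (fam n A 0).[g] = 0 by rewrite fam0 !hornerE gn subrr.
have /choice[Y hY] : forall w, exists z, cnorm (w - 0) <= rho -> (fam n A w).[z] = 0 /\ lab w z = g.
  move=> w; have [Dw|nD] := pselect (cnorm (w - 0) <= rho); last by exists 0.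
  by have [z ? ?] := l2 w g Dw og; exists z.
have onC w : cnorm w = rho -> cnorm (w - 0) <= rho by rewrite subr0 => ->.
have nz w : cnorm w = rho -> w != 0 by rewrite -cnorm_gt0 => ->.
have XY w : cnorm w = rho -> cnorm F.[Y w / w] = r.
  move=> wr; have [/(over_ne _ _ (nz _ wr)) -> _] := hY _ (onC _ wr).
  by rewrite cnormV cnormX wr rhon invrK.
(* Multiplying [w] and [y] by an n-th root of unity preserves the equation and the quotient y / w;
   the root [om] moves the sheet through [z * w1] to that of [g]. *)
have surj z : cnorm F.[z] = r -> exists2 w, cnorm w = rho & z = Y w / w.
  move=> Fz; have Fz0 : F.[z] != 0 by rewrite -cnorm_gt0 Fz.
  pose w1 : R[i] := n.-root (F.[z]^-1).
  have w1n : w1 ^+ n = F.[z]^-1 by rewrite rootCK.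
  have w1r : cnorm w1 = rho.
    by apply/eqP; rewrite -(eqrXn2 n0) ?(ltW rho0) // -cnormX w1n cnormV Fz rhon.
  have o1 : (fam n A w1).[z * w1] = 0.
    by apply/(over_ne _ _ (nz _ w1r)); rewrite mulfK ?nz // w1n invrK.
  pose be := lab w1 (z * w1).
  have ben : a * be ^+ n = 1.
    have := l1 _ _ (onC _ w1r) o1; rewrite fam0 !hornerE -/be => /eqP.
    by rewrite subr_eq0 => /eqP.
  have be0 : be != 0.
    by apply/eqP => z0; move/eqP: ben; rewrite z0 expr0n gtn_eqF // mulr0 eq_sym oner_eq0.
  pose om := g / be.
  have omn : om ^+ n = 1.
    rewrite expr_div_n; have -> : g ^+ n = be ^+ n by apply: (mulfI a0); rewrite gn ben.
    by rewrite divff // expf_neq0.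
  have om1 : cnorm om = 1 by apply/eqP; rewrite -(@eqrXn2 _ n) ?ler01 // -cnormX omn cnorm1 expr1n.
  have inv w v : cnorm (w - 0) <= rho -> (fam n A w).[v] = 0 -> (fam n A (om * w)).[om * v] = 0.
    move=> _; rewrite !famE' => E; rewrite -[RHS]E; congr (_ - _).
    apply: eq_bigr => i _; rewrite (exprMn _ om w) (exprMn _ om v).
    have on : om ^+ (n - i) * om ^+ i = 1 by rewrite -exprD subnK ?omn // -ltnS ltn_ord.
    rewrite -[RHS]mulr1 -on; move: (om ^+ (n - i)) (om ^+ i) (w ^+ (n - i)) (v ^+ i).
    by move=> o1' o2' w' v'; ring.
  have omw : cnorm (om * w1) = rho by rewrite cnormM om1 mul1r.
  have := l6 om erefl om1 inv _ _ (onC _ w1r) o1; rewrite -/be /om divfK // -/om => labg.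
  have [oY labY] := hY _ (onC _ omw).
  have o2 := inv _ _ (onC _ w1r) o1.
  exists (om * w1) => //; have -> : Y (om * w1) = om * (z * w1).
    by apply: (l3 _ _ _ (onC _ omw) oY o2); rewrite labY labg.
  by rewrite mulrCA mulfK // nz.
have [B hB] := fam_bounded 0 rho n0 An a0.
have Ycts (s : R) : 0 < s -> exists2 q : R, 0 < q & forall w w', cnorm w = rho -> cnorm w' = rho ->
    cnorm (w' - w) < q -> cnorm (Y w' - Y w) < s.
  move=> s0; have m0 : 0 < Num.min s k by rewrite lt_min s0.
  have [q q0 hq] := lift _ m0; exists (Num.min q k); first by rewrite lt_min q0.
  move=> w w' /onC Dw /onC Dw'; rewrite cdistC lt_min => /andP[wq wk].
  have [oY labY] := hY _ Dw; have [oY' labY'] := hY _ Dw'.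
  have [y' oy'] := hq _ _ _ Dw Dw' wq oY; rewrite lt_min => /andP[ys yk].
  suff -> : Y w' = y' by [].
  apply: (l3 _ _ _ Dw' oY' oy'); rewrite labY' -labY.
  by apply: l5 => //; rewrite cdistC.
(* Y w / w varies by at most |Y w' - Y w| / rho + |Y w| |w - w'| / rho^2; each term is kept below e
   / 2. *)
have s0 : 0 < e * rho / 2 by rewrite !divr_gt0 // mulr_gt0.
have [q q0 hq] := Ycts _ s0.
have B0 : 0 <= `|B| by [].
have BB : 0 < 2 * (`|B| + 1) by rewrite mulr_gt0 // ltr_wpDl.
have m0 : 0 < Num.min q (e * (rho * rho) / (2 * (`|B| + 1))).
  by rewrite lt_min q0 divr_gt0 // !mulr_gt0.
have [w1 w1r ->] := surj _ Fx; have [w2 w2r ->] := surj _ Fy.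
apply: (chain_map (f := fun w => Y w / w) _ _ (circle_chain (ltW rho0) m0 w1r w2r)).
  exact: XY.
move=> w w' wr wr'; rewrite lt_min => /andP[wq].
rewrite ltr_pdivlMr // => we; have := hq _ _ wr wr' wq.
have [w0 w'0] : w != 0 /\ w' != 0 by split; apply: nz.
have -> : Y w' / w' - Y w / w = (Y w' - Y w) / w' + Y w * (w - w') / (w * w').
  by field; rewrite ?w0 ?w'0.
move=> hs; apply: le_lt_trans (cnormD _ _) _.
rewrite !cnormM !cnormV !cnormM wr wr'.
have Yw : cnorm (Y w) <= `|B|.
  by apply: le_trans (ler_norm B); have [oY _] := hY _ (onC _ wr); apply: hB oY; apply: onC.
have h1 : cnorm (Y w' - Y w) / rho < e / 2.
  by rewrite ltr_pdivrMr //; move: hs; lra.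
have h2 : cnorm (Y w) * cnorm (w - w') / (rho * rho) < e / 2.
  rewrite ltr_pdivrMr ?mulr_gt0 // cdistC.
  apply: le_lt_trans (ler_wpM2r (cnorm_ge0 _) Yw) _.
  by have := cnorm_ge0 (w' - w); lra.
lra.
Qed.

End Branches.

(** * Dynamics of a semigroup with a common escape radius *)

Section Dynamics.
Variable R : realType.
Implicit Types (x y w : R[i]) (e : R) (g h p : {poly R[i]}).

Definition iterp p m : {poly R[i]} := iter m (fun q => p \Po q) 'X.

Lemma iterp_horner p m x : (iterp p m).[x] = iter m (horner p) x.
Proof. by elim: m => [|m IH]; rewrite /iterp /= ?hornerX // horner_comp IH. Qed.

Lemma iterpSr p m x : (iterp p m.+1).[x] = (iterp p m).[p.[x]].
Proof. by rewrite !iterp_horner iterSr. Qed.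

Lemma iterpS p m x : (iterp p m.+1).[x] = p.[(iterp p m).[x]].
Proof. by rewrite !iterp_horner. Qed.

Lemma iterp0 p x : (iterp p 0).[x] = x.
Proof. by rewrite iterp_horner. Qed.

Lemma iterpD p m n x : (iterp p (m + n)).[x] = (iterp p m).[(iterp p n).[x]].
Proof. by rewrite !iterp_horner iterD. Qed.

Variables (S : {poly R[i]} -> Prop) (r : R).
Hypotheses (Scomp : comp_closed S) (S1 : forall g, S g -> (1 < size g)%N).
Hypotheses (r0 : 0 < r) (esc : forall g, S g -> forall w, r <= cnorm w -> 2 * cnorm w <= cnorm g.[w]).
Local Notation J x := (Julia S (Some x)).

Lemma S_iterp g m : S g -> S (iterp g m.+1).
Proof.
move=> Sg; elim: m => [|m IH]; first by rewrite /iterp /= comp_polyXr.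
exact: Scomp.
Qed.

Lemma escape_iterp g m w : S g -> r <= cnorm w -> 2 ^+ m * cnorm w <= cnorm (iterp g m).[w].
Proof.
move=> Sg rw; elim: m => [|m IH]; first by rewrite mul1r iterp0.
rewrite iterpS exprS -mulrA; apply: le_trans (esc Sg _); first by rewrite ler_wpM2l.
apply: le_trans rw _; apply: le_trans IH; rewrite ler_peMl //.
by rewrite exprn_ege1 // ler1n.
Qed.

Lemma escape_ge g w : S g -> r <= cnorm w -> r < cnorm g.[w].
Proof. by move=> Sg rw; have := esc Sg rw; move: r0; lra. Qed.

Lemma escape_iterp_ge g m w : S g -> r <= cnorm w -> r <= cnorm (iterp g m).[w].
Proof.
move=> Sg rw; elim: m => [|m IH]; first by rewrite iterp0.
by rewrite iterpS ltW // escape_ge.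
Qed.

Definition Kh x := forall g, S g -> cnorm g.[x] <= r.

Lemma Kh_lt g x : S g -> Kh x -> cnorm x < r.
Proof. by move=> Sg /(_ _ Sg); apply: contraLR; rewrite -leNgt -ltNge => /(escape_ge Sg). Qed.

Lemma Kh_inv g x : S g -> Kh x -> Kh g.[x].
Proof. by move=> Sg Kx h Sh; rewrite -horner_comp; apply: Kx; apply: Scomp. Qed.

Lemma Kh_closed : cclosed Kh.
Proof.
move=> u l Ku ul g Sg; apply: ccvg_norm_le (ccvg_poly g ul) _ => N.
by exists N => //; apply: Ku.
Qed.

Lemma not_KhP x : ~ Kh x -> exists2 g, S g & r < cnorm g.[x].
Proof. by move=> /existsNP[g /not_implyP[Sg /negP]]; rewrite -ltNge; exists g. Qed.

(** Once |g(x)| > r, iterating [g] at least doubles the modulus each time, so the orbit is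
    unbounded. *)
Lemma KhatE x : Khat S (Some x) <-> Kh x.
Proof.
split=> [[_ [<-] [M hM]]|Kx]; last by exists x => //; exists r.
move=> g Sg; rewrite leNgt; apply/negP => rg.
pose m := Num.bound (`|M| / r).
have hm : `|M| / r < m%:R by apply: archi_boundP; rewrite divr_ge0 // ltW.
have := hM _ (Scomp (S_iterp m Sg) Sg); rewrite horner_comp.
have := escape_iterp m.+1 Sg (ltW rg).
have : m%:R <= 2 ^+ m.+1 :> R by rewrite -natrX ler_nat ltnW // (ltn_trans (ltnSn m)) // ltn_expl.
move: hm; rewrite ltr_pdivrMr //; have := ler_norm M.
set P := 2 ^+ m.+1; set N := cnorm (iterp _ _).[_] => h1 h2 h3 h4 h5.
have : P * r < P * cnorm g.[x] by rewrite ltr_pM2l ?exprn_gt0.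
have : m%:R * r <= P * r by rewrite ler_pM2r.
lra.
Qed.

Lemma equicts_dist x (M e : R) : equicts S (Some x) -> 0 < e ->
  exists2 d : R, 0 < d & forall g, S g -> cnorm g.[x] <= M ->
    forall w, cnorm (w - x) < d -> cnorm (g.[x] - g.[w]) < e.
Proof.
move=> eqx e0; have [d1 d10 h1] := cdist_of_sdist M e0.
have [d2 d20 h2] := eqx _ d10; exists (d2 / 2); first by rewrite divr_gt0.
move=> g Sg gM w wd; apply: h1 => //; apply: (h2 _ Sg (Some w)).
by apply: le_lt_trans (sdist_le_cdist _ _) _; rewrite cdistC; lra.
Qed.

(** Applying [g] twice opens a gap: |g(w)| > r gives |g(g(w))| > 2 r, whereas |g(g(x))| <= r, and
    equicontinuity keeps these two values closer than [r]. *)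
Lemma equicts_interior x : equicts S (Some x) -> Kh x ->
  exists2 d : R, 0 < d & forall w, cnorm (w - x) < d -> Kh w.
Proof.
move=> eqx Kx; have [d d0 hd] := equicts_dist r eqx r0; exists d => // w wd.
apply: contrapT => /not_KhP[g Sg rg].
have Sgg := Scomp Sg Sg; have := hd _ Sgg (Kx _ Sgg) _ wd; have := Kx _ Sgg.
rewrite !horner_comp; have := esc Sg (ltW rg).
by have := cnorm_le_dist g.[g.[w]] g.[g.[x]]; rewrite cdistC; lra.
Qed.

Definition bdKh x := Kh x /\ forall d : R, 0 < d -> exists2 w, cnorm (w - x) < d & ~ Kh w.

Lemma bdKh_Julia x : bdKh x -> J x.
Proof.
move=> [Kx hx] /(Fatou_equicts S1)/equicts_interior/(_ Kx)[d /hx[w wd nK] hd].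
by apply: nK; apply: hd.
Qed.

Lemma not_bdKh x : Kh x -> ~ bdKh x -> exists2 d : R, 0 < d & forall w, cnorm (w - x) < d -> Kh w.
Proof.
move=> Kx nb; apply: contrapT => h; apply: nb; split=> // d d0.
apply: contrapT => h'; apply: h; exists d => // w wd.
by apply: contrapT => nK; apply: h'; exists w.
Qed.

Lemma interior_Fatou x (d : R) : 0 < d -> (forall w, cnorm (w - x) < d -> Kh w) -> Fatou S (Some x).
Proof. by move=> d0 hd; apply: (@bounded_Fatou _ _ _ d r) => // g Sg w /hd; apply. Qed.

Definition outside (z : sphere R) := if z is Some w then is_true (r < cnorm w) else True.

(** Near a finite point all elements omit the disc of radius [r]; near infinity each of them brings
    points closer to infinity. *)
Lemma outside_Fatou z : outside z -> Fatou S z.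
Proof.
have oo : sopen outside.
  move=> [x|] /= hx.
    have e0 : 0 < cnorm x - r by rewrite subr_gt0.
    have [d d0 hd] := sphere_near x e0; exists d => // v /hd[y -> yx] /=.
    by have := cnorm_le_dist x y; rewrite cdistC; lra.
  have [d d0 hd] := sdist_inf_gt r; exists d => // -[y|] //.
  by move=> /hd.
move=> hz; exists outside; split=> //; apply: arzela_ascoli => // -[x|] /= hx.
  have e0 : 0 < (cnorm x - r) / 2 by rewrite divr_gt0 // subr_gt0.
  apply: (omit_equicts e0 r0) => g Sg w wx; apply: ltW; apply: (escape_ge Sg).
  by have := cnorm_le_dist x w; rewrite cdistC; lra.
move=> e e0; have [d d0 hd] := sdist_inf_gt r; exists (Num.min d e); first by rewrite lt_min d0.
move=> g Sg [w|]; rewrite lt_min (pmap_inf (S1 Sg)) ?sdistzz // !(sdistC None).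
move=> /andP[/hd/ltW rw we]; apply: le_lt_trans we; apply: sdist_inf_mono.
by apply: le_trans (esc Sg rw); rewrite ler_peMl // ler1n.
Qed.

Lemma Julia_bounded x : J x -> cnorm x <= r.
Proof. by move=> Jx; rewrite leNgt; apply/negP => rx; apply: Jx; apply: outside_Fatou. Qed.

Lemma Julia_finite : ~ Julia S None.
Proof. by apply; apply: outside_Fatou. Qed.

(** Level points far from J(S) for arbitrarily large [k] would accumulate at some [x]. No g^k(h(x))
    exceeds [r], since later iterates at nearby level points would then exceed it too. If [x] were
    in the Fatou set, one further [g], doubling the modulus [r] on the level set, would contradict
    equicontinuity. The option [h = 'X] serves the curve before any pullback. *)
Lemma level_near_Julia g h e : S g -> (h = 'X \/ S h) -> 0 < e ->
  exists k0, forall k, (k0 <= k)%N -> forall x, cnorm (iterp g k \Po h).[x] = r ->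
    exists2 y, J y & cnorm (y - x) < e.
Proof.
move=> Sg hh e0; apply: contrapT => /forallNP bad.
have Sf k : S (iterp g k.+1 \Po h).
  by case: hh => [->|Sh]; [rewrite comp_polyXr; apply: S_iterp | apply: Scomp (S_iterp _ Sg) Sh].
have /choice[t ht] : forall n : nat, exists t : nat * R[i], [/\ (n.+1 <= t.1)%N,
    cnorm (iterp g t.1 \Po h).[t.2] = r & forall y, J y -> e <= cnorm (y - t.2)].
  move=> n; have /existsNP[k /not_implyP[nk /existsNP[x /not_implyP[hx nex]]]] := bad n.+1.
  exists (k, x); split=> // y Jy; rewrite leNgt; apply/negP => lt; apply: nex; by exists y.
have [|phi hphi [x hx]] := @bolzano _ (fun n => (t n).2) r.
  move=> n; have [nt hr _] := ht n; rewrite leNgt; apply/negP => lt.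
  case: (t n).1 nt hr => // k _ hr; have := escape_ge (Sf k) (ltW lt).
  by rewrite hr ltxx.
have Kx k : cnorm (iterp g k \Po h).[x] <= r.
  apply: ccvg_norm_le (ccvg_poly _ hx) _ => N; exists (maxn N k); first exact: leq_maxl.
  pose n := phi (maxn N k); have kn : (k <= n)%N by apply: leq_trans (leq_maxr _ _) (extraction_ge hphi _).
  have [nt hr _] := ht n; rewrite /= -/n; rewrite leNgt; apply/negP => lt.
  move: hr; rewrite !horner_comp.
  have kt : (k < (t n).1)%N by apply: leq_ltn_trans kn nt.
  rewrite -(subnK (ltnW kt)) iterpD => hr.
  have : (0 < (t n).1 - k)%N by rewrite subn_gt0.
  case E : ((t n).1 - k)%N hr => [//|i] hr _.
  have := escape_ge (S_iterp i Sg) (ltW lt).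
  by move: hr; rewrite !horner_comp => ->; rewrite ltxx.
have [Fx|Jx] := pselect (Fatou S (Some x)); last first.
  have [N hN] := hx _ e0; have [_ _ /(_ _ Jx)] := ht (phi N).
  by rewrite leNgt cdistC hN.
have [d d0 hd] := equicts_dist r (Fatou_equicts S1 Fx) r0.
have [N hN] := hx _ d0; have [nt hr _] := ht (phi N).
set x' := (t (phi N)).2 in hr; set k := (t (phi N)).1 in hr.
have := hd _ (Sf k) (Kx _) x' (hN _ (leqnn _)); have := Kx k.+1.
have : 2 * r <= cnorm (iterp g k.+1 \Po h).[x'].
  by move: hr; rewrite !horner_comp => hr; rewrite -{1}hr; apply: esc => //; rewrite hr.
set f := iterp _ _ \Po _; have := cnorm_le_dist f.[x'] f.[x]; rewrite cdistC; lra.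
Qed.

(** The two parts of a separation would be at positive distance [d]. Finer and finer chains leaving
    the d / 2 neighbourhood of [B1] have exit points accumulating at a reachable point [l], outside
    that neighbourhood but within d / 2 of a limit [m] in [B1]: it fits neither part. *)
Lemma chain_component_connected (z1 : R[i]) : J z1 ->
  sconnected (fun z : sphere R => exists2 x, z = Some x & forall e : R, 0 < e -> chain (fun w => J w) e z1 x).
Proof.
move=> Jz1; set K := fun z => _.
pose k x := forall e : R, 0 < e -> chain (fun w => J w) e z1 x.
have kK x : K (Some x) <-> k x by split=> [[_ [<-]]|kx] //; exists x.
have kz1 : k z1 by move=> e _; apply: chain0.
have kb x : k x -> cnorm x <= r.
  by move=> h; apply: Julia_bounded; case: (chain_in (h 1 ltr01)).
have klim (u : nat -> R[i]) l : (forall n : nat, exists2 N, (n <= N)%N & chain (fun w => J w) N.+1%:R^-1 z1 (u n)) ->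
    ccvg u l -> k l.
  move=> hu ul e e0; have Jl : J l.
    by apply: Julia_closed ul => n; have [N _ h] := hu n; case: (chain_in h).
  have [N hN] := ul _ e0; have [N' hN'] := invn_lt e0; pose n := maxn N N'.
  have [M nM hM] := hu n.
  apply: (@chain_trans _ _ _ (u n)); last first.
    apply: chain_step => //; first by case: (chain_in hM).
    by rewrite cdistC; apply: hN; rewrite leq_maxl.
  apply: chain_mono hM => //; apply/ltW/hN'; exact: leq_trans (leq_maxr _ _) nM.
have klim' (u : nat -> R[i]) l : (forall n, k (u n)) -> ccvg u l -> k l.
  by move=> hu; apply: klim => n; exists n => //; apply: hu; rewrite invr_gt0 ltr0n.
suff H (B1 B2 : sphere R -> Prop) : rel_open K B1 -> rel_open K B2 -> B1 (Some z1) ->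
    (exists z, B2 z) -> (forall z, K z -> B1 z \/ B2 z) -> (forall z, ~ (B1 z /\ B2 z)) -> False.
  move=> [B1 [B2 [o1 o2 n1 n2 [cov dis]]]].
  have [b1|b2] := cov _ (iffRL (kK z1) kz1); first exact: (H B1 B2).
  apply: (H B2 B1) => // z; first by move=> /cov[]; [right|left].
  by move=> [? ?]; apply: (dis z).
move=> [s1 o1] [s2 o2] B1z1 [p2 B2p2] cov dis.
have near (B : sphere R -> Prop) (u : nat -> R[i]) l : (forall z, B z -> exists2 d : R, 0 < d & forall w : sphere R, K w -> sdist z w < d -> B w) ->
    B (Some l) -> (forall n, k (u n)) -> ccvg u l -> exists N, forall n, (N <= n)%N -> B (Some (u n)).
  move=> oB /oB[d d0 hd] ku /ccvg_scvg/(_ _ d0)[N hN]; exists N => n Nn.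
  by apply: hd; [apply/kK | rewrite sdistC; apply: hN].
have [d d0 sepd] : exists2 d : R, 0 < d & forall y w, B1 (Some y) -> B2 (Some w) -> d <= cnorm (w - y).
  apply: contrapT => h.
  have /choice[t ht] : forall n : nat, exists t : R[i] * R[i],
      [/\ B1 (Some t.1), B2 (Some t.2) & cnorm (t.1 - t.2) < n.+1%:R^-1].
    move=> n; apply: contrapT => h'; apply: h; exists n.+1%:R^-1; first by rewrite invr_gt0 ltr0n.
    move=> y w By Bw; rewrite leNgt; apply/negP => lt; apply: h'; exists (y, w).
    by split=> //; rewrite cdistC.
  have k1 n : k (t n).1 by case: (ht n) => /s1/kK.
  have k2 n : k (t n).2 by case: (ht n) => _ /s2/kK.
  have [phi hphi [l hl]] := bolzano (fun n => kb _ (k1 n)).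
  have hl2 : ccvg (fun n => (t (phi n)).2) l.
    apply: ccvg_close hl _ => n; have [_ _ lt] := ht (phi n).
    by apply: lt_le_trans lt _; apply: inv_extraction.
  have kl : k l by apply: klim' hl => n; apply: k1.
  have [Bl|Bl] := cov _ (iffRL (kK l) kl).
    have [N /(_ _ (leqnn _)) b1] := near _ _ _ o1 Bl (fun n => k2 (phi n)) hl2.
    by have [_ b2 _] := ht (phi N); apply: (dis _ (conj b1 b2)).
  have [N /(_ _ (leqnn _)) b2] := near _ _ _ o2 Bl (fun n => k1 (phi n)) hl.
  by have [b1 _ _] := ht (phi N); apply: (dis _ (conj b1 b2)).
have d20 : 0 < d / 2 by rewrite divr_gt0.
pose P x := exists2 y, B1 (Some y) & cnorm (x - y) < d / 2.
have Pz1 : P z1 by exists z1 => //; rewrite subrr cnorm0.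
have [x2 xp2 kx2] := s2 _ B2p2.
have nPx2 : ~ P x2.
  move=> [y By]; have : d <= cnorm (x2 - y) by apply: sepd By _; rewrite -xp2.
  by move: d0; lra.
have /choice[t ht] : forall n : nat, exists t : R[i] * R[i],
    [/\ chain (fun w => J w) n.+1%:R^-1 z1 t.1, B1 (Some t.2), ~ P t.1 & cnorm (t.1 - t.2) < d / 2 + n.+1%:R^-1].
  move=> n; have n0 : 0 < n.+1%:R^-1 :> R by rewrite invr_gt0 ltr0n.
  have [a [b [ca [y By ay] nPb Jb ab]]] := chain_exit (kx2 _ n0) Pz1 nPx2.
  exists (b, y); split=> //=; first exact: chainS ca Jb ab.
  by apply: le_lt_trans (cdist_triangle a _ _) _; rewrite addrC ltrD.
have tb n : cnorm (t n).1 <= r by have [h _ _ _] := ht n; apply: Julia_bounded; case: (chain_in h).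
have k2 n : k (t n).2 by case: (ht n) => _ /s1/kK.
have [phi hphi [l [m [hl hm]]]] := bolzano2 tb (fun n => kb _ (k2 n)).
have kl : k l.
  apply: klim hl => n; exists (phi n); first exact: extraction_ge.
  by case: (ht (phi n)).
have km : k m by apply: klim' hm => n; apply: k2.
have [Bl|Bl] := cov _ (iffRL (kK l) kl).
  have [N /(_ _ (leqnn _)) lt] := hl _ d20; have [_ _ + _] := ht (phi N).
  by apply; exists l.
have [Bm|Bm] := cov _ (iffRL (kK m) km); last first.
  have [N /(_ _ (leqnn _)) b2] := near _ _ _ o2 Bm (fun n => k2 (phi n)) hm.
  by have [_ b1 _ _] := ht (phi N); apply: (dis _ (conj b1 b2)).
have := sepd _ _ Bm Bl.
have d8 : 0 < d / 8 by rewrite divr_gt0.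
have [N1 h1] := hl _ d8; have [N2 h2] := hm _ d8; have [N3 h3] := invn_lt d8.
pose n := maxn N1 (maxn N2 N3).
have lt1 := h1 n (leq_maxl _ _).
have lt2 : cnorm ((t (phi n)).2 - m) < d / 8 by apply: h2; rewrite /n leq_max leq_maxl orbT.
have lt3 : (phi n).+1%:R^-1 < d / 8.
  by apply: h3; apply: leq_trans (extraction_ge hphi n); rewrite /n !leq_max leqnn !orbT.
have [_ _ _ lt4] := ht (phi n); have lt5 := lt_trans lt4 (ler_ltD (lexx _) lt3).
have := cdist_triangle (t (phi n)).1 l m; have := cdist_triangle (t (phi n)).2 (t (phi n)).1 m.
move: lt1 lt2 lt5 d0; rewrite (cdistC l (t (phi n)).1) /=; lra.
Qed.

(** The endpoint in [B] may vary with [e]; a limit of endpoints serves every step. *)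
Lemma chain_component (z1 : R[i]) (B : R[i] -> Prop) : J z1 -> cclosed B -> (forall b, B b -> J b) ->
  (forall e : R, 0 < e -> exists2 b, B b & chain (fun w => J w) e z1 b) ->
  exists2 b, B b & component (Julia S) (Some z1) (Some b).
Proof.
move=> Jz1 Bc BJ h.
have /choice[t ht] : forall n : nat, exists b, B b /\ chain (fun w => J w) n.+1%:R^-1 z1 b.
  move=> n; have n0 : 0 < n.+1%:R^-1 :> R by rewrite invr_gt0 ltr0n.
  by have [b ? ?] := h _ n0; exists b.
have [phi hphi [b hb]] := bolzano (fun n => Julia_bounded (BJ _ (ht n).1)).
have Bb : B b by apply: Bc hb => n; case: (ht (phi n)).
exists b => //; exists (fun z : sphere R => exists2 x, z = Some x & forall e : R, 0 < e -> chain (fun w => J w) e z1 x).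
split.
- by move=> _ [x -> hx]; case: (chain_in (hx 1 ltr01)).
- by apply: chain_component_connected.
- by exists z1 => // e _; apply: chain0.
exists b => // e e0; have [N hN] := hb _ e0; have [N' hN'] := invn_lt e0; pose n := maxn N N'.
have cn := (ht (phi n)).2.
apply: (@chain_trans _ _ _ (t (phi n))); last first.
  apply: chain_step; [by case: (chain_in cn) | exact: BJ |].
  by rewrite cdistC; apply: hN; rewrite leq_maxl.
apply: chain_mono cn => //; apply/ltW/hN'.
by apply: leq_trans (extraction_ge hphi n); rewrite leq_maxr.
Qed.

End Dynamics.

(** * The generators in Gamma map the filled set into its interior *)

Section Crossing.
Variable R : realType.
Implicit Types (x y w a b : R[i]) (e : R) (f p : {poly R[i]}).

Lemma segp_ball x y a (t e : R) : 0 <= t <= 1 -> cnorm (x - a) < e -> cnorm (y - a) < e ->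
  cnorm (segp x y t - a) < e.
Proof.
move=> /andP[t0 t1] xa ya.
have -> : segp x y t - a = (1 - t)%:C * (x - a) + t%:C * (y - a).
  by rewrite /segp rmorphB rmorph1; ring.
apply: le_lt_trans (cnormD _ _) _; rewrite !cnormM !cnorm_real !ger0_norm ?subr_ge0 //.
move: (cnorm (x - a)) (cnorm (y - a)) xa ya => X Y Xe Ye.
have [XY|YX] := lerP X Y.
  have : 0 <= (1 - t) * (Y - X) by rewrite mulr_ge0 // subr_ge0.
  lra.
have : 0 <= t * (X - Y) by rewrite mulr_ge0 // subr_ge0 ltW.
lra.
Qed.

(** The third clause retains that [b] is on the segment, through convexity of discs: whatever [x]
    and [y] are close to, [b] is as close to. *)
Lemma segment_boundary (P : R[i] -> Prop) x y : cclosed P -> P x -> ~ P y -> exists b,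
  [/\ P b, forall d : R, 0 < d -> exists2 w, cnorm (w - b) < d & ~ P w &
    forall a e, cnorm (x - a) < e -> cnorm (y - a) < e -> cnorm (b - a) < e].
Proof.
move=> Pc Px nPy; have [t t01 ht] := segment_cross Px nPy; exists (segp x y t); split.
- have /choice[u hu] : forall n : nat, exists w, P w /\ cnorm (w - segp x y t) < n.+1%:R^-1.
    by move=> n; have [|[w ? ?] _] := ht n.+1%:R^-1; [rewrite invr_gt0 ltr0n | exists w].
  apply: (Pc u); first by move=> n; case: (hu n).
  apply: ccvg_close (ccvg_cst _) _ => n; rewrite cdistC; by case: (hu n).
- by move=> d /ht[_ [w ? ?]]; exists w.
- by move=> a e; apply: segp_ball.
Qed.

Lemma sublevel_closed f (r : R) : cclosed (fun w => cnorm f.[w] <= r).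
Proof.
by move=> u l hu ul; apply: ccvg_norm_le (ccvg_poly f ul) _ => N; exists N.
Qed.

Lemma level_cross f (r : R) x y : cnorm f.[x] <= r -> r <= cnorm f.[y] -> exists2 b,
  cnorm f.[b] = r & forall a e, cnorm (x - a) < e -> cnorm (y - a) < e -> cnorm (b - a) < e.
Proof.
move=> fx; rewrite le_eqVlt => /orP[/eqP fy|fy]; first by exists y.
have nfy : ~ cnorm f.[y] <= r by apply/negP; rewrite -ltNge.
have [b [Pb nPb ball]] := segment_boundary (@sublevel_closed f r) fx nfy.
exists b => //; apply/eqP; rewrite eq_le Pb leNgt; apply/negP => lt.
have [|d d0 hd] := cts_poly f b (e := r - cnorm f.[b]); first by rewrite subr_gt0.
have [w /hd wd /negP] := nPb _ d0; rewrite -ltNge.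
by have := cnorm_le_dist f.[w] f.[b]; lra.
Qed.

Lemma sublevel_max f p (r M : R) : (1 < size f)%N -> 0 <= M ->
  (forall x, cnorm f.[x] = r -> cnorm p.[x] <= M) ->
  forall x, cnorm f.[x] <= r -> cnorm p.[x] <= M.
Proof.
move=> sf M0 hp x fx; have E (w : R[i]) : M = M * cnorm (1%:P : {poly R[i]}).[w].
  by rewrite hornerC cnorm1 mulr1.
rewrite (E x); apply: (max_principle (@sublevel_closed f r) _ M0 _ _ fx).
- have [K hK] := poly_infty (r + 1) sf; exists K => w fw.
  by rewrite leNgt; apply/negP => /ltW/hK; lra.
- by move=> w _; rewrite hornerC oner_eq0.
- move=> w; rewrite -E le_eqVlt => /orP[/eqP/hp|lt]; [by left|right].
  have [|d d0 hd] := cts_poly f w (e := r - cnorm f.[w]); first by rewrite subr_gt0.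
  exists d => // v /hd; have := cnorm_le_dist f.[v] f.[w]; lra.
Qed.

Lemma bounded_min (P : nat -> R -> Prop) (m : nat) :
  (forall j s t, t <= s -> P j s -> P j t) -> (forall j, exists2 s : R, 0 < s & P j s) ->
  exists2 s : R, 0 < s & forall j, (j <= m)%N -> P j s.
Proof.
move=> mono hP; elim: m => [|m [s s0 hs]].
  by have [s s0 hs] := hP 0%N; exists s => // j; rewrite leqn0 => /eqP ->.
have [t t0 ht] := hP m.+1; exists (Num.min s t); first by rewrite lt_min s0.
move=> j; rewrite leq_eqVlt => /orP[/eqP ->|].
  by apply: mono ht; rewrite ge_min lexx orbT.
by rewrite ltnS => /hs; apply: mono; rewrite ge_min lexx.
Qed.

Lemma bounded_max (P : nat -> nat -> Prop) (m : nat) :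
  (forall j, exists k0, forall k, (k0 <= k)%N -> P j k) ->
  exists k, forall j, (j <= m)%N -> P j k.+1.
Proof.
move=> hP; suff [k0 hk] : exists k0, forall k, (k0 <= k)%N -> forall j, (j <= m)%N -> P j k.
  by exists k0 => j; apply: hk.
elim: m => [|m [k0 hk0]].
  by have [k0 hk] := hP 0%N; exists k0 => k /hk ? j; rewrite leqn0 => /eqP ->.
have [k1 hk1] := hP m.+1; exists (maxn k0 k1) => k; rewrite geq_max => /andP[a0 a1] j.
by rewrite leq_eqVlt => /orP[/eqP ->|]; [exact: hk1 | rewrite ltnS; exact: hk0].
Qed.

End Crossing.

(** * One element [gam] of the semigroup, its filled set and its Julia set *)

Section Cyclic.
Variable R : realType.
Implicit Types (x y w a b p : R[i]) (e : R) (f g : {poly R[i]}).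
Variables (S : {poly R[i]} -> Prop) (r : R) (gam : {poly R[i]}).
Hypotheses (Scomp : comp_closed S) (S1 : forall g, S g -> (1 < size g)%N).
Hypotheses (r0 : 0 < r) (esc : forall g, S g -> forall w, r <= cnorm w -> 2 * cnorm w <= cnorm g.[w]).
Hypothesis Sgam : S gam.
Local Notation C := (generated (fun q => q = gam)).
Local Notation J x := (Julia S (Some x)).
Local Notation K := (Kh S r).
Local Notation Kg := (Kh C r).

Lemma generated_comp (A : {poly R[i]} -> Prop) : comp_closed (generated A).
Proof. by move=> g h Ag Ah T AT Tc; apply: (Tc); [apply: Ag | apply: Ah]. Qed.

Lemma generated_in (A : {poly R[i]} -> Prop) g : A g -> generated A g.
Proof. by move=> Ag T AT _; apply: AT. Qed.

Lemma cyclic_sub g : C g -> S g.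
Proof. by move=> /(_ S); apply=> // q ->. Qed.

Lemma cyclic_iterp g : C g -> exists m, forall x, g.[x] = (iterp gam m.+1).[x].
Proof.
move=> /(_ (fun q => exists m, forall x, q.[x] = (iterp gam m.+1).[x])); apply.
  by move=> q ->; exists 0%N => x; rewrite iterpS iterp0.
move=> p q [m hm] [n hn]; exists (m + n.+1)%N => x.
by rewrite horner_comp hm hn -iterpD addSn.
Qed.

Lemma iterp_cyclic m : C (iterp gam m.+1).
Proof. exact: (@S_iterp R C (@generated_comp _) gam m (@generated_in (fun q => q = gam) gam erefl)). Qed.

Lemma Kg_sub x : K x -> Kg x.
Proof. by move=> Kx g /cyclic_sub; apply: Kx. Qed.

Lemma Kg_iterp x m : Kg x -> cnorm (iterp gam m).[x] <= r.
Proof.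
move=> Kx; case: m => [|m]; last exact: (Kx _ (iterp_cyclic m)).
have escC g : C g -> forall w, r <= cnorm w -> 2 * cnorm w <= cnorm g.[w].
  by move=> /cyclic_sub/esc.
by rewrite iterp0; exact: (ltW (Kh_lt r0 escC (iterp_cyclic 0) Kx)).
Qed.

(** An iterate of [x] beyond [r] stays beyond [r] under [m] further applications of [gam]. *)
Lemma Kg_back m x : Kg (iterp gam m).[x] -> Kg x.
Proof.
move=> Kx g /cyclic_iterp[n hn]; rewrite leNgt; apply/negP; rewrite hn => lt.
have := Kg_iterp n.+1 Kx; rewrite -iterpD addnC iterpD leNgt.
case: m {Kx} => [|m]; first by rewrite iterp0 lt.
by rewrite (escape_ge r0 esc (S_iterp Scomp m Sgam) (ltW lt)).
Qed.

Lemma bdKg_Julia b : bdKh C r b -> Julia1 gam (Some b).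
Proof.
apply: bdKh_Julia => //; first exact: generated_comp.
- by move=> g /cyclic_sub/S1.
- by move=> g /cyclic_sub/esc.
Qed.

Lemma Julia1_sub (b : sphere R) : Julia1 gam b -> Julia S b.
Proof. by move=> Jb Fb; apply: Jb; apply: Fatou_sub Fb; apply: cyclic_sub. Qed.

Lemma Kg_boundary x y : Kg x -> ~ Kg y -> exists2 b, bdKh C r b &
  forall a e, cnorm (x - a) < e -> cnorm (y - a) < e -> cnorm (b - a) < e.
Proof.
move=> Kx nKy; have [b [Kb nKb ball]] := segment_boundary (@Kh_closed _ C r) Kx nKy.
by exists b.
Qed.

(** Otherwise [schwarz_inv] applies to q = gam^m - c near [a] and gives |q(w)| <= 2 |q(a)| <= 4 r
    for [w] close to [a], with a closeness independent of [m]; but points outside [Kg] come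
    arbitrarily near [a]. *)
Lemma montel_hit a c (e k : R) : bdKh C r a -> 0 < e -> 0 < k -> cnorm c <= r ->
  exists m w, cnorm (w - a) < e /\ cnorm ((iterp gam m).[w] - c) < k.
Proof.
move=> [Ka nKa] e0 k0 cr; apply: contrapT => h.
have e20 : 0 < e / 2 by rewrite divr_gt0.
have hm m w : cnorm (w - a) <= e / 2 -> k <= cnorm (iterp gam m - c%:P).[w].
  move=> wa; rewrite !hornerE leNgt; apply/negP => lt; apply: h; exists m, w.
  by split=> //; apply: le_lt_trans wa _; move: e0; lra.
have [M M0 hM] : exists2 M : R, 0 < M & (1 + 2 * r / k) / (e / 2) <= M.
  exists ((1 + 2 * r / k) / (e / 2)) => //.
  by rewrite divr_gt0 // ltr_wpDr // divr_ge0 ?mulr_ge0 // ltW.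
have m0 : 0 < Num.min (e / 2) (1 / (2 * M)).
  by rewrite lt_min e20 divr_gt0 // mulr_gt0.
have [w + nKw] := nKa _ m0; rewrite lt_min => /andP[/ltW we wM].
have [g /cyclic_iterp[n hn]] := not_KhP nKw; rewrite hn => lt.
(* Three further iterates multiply the modulus by at least 8, leaving |q(w)| > 7 r after [c] is
   subtracted. *)
have := schwarz_inv e20 k0 (hm (3 + n.+1)%N) we.
set q := (iterp gam _ - _); have qa : cnorm q.[a] <= 2 * r.
  rewrite /q !hornerE; apply: le_trans (cnormB _ _) _; have := Kg_iterp (3 + n.+1) Ka; lra.
have qw : 7 * r < cnorm q.[w].
  rewrite /q !hornerE iterpD; have := escape_iterp esc 3 Sgam (ltW lt).
  have := cnorm_le_dist (iterp gam 3).[(iterp gam n.+1).[w]] c.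
  have -> : 2 ^+ 3 = 8 :> R by rewrite !exprS expr0; lra.
  lra.
have h1 : (1 + cnorm q.[a] / k) / (e / 2) <= M.
  by apply: le_trans hM; rewrite ler_pM2r ?invr_gt0 // lerD2l ler_pM2r ?invr_gt0.
have h2 : M * cnorm (w - a) < 1 / 2.
  move: wM; rewrite ltr_pdivlMr; [lra | by rewrite mulr_gt0].
have h3 : (1 + cnorm q.[a] / k) / (e / 2) * cnorm (w - a) <= 1 / 2.
  by apply: le_trans (ltW h2); rewrite ler_wpM2r.
move=> hs; have := le_trans hs (ler_wpM2r (cnorm_ge0 q.[w]) h3).
by have := cnorm_le_dist q.[w] q.[a]; move: qa qw r0; clear; lra.
Qed.

Hypothesis crit : forall g, S g -> forall c, (g^`()).[c] = 0 -> K g.[c].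

Lemma S_level_chain f x y e : S f -> 0 < e -> cnorm f.[x] = r -> cnorm f.[y] = r ->
  chain (fun w => cnorm f.[w] = r) e x y.
Proof.
move=> Sf e0; apply: level_chain => //; first exact: S1.
by move=> c /(crit Sf); apply: (Kh_lt r0 esc Sf).
Qed.

(* Pull back by [gam^j] the level curve [|f| = r] of some [f] in [S]: it is
   chain-connected, close to [J(S)], passes near [gam z], and consecutive
   pullbacks are close to each other, unless [{|f| <= r}] is backward invariant. *)
Lemma boundary_chain z c (k e : R) : bdKh S r z -> bdKh S r gam.[z] ->
  0 < k -> (forall w, cnorm (w - c) < k -> K w) -> 0 < e ->
  exists2 b, Julia1 gam (Some b) & chain (fun w => J w) (3 * e) gam.[z] b.
Proof.
move=> [Kz nKz] bz1 k0 hk e0; have [Kz1 nKz1] := bz1.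
have Jz1 : J gam.[z] := bdKh_Julia Scomp S1 r0 esc bz1.
have Kc : K c by apply: hk; rewrite subrr cnorm0.
have [a ba _] : exists2 a, bdKh C r a & True.
  have nK : ~ Kg (r + 1)%:C.
    move=> /(Kg_iterp 0); rewrite iterp0 cnorm_real ger0_norm; move: r0; lra.
  by have [a ba _] := Kg_boundary (Kg_sub Kz) nK; exists a.
have [Ka nKa] := ba.
(* Close to [a] lie [w0], sent by gam^m0 into the disc inside K, and [w'], outside [Kg]; a level
   curve separating them passes near [a], a point of J(gam). *)
have [m0 [w0 [w0a w0c]]] := montel_hit ba e0 k0 (ltW (Kh_lt r0 esc Sgam Kc)).
have {w0c}Kw0 := hk _ w0c; have [w' w'a nKw'] := nKa _ e0.
have sz j : (1 < size (iterp gam j))%N.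
  by case: j => [|j]; [rewrite size_polyX | apply: S1; apply: S_iterp].
(* One threshold for all pullbacks up to [m0]; it depends on [gam] alone and is fixed before [f] is
   chosen. *)
have [s1 s10 hs1] : exists2 s : R, 0 < s & forall j, (j <= m0)%N -> forall x t,
    cnorm ((iterp gam j).[x] - t) < s -> exists2 y, (iterp gam j).[y] = t & cnorm (y - x) < e.
  apply: (@bounded_min R (fun j s => forall x t, cnorm ((iterp gam j).[x] - t) < s ->
    exists2 y, (iterp gam j).[y] = t & cnorm (y - x) < e)).
    by move=> j s t ts hs x u /lt_le_trans/(_ ts); apply: hs.
  by move=> j; apply: root_close e0 (sz j).
pose s := Num.min s1 e; have s0 : 0 < s by rewrite lt_min s10.
have [t1 t10 ht1] := root_close s0 (S1 Sgam).
pose t := Num.min t1 e; have t0 : 0 < t by rewrite lt_min t10.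
have te : t <= e by rewrite ge_min lexx orbT.
have [a' a'z /not_KhP[g Sg ra']] := nKz1 _ t0.
have [k' hk'] : exists k, forall j, (j <= m0.+1)%N -> forall x,
    cnorm (iterp g k.+1 \Po iterp gam j).[x] = r -> exists2 y, J y & cnorm (y - x) < e.
  apply: (@bounded_max (fun j k => forall x, cnorm (iterp g k \Po iterp gam j).[x] = r ->
    exists2 y, J y & cnorm (y - x) < e)) => j.
  apply: level_near_Julia => //; case: j => [|j]; [by left | right].
  exact: S_iterp.
pose f := iterp g k'.+1; have Sf : S f by apply: S_iterp.
pose L j x := cnorm (f \Po iterp gam j).[x] = r.
have L0E x : L 0%N x <-> cnorm f.[x] = r by rewrite /L comp_polyXr.
have LE j x : L j x <-> cnorm f.[(iterp gam j).[x]] = r by rewrite /L horner_comp.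
have SL j : S (f \Po iterp gam j).
  by case: j => [|j]; [rewrite comp_polyXr | apply: Scomp Sf _; apply: S_iterp].
have [p1 fp1 p1ball] : exists2 b, cnorm f.[b] = r &
    forall a e, cnorm (gam.[z] - a) < e -> cnorm (a' - a) < e -> cnorm (b - a) < e.
  apply: level_cross; first exact: Kz1.
  rewrite /f iterpSr; exact: (escape_iterp_ge r0 esc k' Sg (ltW ra')).
have p1z : cnorm (p1 - gam.[z]) < t by apply: p1ball; rewrite ?subrr ?cnorm0.
have [y1 gy1 y1z] : exists2 y, gam.[y] = p1 & cnorm (y - z) < s.
  by apply: ht1; rewrite cdistC; apply: lt_le_trans p1z _; rewrite ge_min lexx.
(* A step below [e] between level points costs a step below [3 * e] between the points of [J] that
   accompany them. *)
pose Q x := exists2 x', chain (fun w => J w) (3 * e) gam.[z] x' & cnorm (x' - x) < e.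
have Qp1 : Q p1.
  by exists gam.[z]; [exact: chain0 | rewrite cdistC; apply: lt_le_trans p1z te].
have Qend x b : Q x -> J b -> cnorm (b - x) < e -> chain (fun w => J w) (3 * e) gam.[z] b.
  move=> [x' cx' x'x] Jb bx; apply: chainS cx' Jb _.
  by have := cdist_triangle x b x'; rewrite (cdistC x x'); move: e0; lra.
have Qnear j x y : (j <= m0.+1)%N -> Q x -> L j y -> cnorm (y - x) < e -> Q y.
  move=> jm [x' cx' x'x] Ly yx; have [y' Jy' y'y] := hk' j jm y Ly.
  exists y' => //; apply: chainS cx' Jy' _.
  have := cdist_triangle y y' x'; have := cdist_triangle x y x'.
  by rewrite (cdistC x x'); lra.
have Qlev j x y : (j <= m0.+1)%N -> Q x -> L j x -> L j y -> Q y.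
  move=> jm Qx Lx Ly; elim: (S_level_chain (SL j) e0 Lx Ly) => // v w _ Qv Lw.
  exact: (Qnear j v w).
have finish b x : bdKh C r b -> Q x -> cnorm (b - x) < e ->
    exists2 b, Julia1 gam (Some b) & chain (fun w => J w) (3 * e) gam.[z] b.
  move=> /bdKg_Julia Jb Qx bx; exists b => //; apply: Qend Qx _ bx; exact: Julia1_sub.
have Q0 x : L 0%N x -> Q x by move=> Lx; apply: (Qlev 0%N p1) => //; apply/L0E.
(* If the curve [L 0] leaves [Kg], it meets the boundary of [Kg] up to [e]; if [p1] is already
   outside, the segment from [gam.[z]] to [p1] does. *)
have [[p2 Lp2 nKp2]|inKg] := pselect (exists2 p, L 0%N p & ~ Kg p).
  have [Kp1|nKp1] := pselect (Kg p1); last first.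
    have [b bb ball] := Kg_boundary (Kg_sub Kz1) nKp1.
    apply: (finish b p1 bb Qp1); apply: ball; last by rewrite subrr cnorm0.
    by rewrite cdistC; apply: lt_le_trans p1z te.
  have L1 : L 0%N p1 by apply/L0E.
  have [x [w [cx Kx nKw Lw wx]]] := chain_exit (S_level_chain (SL 0%N) e0 L1 Lp2) Kp1 nKp2.
  have [b bb ball] := Kg_boundary Kx nKw; apply: (finish b x bb).
    by apply: Q0; case: (chain_in cx).
  by apply: ball; rewrite ?subrr ?cnorm0.
have subKg x : cnorm f.[x] <= r -> Kg x.
  move=> fx h Ch; apply: (sublevel_max (S1 Sf) (ltW r0)) fx => v fv.
  have [Kv|nKv] := pselect (Kg v); first exact: Kv.
  by case: inKg; exists v => //; apply/L0E.
have hit j p : L j p -> Q p -> cnorm (p - a) < e ->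
    exists2 b, Julia1 gam (Some b) & chain (fun w => J w) (3 * e) gam.[z] b.
  by move=> Lp Qp pa; apply: (finish a p) => //; rewrite cdistC.
(* If [L 0] and [L 1] come within [s], pulling back by gam^j brings [L j] and [L j.+1] within [e];
   so [Q] spreads to [L m0], which passes between [w0] and [w']. *)
have [[p [p' [Lp Lp' pp']]]|far] := pselect (exists p p', [/\ L 0%N p, L 1%N p' & cnorm (p - p') < s]).
  have Qj j : (j <= m0)%N -> forall x, L j x -> Q x.
    elim: j => [_|j IH jm]; first exact: Q0.
    have [y hy] := poly_surj p (sz j); have jm' := ltnW jm.
    have Ly : L j y by apply/LE; rewrite hy; apply/L0E.
    have [y' hy' yy'] : exists2 y', (iterp gam j).[y'] = p' & cnorm (y' - y) < e.
      by apply: hs1 jm' _ _ _; rewrite hy; apply: lt_le_trans pp' _; rewrite ge_min lexx.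
    have Ly' : L j.+1 y'.
      by apply/LE; rewrite iterpS hy'; move/LE: Lp'; rewrite iterpS iterp0.
    have Qy' : Q y' := Qnear j.+1 y y' (leqW jm) (IH jm' _ Ly) Ly' yy'.
    by move=> x Lx; apply: (Qlev j.+1 y' x (leqW jm)).
  have h0 : cnorm (f \Po iterp gam m0).[w0] <= r by rewrite horner_comp; exact: Kw0.
  have h' : r <= cnorm (f \Po iterp gam m0).[w'].
    by rewrite horner_comp leNgt; apply/negP => /ltW/subKg/Kg_back; exact: nKw'.
  have [b fb ball] := level_cross h0 h'.
  exact: (hit m0 b fb (Qj m0 (leqnn _) b fb) (ball a e w0a w'a)).
(* Otherwise [L 1], which contains [y1] near [z], cannot cross [L 0] and stays in {|f| <= r}. By the
   maximum principle this sublevel set is backward invariant; it contains [w0] but not [w'], so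
   [L 0] itself passes near [a]. *)
have {}far p p' : L 0%N p -> L 1%N p' -> s <= cnorm (p - p').
  by move=> Lp Lp'; rewrite leNgt; apply/negP => lt; apply: far; exists p, p'.
have L1y1 : L 1%N y1 by apply/LE; rewrite iterpS iterp0 gy1.
have fy1 : cnorm f.[y1] <= r.
  rewrite leNgt; apply/negP => /ltW lt.
  have [b /L0E Lb ball] := level_cross (Kz _ Sf) lt.
  have := far _ _ Lb L1y1; rewrite leNgt ball //; first by rewrite cdistC.
  by rewrite subrr cnorm0.
have fL1 x : cnorm (f \Po iterp gam 1).[x] = r -> cnorm f.[x] <= r.
  move=> Lx; apply: contrapT => nfx.
  have [v [w [cv fv nfw Lw wv]]] := chain_exit (P := fun v => cnorm f.[v] <= r) (S_level_chain (SL 1%N) s0 L1y1 Lx) fy1 nfx.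
  have fw : r <= cnorm f.[w] by move/negP: nfw; rewrite -ltNge => /ltW.
  have [b /L0E Lb ball] := level_cross fv fw.
  have := far _ _ Lb Lw; rewrite leNgt ball //; first by rewrite cdistC.
  by rewrite subrr cnorm0.
have back1 x : cnorm f.[gam.[x]] <= r -> cnorm f.[x] <= r.
  move=> fx; apply: (sublevel_max (S1 (SL 1%N)) (ltW r0) fL1).
  by rewrite horner_comp (iterpS gam) iterp0.
have backm m x : cnorm f.[(iterp gam m).[x]] <= r -> cnorm f.[x] <= r.
  elim: m x => [|m IH] x; first by rewrite iterp0.
  by rewrite iterpSr => /IH/back1.
have h0 : cnorm f.[w0] <= r by apply: (backm m0); exact: Kw0.
have h' : r <= cnorm f.[w'].
  by rewrite leNgt; apply/negP => /ltW/subKg; exact: nKw'.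
have [b /L0E Lb ball] := level_cross h0 h'.
exact: (hit 0%N b Lb (Q0 b Lb) (ball a e w0a w'a)).
Qed.

Lemma Khat_boundary z : bdKh S r z -> sboundary (Khat S) (Some z).
Proof.
have KE x : Khat S (Some x) <-> K x by apply: KhatE.
move=> [Kz nKz]; split=> d d0.
  by exists (Some z); [apply/KE | rewrite sdistzz].
have d2 : 0 < d / 2 by rewrite divr_gt0.
have [w wd nK] := nKz _ d2; exists (Some w); first by move=> /KE.
by apply: le_lt_trans (sdist_le_cdist _ _) _; rewrite cdistC; lra.
Qed.

Lemma component_refl z : J z -> component (Julia S) (Some z) (Some z).
Proof.
move=> Jz; exists (fun v => v = Some z); split=> //; first by move=> _ ->.
move=> [B1 [B2 [[s1 _] [s2 _] [v1 b1] [v2 b2] [_ dis]]]].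
by apply: (dis (Some z)); split; [rewrite -(s1 _ b1) | rewrite -(s2 _ b2)].
Qed.

Lemma bdKh_Jmin z b : bdKh S r z -> component (Julia S) (Some z) (Some b) -> Jmin S (Some b).
Proof.
move=> bz cb; exists (Some z); split=> //.
  move=> [A [AJ _ _ /AJ]]; exact: (Julia_finite S1 r0 esc).
exists (Some z); last exact: Khat_boundary.
exact: (component_refl (bdKh_Julia Scomp S1 r0 esc bz)).
Qed.

(** Interior points have interior images because [gam] is open. For boundary points, chains of every
    step from [gam.[z]] to J(gam) are merged by [chain_component]. The disc about [c] is the target
    for [montel_hit]. *)
Theorem map_Khat_interior z c (k : R) :
  (forall v, ~ (Julia1 gam v /\ Jmin S v)) ->
  0 < k -> (forall w, cnorm (w - c) < k -> K w) -> K z ->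
  exists2 d : R, 0 < d & forall w, cnorm (w - gam.[z]) < d -> K w.
Proof.
move=> hJ k0 hk Kz; have Kz1 := Kh_inv Scomp Sgam Kz; apply: not_bdKh => // bz1.
have [bz|nb] := pselect (bdKh S r z); last first.
  have [d d0 hd] := not_bdKh Kz nb; have [s s0 hs] := root_close d0 (S1 Sgam).
  have [w ws nK] := bz1.2 _ s0; apply: nK; rewrite cdistC in ws.
  have [y <- yz] := hs _ _ ws; apply: (Kh_inv Scomp Sgam); exact: hd.
have Jz1 : J gam.[z] := bdKh_Julia Scomp S1 r0 esc bz1.
have [b Jb cb] : exists2 b, Julia1 gam (Some b) & component (Julia S) (Some gam.[z]) (Some b).
  apply: (chain_component S1 r0 esc Jz1).
  - by move=> u l hu ul; apply: Julia_closed hu ul.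
  - by move=> b; apply: Julia1_sub.
  move=> e e0; have e3 : 0 < e / 3 by rewrite divr_gt0.
  have [b Jb cb] := boundary_chain bz bz1 k0 hk e3; exists b => //.
  by apply: chain_mono cb => //; lra.
by apply: (hJ (Some b)); split=> //; apply: bdKh_Jmin bz1 cb.
Qed.

End Cyclic.

(** * Uniform estimates over the generators *)

Section Uniformity.
Variable R : realType.
Implicit Types (x y w c : R[i]) (e : R) (p q g h : {poly R[i]}).

(* On [|w| = R1] the bound [rho <= |q|] bounds the leading coefficient of [q]
   below by [rho / (2 R1)^deg q], since all roots of [q] lie in [|w| < R1]. *)
Lemma uniform_escape (rho R1 : R) : 0 < rho -> 0 < R1 -> exists2 r : R, 0 < r &
  forall q, (2 < size q)%N -> (forall w, R1 <= cnorm w -> rho <= cnorm q.[w]) ->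
  forall w, r <= cnorm w -> 2 * cnorm w <= cnorm q.[w].
Proof.
move=> rho0 R10.
(* For |w| >= 4 R1, |q(w)| >= rho (|w| / (4 R1))^2 as the degree is at least 2; this reaches 2 |w|
   once |w| >= 32 R1^2 / rho. *)
exists (Num.max (4 * R1) (32 * R1 ^+ 2 / rho)); first by rewrite lt_max mulr_gt0.
move=> q sq hq w; rewrite ge_max => /andP[w1]; rewrite ler_pdivrMr // => w2.
have w0 : 0 < cnorm w by apply: lt_le_trans w1; rewrite mulr_gt0.
have [rs hrs] := closed_field_poly_normal q.
have q0 : q != 0 by rewrite -size_poly_gt0 (ltn_trans _ sq).
have szrs : size rs = (size q).-1.
  by rewrite {1}hrs size_scale ?lead_coef_eq0 // size_prod_XsubC.
have rsR z : z \in rs -> cnorm z < R1.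
  move=> zrs; rewrite ltNge; apply/negP => /hq; rewrite hrs hornerZ.
  have /eqP -> : root (\prod_(z <- rs) ('X - z%:P)) z by rewrite root_prod_XsubC.
  by rewrite mulr0 cnorm0 leNgt rho0.
have val x : cnorm q.[x] = cnorm (lead_coef q) * \prod_(z <- rs) cnorm (x - z).
  rewrite {1}hrs hornerZ cnormM horner_prod cnorm_prod; congr (_ * _).
  by apply: eq_bigr => z _; rewrite !hornerE.
set l := cnorm (lead_coef q) in val; have l0 : 0 <= l by exact: cnorm_ge0.
have low : rho <= l * (2 * R1) ^+ size rs.
  have := hq R1%:C; rewrite cnorm_real gtr0_norm // lexx val => /(_ isT) h; apply: le_trans h _.
  rewrite ler_wpM2l //; elim: (rs) rsR => [|z s IH] hs; first by rewrite big_nil expr0.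
  rewrite big_cons exprS; apply: ler_pM => //.
  - by elim/big_rec: _ => // i y _ h; rewrite mulr_ge0.
  - apply: le_trans (cnormB _ _) _; rewrite cnorm_real gtr0_norm //.
    by have := hs z (mem_head _ _); lra.
  - by apply: IH => y ys; apply: hs; rewrite inE ys orbT.
have big : l * (cnorm w / 2) ^+ size rs <= cnorm q.[w].
  rewrite val ler_wpM2l //; elim: (rs) rsR => [|z s IH] hs; first by rewrite big_nil expr0.
  rewrite big_cons exprS; apply: ler_pM => //.
  - by rewrite divr_ge0.
  - by rewrite exprn_ge0 // divr_ge0.
  - have := hs z (mem_head _ _); have := cnorm_le_dist w z; move: w1; lra.
  - by apply: IH => y ys; apply: hs; rewrite inE ys orbT.
apply: le_trans big; have R1n : R1 != 0 by rewrite gt_eqF.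
have -> : cnorm w / 2 = (2 * R1) * (cnorm w / (4 * R1)) by field.
rewrite exprMn mulrA.
have t1 : 1 <= cnorm w / (4 * R1) by rewrite ler_pdivlMr ?mulr_gt0 // mul1r.
apply: le_trans (_ : rho * (cnorm w / (4 * R1)) ^+ 2 <= _).
  have -> : rho * (cnorm w / (4 * R1)) ^+ 2 = rho * cnorm w * cnorm w / (16 * R1 ^+ 2) by field.
  rewrite ler_pdivlMr ?mulr_gt0 ?exprn_gt0 //.
  have -> : 2 * cnorm w * (16 * R1 ^+ 2) = (32 * R1 ^+ 2) * cnorm w by ring.
  by rewrite ler_pM2r // (mulrC rho).
apply: ler_pM; rewrite ?(ltW rho0) ?exprn_ge0 ?(le_trans ler01 t1) //.
by apply: ler_weXn2l => //; rewrite szrs -ltnS prednK // ltnW // ltnW.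
Qed.

(** Asking for [P n] on a whole neighbourhood makes [U n] open; a finite subcover and monotonicity
    in [n] leave one index. *)
Lemma compact_uniform (Gamma : {poly R[i]} -> Prop) (P : nat -> {poly R[i]} -> Prop) :
  poly_compact Gamma -> (forall m n q, (m <= n)%N -> P m q -> P n q) ->
  (forall p, Gamma p -> exists n, exists2 e : R, 0 < e &
     forall q, (forall z, sdist (pmap q z) (pmap p z) < e) -> P n q) ->
  exists n, forall p, Gamma p -> P n p.
Proof.
move=> Gc mono loc.
pose U n p := exists2 e : R, 0 < e & forall q, (forall z, sdist (pmap q z) (pmap p z) < e) -> P n q.
have [|p /loc[n]|s hs] := Gc nat U; last 2 first.
- by exists n.
- exists (\max_(i <- s) i) => p /hs[n [ns [e e0 he]]]; apply: (mono n).
    elim: s ns {hs} => // a s IH; rewrite big_cons => -[->|/IH h]; first exact: leq_maxl.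
    exact: leq_trans h (leq_maxr _ _).
  by apply: he => z; rewrite sdistzz.
move=> n p [e e0 he]; have e2 : 0 < e / 2 by rewrite divr_gt0.
exists (e / 2) => // q hq; exists (e / 2) => // q' hq'; apply: he => z.
by apply: le_lt_trans (sdist_triangle (pmap q z) _ _) _; have := hq z; have := hq' z; lra.
Qed.

Lemma near_uniform p (M e : R) : 0 < e -> exists2 d : R, 0 < d &
  forall q, (forall z, sdist (pmap q z) (pmap p z) < d) ->
  forall w, cnorm w <= M -> cnorm (q.[w] - p.[w]) < e.
Proof.
move=> e0; have [B B0 hB] := poly_bounded p M; have [d d0 hd] := cdist_of_sdist B e0.
exists d => // q hq w /hB pw; rewrite cdistC; apply: hd => //.
by rewrite sdistC; exact: (hq (Some w)).
Qed.

(** Spherical convergence is uniform on discs, where [p] is bounded. The Cauchy estimate on unit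
    discs, applied to the difference with [p], extends it to derivatives; hence the margin
    [M + 1]. *)
Lemma near_seq p (q : nat -> {poly R[i]}) (u : nat -> R[i]) l (M : R) :
  (forall n z, sdist (pmap (q n) z) (pmap p z) < n.+1%:R^-1) ->
  forall phi, extraction phi -> (forall n, cnorm (u n) <= M) -> ccvg u l ->
  ccvg (fun n => (q (phi n)).[u n]) p.[l] /\
  ccvg (fun n => (q (phi n))^`().[u n]) (p^`()).[l].
Proof.
move=> hq phi hphi uM ul.
have small (e : R) : 0 < e -> exists N, forall n, (N <= n)%N ->
    forall w, cnorm w <= M + 1 -> cnorm ((q (phi n)).[w] - p.[w]) < e.
  move=> e0; have [d d0 hd] := near_uniform p (M + 1) e0; have [N hN] := invn_lt d0.
  exists N => n Nn; apply: hd => z; apply: lt_trans (hq _ _) (hN _ _).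
  exact: leq_trans Nn (extraction_ge hphi n).
split=> e e0; have e4 : 0 < e / 4 by rewrite divr_gt0.
  have [N hN] := small _ e4; have [N' hN'] := ccvg_poly p ul e4.
  exists (maxn N N') => n; rewrite geq_max => /andP[/hN h /hN' h'].
  have := cdist_triangle p.[u n] (q (phi n)).[u n] p.[l]; have := h (u n).
  by have uM1 : cnorm (u n) <= M + 1 by [have := uM n; lra]; move=> /(_ uM1); move: h' e4; lra.
have [N hN] := small _ e4; have [N' hN'] := ccvg_poly (p^`()) ul e4.
exists (maxn N N') => n; rewrite geq_max => /andP[/hN h /hN' h'].
have := @cauchy_deriv _ (q (phi n) - p) (u n) 1 (e / 2) ltr01.
rewrite derivB !hornerE divr1 => /(_ _)-hc.
have {}hc : cnorm ((q (phi n))^`().[u n] - (p^`()).[u n]) <= e / 2.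
  apply: hc => w wu; rewrite !hornerE; apply: le_trans (cnormB _ _) _.
  have wM : cnorm w <= M + 1 by have := cnorm_le_dist w (u n); have := uM n; lra.
  have uM1 : cnorm (u n) <= M + 1 by have := uM n; lra.
  by have := h w wM; have := h _ uM1; lra.
have := cdist_triangle (p^`()).[u n] (q (phi n))^`().[u n] (p^`()).[l].
by move: h' e4; lra.
Qed.

Lemma deriv_root g : (2 < size g)%N -> exists c, (g^`()).[c] = 0.
Proof.
move=> sg; apply: poly_surj; rewrite ltnNge; apply/negP => le.
case E : (size g) sg => [|[|[|n]]] // _.
have : (g^`())`_n.+1 = 0 by rewrite nth_default // (leq_trans le).
rewrite coef_deriv; have := lead_coefE g; rewrite E /= => <- /eqP.
by rewrite mulrn_eq0 /= lead_coef_eq0 -size_poly_eq0 E.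
Qed.

End Uniformity.

(** * Words in the generators *)

Section Generators.
Variable R : realType.
Implicit Types (x y w c : R[i]) (e : R) (p q g h : {poly R[i]}).
Variables H Gamma : {poly R[i]} -> Prop.
Hypothesis Hcomp : comp_closed H.
Local Notation G := (generated (fun p => H p \/ Gamma p)).
Local Notation "A ^1" := (fun p : {poly R[i]} => p = 'X \/ A p) (at level 2, format "A ^1").

Lemma comp_unit (A : {poly R[i]} -> Prop) p q : comp_closed A -> A^1 p -> A q -> A (p \Po q).
Proof. by move=> Ac [->|Ap] Aq; [rewrite comp_polyX | apply: Ac]. Qed.

Lemma unit_comp (A : {poly R[i]} -> Prop) p q : comp_closed A -> A p -> A^1 q -> A (p \Po q).
Proof. by move=> Ac Ap [->|Aq]; [rewrite comp_polyXr | apply: Ac]. Qed.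

(** [h] collects the elements of H applied before the first one of Gamma; the adjoined identity
    allows it to be empty. The induction predicate [T] retains [G g], since the outer factor must be
    known to lie in G. *)
Lemma first_generator g : G g -> H g \/
  exists h gam g', [/\ H^1 h, Gamma gam, G^1 g' & g = g' \Po (gam \Po h)].
Proof.
pose T g := G g /\ (H g \/ exists h gam g', [/\ H^1 h, Gamma gam, G^1 g' & g = g' \Po (gam \Po h)]).
move=> Gg; suff [] : T g by []; apply: (Gg T) => [q hq|p q [Gp Tp] [Gq Tq]].
  split; first exact: generated_in.
  case: hq => [|Gq]; [by left | right].
  by exists 'X, q, 'X; split=> //; [left | left | rewrite comp_polyX comp_polyXr].
split; first exact: generated_comp.
case: Tq => [Hq|[h [gam [g' [h1 h2 h3 ->]]]]].
  case: Tp => [Hp|[h [gam [g' [h1 h2 h3 ->]]]]]; first by left; apply: Hcomp.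
  right; exists (h \Po q), gam, g'; split=> //; last by rewrite !comp_polyA.
  by right; exact: (comp_unit Hcomp h1 Hq).
right; exists h, gam, (p \Po g'); split=> //; last by rewrite !comp_polyA.
by right; exact: (unit_comp (@generated_comp _ _) Gp h3).
Qed.

(** The mirror decomposition: [h] collects what is applied after the last element of Gamma. *)
Lemma last_generator g : G g -> H g \/
  exists h gam g', [/\ H^1 h, Gamma gam, G^1 g' & g = h \Po (gam \Po g')].
Proof.
pose T g := G g /\ (H g \/ exists h gam g', [/\ H^1 h, Gamma gam, G^1 g' & g = h \Po (gam \Po g')]).
move=> Gg; suff [] : T g by []; apply: (Gg T) => [q hq|p q [Gp Tp] [Gq Tq]].
  split; first exact: generated_in.
  case: hq => [|Gq]; [by left | right].
  by exists 'X, q, 'X; split=> //; [left | left | rewrite comp_polyX comp_polyXr].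
split; first exact: generated_comp.
case: Tp => [Hp|[h [gam [g' [h1 h2 h3 ->]]]]].
  case: Tq => [Hq|[h [gam [g' [h1 h2 h3 ->]]]]]; first by left; apply: Hcomp.
  right; exists (p \Po h), gam, g'; split=> //; last by rewrite !comp_polyA.
  by right; exact: (unit_comp Hcomp Hp h1).
right; exists h, gam, (g' \Po q); split=> //; last by rewrite !comp_polyA.
by right; exact: (comp_unit (@generated_comp _ _) h3 Gq).
Qed.

End Generators.

Theorem theorem1p28 (R : realType) (H Gamma : {poly R[i]} -> Prop) :
  classG H ->
  poly_compact Gamma ->
  classGdis (generated (fun p => H p \/ Gamma p)) ->
  (forall gamma, Gamma gamma -> forall z,
      ~ (Julia1 gamma z /\ Jmin (generated (fun p => H p \/ Gamma p)) z)) ->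
  hyperbolic H ->
  (forall gamma, Gamma gamma -> forall z,
      ~ (critval gamma z /\ Jmin (generated (fun p => H p \/ Gamma p)) z)) ->
  hyperbolic (generated (fun p => H p \/ Gamma p)).
Proof.
move=> [[[h0 Hh0] _ Hcomp] H2 _] Gammac [[_ G2 [M hM]] _] hJ Hhyp hcrit.
set G := generated _ in G2 hM hJ hcrit *.
have Gcomp : comp_closed G := @generated_comp _ _.
have HG h : H h -> G h by move=> Hh; apply: generated_in; left.
have GamG g : Gamma g -> G g by move=> Gg; apply: generated_in; right.
have G1 g : G g -> (1 < size g)%N by move=> /G2/ltnW.
have H1 h : H h -> (1 < size h)%N by move=> /H2/ltnW.
(* Chordal closeness [d1] to infinity yields modulus above 1, the lower bound fed to
   [uniform_escape]. *)
have [d1 d10 hd1] := @sdist_inf_gt R 1.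
(* Infinity is a critical value of every element of [H], hence lies in [F(H)] *)
have [rH rH0 escH] : exists2 r : R, 0 < r &
    forall h, H h -> forall w, r <= cnorm w -> 2 * cnorm w <= cnorm h.[w].
  have FH : Fatou H None.
    by apply: Hhyp => d d0; exists None; rewrite ?sdistzz //; exists h0 => //; right; split=> //; exact: H2.
  have [d2 d20 hd2] := Fatou_equicts H1 FH d10; have [K hK] := sdist_inf_lt d20.
  have K0 : 0 < `|K| + 1 by rewrite ltr_wpDl.
  have [r r0 hr] := uniform_escape (ltr01 : 0 < 1 :> R) K0; exists r => // h Hh.
  apply: hr (H2 _ Hh) _ => w Kw; apply/ltW/hd1; rewrite sdistC.
  have := hd2 _ Hh (Some w); rewrite (pmap_inf (H1 _ Hh)); apply.
  by rewrite sdistC; apply: hK; have := ler_norm K; move: Kw; lra.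
(* Outside a disc [p] is within [d1 / 2] of infinity, so generators near [p] are within [d1];
   compactness makes the disc uniform. *)
have [rG rG0 escGam] : exists2 r : R, 0 < r &
    forall g, Gamma g -> forall w, r <= cnorm w -> 2 * cnorm w <= cnorm g.[w].
  have [n hn] : exists n : nat, forall g, Gamma g -> forall w, n.+1%:R <= cnorm w -> 1 <= cnorm g.[w].
    apply: (compact_uniform (P := fun n g => forall w, n.+1%:R <= cnorm w -> 1 <= cnorm g.[w])) Gammac _ _.
      by move=> m n q mn hq w nw; apply: hq; apply: le_trans nw; rewrite ler_nat.
    move=> p /GamG/G1 sp; have d12 : 0 < d1 / 2 by rewrite divr_gt0.
    have [K hK] := sdist_inf_lt d12; have [K' hK'] := poly_infty K sp.
    exists (Num.bound `|K'|); exists (d1 / 2) => // q hq w nw; apply/ltW/hd1.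
    apply: le_lt_trans (sdist_triangle (Some p.[w]) _ _) _.
    have : K' <= cnorm w.
      have := @archi_boundP _ `|K'| (normr_ge0 _); have := ler_norm K'.
      by move: nw; rewrite -addn1 natrD; lra.
    by move=> /hK'/hK; have := hq (Some w); rewrite /pmap; lra.
  have n0 : 0 < n.+1%:R :> R by rewrite ltr0n.
  have [r r0 hr] := uniform_escape (ltr01 : 0 < 1 :> R) n0; exists r => // g Gg.
  exact: (hr g (G2 _ (GamG _ Gg)) (hn g Gg)).
pose r := Num.max rH rG; have r0 : 0 < r by rewrite lt_max rH0.
have esc g : G g -> forall w, r <= cnorm w -> 2 * cnorm w <= cnorm g.[w].
  move=> /(_ (fun g => forall w, r <= cnorm w -> 2 * cnorm w <= cnorm g.[w])); apply.
    by move=> q [Hq|Gq] w; rewrite ge_max => /andP[w1 w2]; [exact: escH | exact: escGam].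
  move=> p q hp hq w rw; rewrite horner_comp; have qw := hq w rw.
  have := hp q.[w]; have := cnorm_ge0 w; move: r0 rw qw.
  by move=> ? ? ? ? /(_ _)-hh; apply: le_trans (hh _); lra.
pose K := Kh G r.
(* By the chain rule [c] is critical for every [h \Po g], so the G-orbit of [g.[c]] consists of
   critical values of G, bounded by [M]. *)
have crit g c : G g -> (g^`()).[c] = 0 -> K g.[c].
  move=> Gg gc; apply/(KhatE Gcomp r0 esc); exists g.[c] => //; exists M => h Gh.
  rewrite -horner_comp; apply: hM => d d0; exists (Some (h \Po g).[c]); last by rewrite sdistzz.
  exists (h \Po g); first exact: Gcomp.
  by left; exists c; split=> //; rewrite deriv_comp hornerM gc mulr0.
have critK g : G g -> forall c, (g^`()).[c] = 0 -> K g.[c] by move=> Gg c; apply: crit.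
have crit_int g c : Gamma g -> (g^`()).[c] = 0 ->
    exists2 d : R, 0 < d & forall w, cnorm (w - g.[c]) < d -> K w.
  move=> Gg gc; apply: not_bdKh; first exact: crit (GamG _ Gg) gc.
  move=> bd; apply: (hcrit _ Gg (Some g.[c])); split; first by left; exists c.
  apply: (bdKh_Jmin Gcomp G1 r0 esc bd); apply: component_refl.
  exact: (bdKh_Julia Gcomp G1 r0 esc bd).
(* The disc inside K that [map_Khat_interior] asks for surrounds a critical value of [g]. *)
have map_int g x : Gamma g -> K x -> exists2 d : R, 0 < d & forall w, cnorm (w - g.[x]) < d -> K w.
  move=> Gg Kx; have [c gc] := deriv_root (G2 _ (GamG _ Gg)).
  have [d d0 hd] := crit_int _ _ Gg gc.
  exact: (map_Khat_interior Gcomp G1 r0 esc (GamG _ Gg) critK (hJ _ Gg) d0 hd Kx).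
have Kb x : K x -> cnorm x <= r by move=> Kx; apply/ltW/(Kh_lt r0 esc (HG _ Hh0) Kx).
have contr (p : {poly R[i]}) (v w : nat -> R[i]) l : (exists2 d : R, 0 < d & forall w, cnorm (w - l) < d -> K w) ->
    ccvg v l -> forall phi, extraction phi -> (forall n, cnorm (v n - w n) < (phi n).+1%:R^-1 /\ ~ K (w n)) -> False.
  move=> [d d0 hd] vl phi hphi hw.
  have wl : ccvg w l.
    apply: ccvg_close vl _ => n; apply: lt_le_trans (hw n).1 _; exact: inv_extraction.
  by have [N /(_ _ (leqnn _)) hN] := wl _ d0; apply: (hw N).2; apply: hd.
(* Both ends are thickened: the source for images under H that are only close to K, the target to
   leave a disc of K around [g.[y]]. *)
have [n1 hn1] : exists n, forall g, Gamma g -> forall x y w, K x -> cnorm (y - x) < n.+1%:R^-1 ->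
    cnorm (w - g.[y]) < n.+1%:R^-1 -> K w.
  have [] // := @compact_uniform R Gamma (fun n g => Gamma g -> forall x y w, K x -> cnorm (y - x) < n.+1%:R^-1 ->
    cnorm (w - g.[y]) < n.+1%:R^-1 -> K w) Gammac.
  - move=> m n q mn hq Gq x y w Kx yx wq.
    have mn' : n.+1%:R^-1 <= m.+1%:R^-1 :> R by rewrite lef_pV2 ?posrE ?ltr0n // ler_nat.
    by apply: (hq Gq x y) => //; apply: lt_le_trans mn'.
  - move=> p Gp; apply: contrapT => bad.
    have /choice[t ht] : forall n : nat, exists t : {poly R[i]} * (R[i] * R[i] * R[i]),
      [/\ forall z, sdist (pmap t.1 z) (pmap p z) < n.+1%:R^-1, K t.2.1.1,
         cnorm (t.2.1.2 - t.2.1.1) < n.+1%:R^-1, cnorm (t.2.2 - t.1.[t.2.1.2]) < n.+1%:R^-1 & ~ K t.2.2].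
      move=> n; apply: contrapT => h; apply: bad; exists n; exists n.+1%:R^-1.
        by rewrite invr_gt0 ltr0n.
      move=> q hq Gq x y w Kx yx wq; apply: contrapT => nK; apply: h.
      by exists (q, (x, y, w)).
    have xb n : cnorm (t n).2.1.1 <= r by apply: Kb; case: (ht n).
    have [phi hphi [x hx]] := bolzano xb.
    have Kx : K x by apply: (@Kh_closed _ G r) hx => n; case: (ht (phi n)).
    have yb n : cnorm (t (phi n)).2.1.2 <= r + 1.
      have [_ _ yx _ _] := ht (phi n); have := xb (phi n).
      have i1 : (phi n).+1%:R^-1 <= 1 :> R by rewrite invf_le1 ?ler1n ?ltr0n.
      have := cnorm_le_dist (t (phi n)).2.1.2 (t (phi n)).2.1.1.
      by have := lt_le_trans yx i1; clear; lra.
    have hy : ccvg (fun n => (t (phi n)).2.1.2) x.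
      apply: ccvg_close hx _ => n; have [_ _ yx _ _] := ht (phi n).
      by rewrite /= cdistC; apply: lt_le_trans yx _; exact: inv_extraction.
    have [qy _] := near_seq (q := fun n => (t n).1) (fun n z => let: And5 h _ _ _ _ := ht n in h z) hphi yb hy.
    apply: (contr p _ (fun n => (t (phi n)).2.2) _ (map_int _ _ Gp Kx) qy phi hphi) => n.
    by have [_ _ _ wq nK] := ht (phi n); rewrite cdistC.
  by move=> n hn; exists n => g Gg; apply: hn.
have [n2 hn2] : exists n, forall g, Gamma g -> forall c w, (g^`()).[c] = 0 ->
    cnorm (w - g.[c]) < n.+1%:R^-1 -> K w.
  have [] // := @compact_uniform R Gamma (fun n g => Gamma g -> forall c w, (g^`()).[c] = 0 ->
    cnorm (w - g.[c]) < n.+1%:R^-1 -> K w) Gammac.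
  - move=> m n q mn hq Gq c w qc wq.
    have mn' : n.+1%:R^-1 <= m.+1%:R^-1 :> R by rewrite lef_pV2 ?posrE ?ltr0n // ler_nat.
    by apply: (hq Gq c) => //; apply: lt_le_trans mn'.
  - move=> p Gp; apply: contrapT => bad.
    have /choice[t ht] : forall n : nat, exists t : {poly R[i]} * (R[i] * R[i]),
      [/\ forall z, sdist (pmap t.1 z) (pmap p z) < n.+1%:R^-1, Gamma t.1,
         (t.1^`()).[t.2.1] = 0, cnorm (t.2.2 - t.1.[t.2.1]) < n.+1%:R^-1 & ~ K t.2.2].
      move=> n; apply: contrapT => h; apply: bad; exists n; exists n.+1%:R^-1.
        by rewrite invr_gt0 ltr0n.
      move=> q hq Gq c w qc wq; apply: contrapT => nK; apply: h.
      by exists (q, (c, w)).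
    (* Critical points stay bounded: beyond [r] their values would be beyond [r] too, hence outside
       K. *)
    have cb n : cnorm (t n).2.1 <= r.
      have [_ Gq qc _ _] := ht n; rewrite leNgt; apply/negP => /ltW rc.
      have := escape_ge r0 esc (GamG _ Gq) rc; rewrite ltNge Kb //.
      exact: crit (GamG _ Gq) qc.
    have [phi hphi [c hc]] := bolzano cb.
    have [qc dqc] := near_seq (q := fun n => (t n).1) (fun n z => let: And5 h _ _ _ _ := ht n in h z) hphi (fun n => cb (phi n)) hc.
    have pc : (p^`()).[c] = 0.
      apply: (ccvg_unique dqc) => e e0; exists 0%N => n _.
      by have [_ _ -> _ _] := ht (phi n); rewrite subrr cnorm0.
    apply: (contr p _ (fun n => (t (phi n)).2.2) _ (crit_int _ _ Gp pc) qc phi hphi) => n.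
    by have [_ _ _ wq nK] := ht (phi n); rewrite cdistC.
  by move=> n hn; exists n => g Gg; apply: hn.
pose eta : R := Num.min n1.+1%:R^-1 n2.+1%:R^-1.
have eta0 : 0 < eta by rewrite lt_min !invr_gt0 !ltr0n.
have eta1 : eta <= n1.+1%:R^-1 by rewrite ge_min lexx.
have eta2 : eta <= n2.+1%:R^-1 by rewrite ge_min lexx orbT.
have unif1 g x y : Gamma g -> K x -> cnorm (y - x) < eta -> forall w, cnorm (w - g.[y]) < eta -> K w.
  by move=> Gg Kx yx w wy; apply: (hn1 _ Gg x y w Kx); apply: lt_le_trans eta1.
have unif2 g c : Gamma g -> (g^`()).[c] = 0 -> forall w, cnorm (w - g.[c]) < eta -> K w.
  by move=> Gg gc w wy; apply: (hn2 _ Gg c w gc); apply: lt_le_trans eta2.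
clearbody eta.
case=> [z|] Pz; last exact: (outside_Fatou G1 r0 esc).
have near_crit (d : R) : 0 < d -> exists g c, [/\ G g, (g^`()).[c] = 0 & cnorm (g.[c] - z) < d].
  move=> /(sphere_near z)[d' /Pz[v [g Gg gv] zv] /(_ _ zv)[y vy yz]]; exists g.
  move: gv yz; rewrite vy => -[[c [gc [->]]]|[]] // yz.
  by exists c.
have Kz : K z.
  have /choice[u hu] : forall n : nat, exists u, K u /\ cnorm (u - z) < n.+1%:R^-1.
    move=> n; have [|g [c [Gg gc cz]]] := near_crit n.+1%:R^-1; first by rewrite invr_gt0 ltr0n.
    by exists g.[c]; split=> //; exact: crit.
  apply: (@Kh_closed _ G r u); first by move=> n; case: (hu n).
  by apply: ccvg_close (ccvg_cst _) _ => n; rewrite cdistC; case: (hu n).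
have [bz|/(not_bdKh Kz)[d d0 hd]] := pselect (bdKh G r z); last exact: interior_Fatou d0 hd.
exfalso; have [_ nKz] := bz.
have [PH|nPH] := pselect (Pset H (Some z)).
  have eqz := Fatou_equicts H1 (Hhyp _ PH).
  (* [eta] is for words in which a generator of Gamma follows the initial part in H, [r] for an
     escaping element of H itself. *)
  have m0 : 0 < Num.min eta r by rewrite lt_min eta0.
  have [d d0 hd] := equicts_dist r eqz m0.
  have d'0 : 0 < Num.min d eta by rewrite lt_min d0.
  have [w] := nKz _ d'0; rewrite lt_min => /andP[wd weta] /not_KhP[g Gg rg].
  have [Hg|[h [gam [g' [Hh Ggam Gg' gE]]]]] := first_generator Hcomp Gg.
    have Hgg := Hcomp _ _ Hg Hg; have := hd _ Hgg (Kz _ (HG _ Hgg)) _ wd.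
    rewrite lt_min => /andP[_]; have := Kz _ (HG _ Hgg); rewrite !horner_comp.
    have := esc _ Gg _ (ltW rg); have := cnorm_le_dist g.[g.[w]] g.[g.[z]].
    by rewrite cdistC; move: rg; lra.
  have Kgam : K gam.[h.[w]].
    have Khz : K h.[z].
      by case: Hh => [->|Hh]; [rewrite hornerX | apply: (Kh_inv Gcomp (HG _ Hh))].
    apply: (unif1 gam h.[z] h.[w] Ggam Khz); last by rewrite subrr cnorm0.
    case: Hh => [->|Hh]; first by rewrite !hornerX.
    have := hd _ Hh (Kz _ (HG _ Hh)) _ wd.
    by rewrite lt_min cdistC => /andP[].
  move: rg; rewrite gE !horner_comp ltNge; apply/negP/negPn.
  by case: Gg' => [->|Gg']; [rewrite hornerX; apply: Kb | apply: Kgam].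
have [d0 d00 hd0] : exists2 d : R, 0 < d & forall h c, H h -> (h^`()).[c] = 0 -> d <= cnorm (h.[c] - z).
  move: nPH => /existsNP[d /not_implyP[d0 nex]]; exists (d / 2); first by rewrite divr_gt0.
  move=> h c Hh hc; rewrite leNgt; apply/negP => lt; apply: nex.
  exists (Some h.[c]); first by exists h => //; left; exists c.
  by apply: le_lt_trans (sdist_le_cdist _ _) _; rewrite cdistC; lra.
(* Outside this disc |h(w)| >= 2 |w| is too large for [h.[w]] to be within [d0] of [z]. *)
pose B := Num.max r (cnorm z + d0).
have B0 : 0 < B by rewrite lt_max r0.
(* As |b - u| < 2 t, the first bound keeps [b] in the range of [branch_near], the second serves when
   no element of H follows the generator, and the third bounds the displacement 16 B t / d0 of the
   inverse branch by eta / 2. *)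
pose t := Num.min (d0 / 16) (Num.min (eta / 4) (eta * d0 / (32 * B))).
have t0 : 0 < t.
  by rewrite !lt_min !divr_gt0 ?mulr_gt0.
have [t1 t2 t3] : [/\ t <= d0 / 16, t <= eta / 4 & t * (32 * B) <= eta * d0].
  split; rewrite /t ?ge_min ?lexx ?orbT //.
  by rewrite -ler_pdivlMr ?mulr_gt0 // !ge_min lexx !orbT.
have [g [x [Gg gx uz]]] := near_crit _ t0; have [b bz' nKb] := nKz _ t0.
set u := g.[x] in uz.
have bu : cnorm (b - u) < 2 * t.
  by have := cdist_triangle z b u; rewrite (cdistC z u); lra.
have [Hg|[h [gam [g' [Hh Ggam Gg' gE]]]]] := last_generator Hcomp Gg.
  by have := hd0 _ _ Hg gx; rewrite -/u; lra.
(* [l] is the value just before the final part in H. It is deep in K wherever the critical point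
   arises: [d0] excludes [h], [unif2] settles [gam], and [unif1] at a critical value settles
   [g']. *)
pose l := gam.[g'.[x]].
have ul : u = h.[l] by rewrite /u gE !horner_comp.
have deepl : forall w, cnorm (w - l) < eta -> K w.
  have : (h^`()).[l] * ((gam^`()).[g'.[x]] * (g'^`()).[x]) = 0.
    by rewrite -[RHS]gx gE !deriv_comp !hornerM !horner_comp.
  move=> /eqP; rewrite !mulf_eq0 => /orP[/eqP hl|/orP[/eqP gaml|/eqP g'x]].
  - case: Hh hl => [->|Hh] hl; first by move: hl => /eqP; rewrite derivX hornerC oner_eq0.
    by have := hd0 _ _ Hh hl; rewrite -ul; lra.
  - exact: unif2.
  - case: Gg' g'x => [->|Gg'] g'x; first by move: g'x => /eqP; rewrite derivX hornerC oner_eq0.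
    by apply: (unif1 gam g'.[x] g'.[x] Ggam (crit _ _ Gg' g'x)); rewrite subrr cnorm0.
case: Hh => [hX|Hh].
  apply: nKb; apply: deepl; move: ul; rewrite hX hornerX => <-; lra.
have [||||//|b' hb' b'l] := @branch_near R h u l b (d0 / 2) B (H1 _ Hh).
- by rewrite divr_gt0.
- by move=> c /(hd0 _ _ Hh); have := cdist_triangle u h.[c] z; lra.
- move=> w wu; rewrite leNgt; apply/negP; rewrite gt_max => /andP[/ltW rw].
  have := esc _ (HG _ Hh) _ rw; have := cnorm_le_dist h.[w] z.
  by have := cdist_triangle u h.[w] z; have := cnorm_ge0 w; move: t1 d00; lra.
- by [].
- by lra.
(* The preimage [b'] of [b] falls in the disc of K about [l], so forward invariance would put [b] in
   K. *)
apply: nKb; rewrite -hb'; apply: (Kh_inv Gcomp (HG _ Hh)); apply: deepl.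
apply: le_lt_trans b'l _.
have -> : 4 * B / (d0 / 2) * cnorm (b - u) = 8 * B * cnorm (b - u) / d0.
  by field; rewrite gt_eqF.
rewrite ltr_pdivrMr //; apply: lt_le_trans (_ : _ < 8 * B * (2 * t)) _.
  by rewrite ltr_pM2l // mulr_gt0.
by have := mulr_gt0 t0 B0; lra.
Qed.
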